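(* The system $\mathsf{RCA}_0^\omega$ proves $\Delta\text{-}\mathsf{CA}\to\mathsf{NBI}$, while $\mathsf{Z}_2^\omega+\Delta\text{-}\mathsf{CA}$ does not prove $\mathsf{NIN}$. Here: $\Delta\text{-}\mathsf{CA}$: for $i=0,1$, all $Y_i^2$ and $A_i(n)\equiv(\exists f\in\mathbb{N}^{\mathbb{N}})(Y_i(f,n)=0)$: $(\forall n\in\mathbb{N})(A_0(n)\leftrightarrow\neg A_1(n))\to(\exists X\subset\mathbb{N})(\forall n\in\mathbb{N})(n\in X\leftrightarrow A_0(n))$. $\mathsf{NIN}$: for any $Y:[0,1]\to\mathbb{N}$ there are $x,y\in[0,1]$ with $x\neq_{\mathbb{R}}y$ and $Y(x)=Y(y)$. $\mathsf{NBI}$: for any $Y:[0,1]\to\mathbb{N}$, either there are $x,y\in[0,1]$ with $x\neq_{\mathbb{R}}y$ and $Y(x)=Y(y)$, or there is $N\in\mathbb{N}$ with $(\forall x\in[0,1])(Y(x)\neq N)$.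
   Context: Finite types: $0$ is a type (natural numbers), and if $\sigma,\tau$ are types then so is $\sigma\to\tau$; $1:=0\to 0$ and $n+1:=n\to 0$; superscripts indicate types. $\mathsf{L}_\omega$ is the many-sorted language with variables of every finite type, constants $0,1,<_0,+_0,\times_0,=_0$ (with usual meaning), typed combinators $\Pi,\Sigma$, and recursor constants $\mathbf{R}_\sigma$. For $\tau=(\tau_1\to\dots\to\tau_k\to 0)$, $x=_\tau y$ abbreviates $\forall z_1^{\tau_1}\dots z_k^{\tau_k}(xz_1\dots z_k=_0 yz_1\dots z_k)$. $\mathsf{QF\text{-}AC}^{\sigma,\tau}$ is the schema $(\forall x^\sigma)(\exists y^\tau)A(x,y)\to(\exists Y^{\sigma\to\tau})(\forall x^\sigma)A(x,Y(x))$ for quantifier-free $A$ of $\mathsf{L}_\omega$. $\mathsf{RCA}_0^\omega$ (Kohlenbach's base theory, classical logic) has the following axioms: ordered semi-ring axioms for $0,1,<_0,+_0,\times_0$; defining axioms of $\Pi,\Sigma$ (giving $\lambda$-abstraction); $\mathbf{R}_0(f,m,0)=m$ and $\mathbf{R}_0(f,m,n+1)=f(n,\mathbf{R}_0(f,m,n))$; extensionality $x=_\rho y\to\varphi(x)=_\tau\varphi(y)$ for all types $\rho,\tau$; induction for quantifier-free formulas of $\mathsf{L}_\omega$; and $\mathsf{QF\text{-}AC}^{1,0}$. Finite sequences and tuples are coded as usual. For $g^1$, $\overline{g}n$ is the (code of the) sequence $\langle g(0),\dots,g(n-1)\rangle$. $(\mathsf{S}_k^2)$ is the axiom stating the existence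 of a type 2 functional $\mathsf{S}_k^2$ with values in $\{0,1\}$ deciding the truth of $\Sigma^1_k$-formulas of second-order arithmetic (function parameters allowed), e.g. for $k=1$: $(\forall f^1)[(\exists g^1)(\forall n^0)(f(\overline{g}n)=0)\leftrightarrow \mathsf{S}_1(f)=0]$, and for general $k$ the same with the normal form of $\Sigma^1_k$-formulas. $\mathsf{Z}_2^\omega:=\bigcup_k(\mathsf{RCA}_0^\omega+(\mathsf{S}_k^2))$. Inside these theories a real is a sequence of rationals $(q_n)$ with $|q_n-q_{n+i}|<2^{-n}$ for all $n,i$; reals $x,y$ represented by $(q_n),(r_n)$ satisfy $x=_{\mathbb{R}}y$ iff $|q_n-r_n|\le 2^{-n+1}$ for all $n$. Functions on $[0,1]$ or $\mathbb{R}$ with values in $\mathbb{N}$ or $\mathbb{R}$ are objects of the corresponding finite type that map $=_{\mathbb{R}}$-equal reals to equal values. *)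

(* Defs.v *)
From Stdlib Require Import List.
Import ListNotations.

Set Implicit Arguments.
Unset Strict Implicit.
Unset Printing Implicit Defensive.

(** Syntax is intrinsically typed: a context lists the types of the free
    variables, and variables are typed de Bruijn indices. *)

Inductive ty : Type :=
| ty0 : ty
| Arr : ty -> ty -> ty.

Declare Scope ty_scope.
Delimit Scope ty_scope with ty.
Bind Scope ty_scope with ty.
Infix "~>" := Arr (at level 70, right associativity) : ty_scope.
Open Scope ty_scope.

Notation ty1 := (ty0 ~> ty0).
Notation ty2 := (ty1 ~> ty0).

Definition ctx := list ty.

Inductive var : ctx -> ty -> Type :=
| vz : forall G s, var (s :: G) s
| vs : forall G s t, var G s -> var (t :: G) s.
Arguments vz {G s}.
Arguments vs {G s t} x.

(** [Rec s] is the recursor of type [s]; it is part of the language for all [s],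
    although the base theory only has axioms for [Rec ty0]. *)
Inductive tm (G : ctx) : ty -> Type :=
| Var : forall s, var G s -> tm G s
| App : forall s t, tm G (s ~> t) -> tm G s -> tm G t
| Zero : tm G ty0
| One : tm G ty0
| Add : tm G (ty0 ~> ty0 ~> ty0)
| Mul : tm G (ty0 ~> ty0 ~> ty0)
| Pi : forall s t, tm G (s ~> t ~> s)
| Sig : forall r s t, tm G ((r ~> s ~> t) ~> (r ~> s) ~> r ~> t)
| Rec : forall s, tm G ((ty0 ~> s ~> s) ~> s ~> ty0 ~> s).
Arguments Var {G s} x.
Arguments App {G s t} a b.
Arguments Zero {G}.
Arguments One {G}.
Arguments Add {G}.
Arguments Mul {G}.
Arguments Pi {G s t}.
Arguments Sig {G r s t}.
Arguments Rec {G s}.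

Inductive form (G : ctx) : Type :=
| Eq : tm G ty0 -> tm G ty0 -> form G
| Lt : tm G ty0 -> tm G ty0 -> form G
| Bot : form G
| And : form G -> form G -> form G
| Or : form G -> form G -> form G
| Imp : form G -> form G -> form G
| All : forall s, form (s :: G) -> form G
| Ex : forall s, form (s :: G) -> form G.
Arguments Bot {G}.
Arguments All {G} s A.
Arguments Ex {G} s A.

Notation sentence := (form []).

Definition Neg G (A : form G) : form G := Imp A Bot.
Definition Iff G (A B : form G) : form G := And (Imp A B) (Imp B A).

Declare Scope tm_scope.
Delimit Scope tm_scope with tm.
Bind Scope tm_scope with tm.
Infix "@" := App (at level 25, left associativity) : tm_scope.
Notation "a + b" := (Add @ a @ b)%tm : tm_scope.
Notation "a * b" := (Mul @ a @ b)%tm : tm_scope.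
Notation "0" := Zero : tm_scope.
Notation "1" := One : tm_scope.
Notation v0 := (Var vz).
Notation v1 := (Var (vs vz)).
Notation v2 := (Var (vs (vs vz))).

Declare Scope form_scope.
Delimit Scope form_scope with form.
Bind Scope form_scope with form.
Infix "==" := Eq (at level 70, no associativity) : form_scope.
Infix "<<" := Lt (at level 70, no associativity) : form_scope.
Notation "a <<= b" := (Or (Lt a b) (Eq a b))
  (at level 70, no associativity) : form_scope.
Infix "/\" := And : form_scope.
Infix "\/" := Or : form_scope.
Notation "~ A" := (Neg A) : form_scope.
Infix "-->" := Imp (at level 90, right associativity) : form_scope.
Infix "<-->" := Iff (at level 95, no associativity) : form_scope.

Definition renaming (G D : ctx) : Type := forall s, var G s -> var D s.
Definition substitution (G D : ctx) : Type := forall s, var G s -> tm D s.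

Definition wk G t : renaming G (t :: G) := fun s x => vs x.

Definition nil_ren G : renaming [] G := fun s x =>
  match x in var D _ return match D with [] => var G s | _ :: _ => unit end with
  | vz => tt
  | vs _ => tt
  end.

Definition lift_ren G D t (r : renaming G D) : renaming (t :: G) (t :: D) :=
  fun s x =>
  match x in var G' s'
  return match G' with
         | [] => unit
         | u :: G0 => renaming G0 D -> var (u :: D) s'
         end with
  | vz => fun _ => vz
  | vs y => fun r => vs (r _ y)
  end r.

Fixpoint ren_tm G D (r : renaming G D) s (a : tm G s) : tm D s :=
  match a with
  | Var x => Var (r _ x)
  | App f b => App (ren_tm r f) (ren_tm r b)
  | Zero => Zero
  | One => One
  | Add => Add
  | Mul => Mul
  | Pi => Pi
  | Sig => Sig
  | Rec => Rec
  end.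

Fixpoint ren_form G D (r : renaming G D) (A : form G) : form D :=
  match A with
  | Eq a b => Eq (ren_tm r a) (ren_tm r b)
  | Lt a b => Lt (ren_tm r a) (ren_tm r b)
  | Bot => Bot
  | And A B => And (ren_form r A) (ren_form r B)
  | Or A B => Or (ren_form r A) (ren_form r B)
  | Imp A B => Imp (ren_form r A) (ren_form r B)
  | All s A => All s (ren_form (lift_ren r) A)
  | Ex s A => Ex s (ren_form (lift_ren r) A)
  end.

Notation "a ^^" := (ren_tm (@wk _ _) a) (at level 5, format "a ^^") : tm_scope.

Definition scons G D t (a : tm D t) (e : substitution G D) :
    substitution (t :: G) D :=
  fun s x =>
  match x in var G' s'
  return match G' with
         | [] => unit
         | u :: G0 => tm D u -> substitution G0 D -> tm D s'
         end with
  | vz => fun a _ => a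
  | vs y => fun _ e => e _ y
  end a e.

Definition lift_subst G D t (e : substitution G D) :
    substitution (t :: G) (t :: D) :=
  scons v0 (fun s x => ren_tm (@wk D t) (e s x)).

Fixpoint subst_tm G D (e : substitution G D) s (a : tm G s) : tm D s :=
  match a with
  | Var x => e _ x
  | App f b => App (subst_tm e f) (subst_tm e b)
  | Zero => Zero
  | One => One
  | Add => Add
  | Mul => Mul
  | Pi => Pi
  | Sig => Sig
  | Rec => Rec
  end.

Fixpoint subst_form G D (e : substitution G D) (A : form G) : form D :=
  match A with
  | Eq a b => Eq (subst_tm e a) (subst_tm e b)
  | Lt a b => Lt (subst_tm e a) (subst_tm e b)
  | Bot => Bot
  | And A B => And (subst_form e A) (subst_form e B)
  | Or A B => Or (subst_form e A) (subst_form e B)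
  | Imp A B => Imp (subst_form e A) (subst_form e B)
  | All s A => All s (subst_form (lift_subst e) A)
  | Ex s A => Ex s (subst_form (lift_subst e) A)
  end.

Definition inst G t (A : form (t :: G)) (a : tm G t) : form G :=
  subst_form (scons a (fun s x => Var x)) A.

(** Universal closure, used for axiom schemas with parameters. *)
Fixpoint close (G : ctx) : form G -> sentence :=
  match G with
  | [] => fun A => A
  | s :: G => fun A => close (All s A)
  end.

Definition theory := sentence -> Prop.

Definition extend (T : theory) (B : sentence) : theory :=
  fun A => T A \/ A = B.

(** Classical natural deduction; equality is a logical symbol at type [ty0]
    only, and [T |- A] in context [G] may use any of the variables of [G]. *)
Inductive nd (T : theory) : forall G, list (form G) -> form G -> Prop :=
| nd_ax : forall G (H : list (form G)) A,
    T A -> nd T H (ren_form (nil_ren G) A)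
| nd_hyp : forall G (H : list (form G)) A,
    In A H -> nd T H A
| nd_raa : forall G (H : list (form G)) A,
    nd T (Neg A :: H) Bot -> nd T H A
| nd_andI : forall G (H : list (form G)) A B,
    nd T H A -> nd T H B -> nd T H (And A B)
| nd_andE1 : forall G (H : list (form G)) A B,
    nd T H (And A B) -> nd T H A
| nd_andE2 : forall G (H : list (form G)) A B,
    nd T H (And A B) -> nd T H B
| nd_orI1 : forall G (H : list (form G)) A B,
    nd T H A -> nd T H (Or A B)
| nd_orI2 : forall G (H : list (form G)) A B,
    nd T H B -> nd T H (Or A B)
| nd_orE : forall G (H : list (form G)) A B C,
    nd T H (Or A B) -> nd T (A :: H) C -> nd T (B :: H) C -> nd T H C
| nd_impI : forall G (H : list (form G)) A B,
    nd T (A :: H) B -> nd T H (Imp A B)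
| nd_impE : forall G (H : list (form G)) A B,
    nd T H (Imp A B) -> nd T H A -> nd T H B
| nd_allI : forall G (H : list (form G)) s (A : form (s :: G)),
    nd T (map (ren_form (@wk G s)) H) A -> nd T H (All s A)
| nd_allE : forall G (H : list (form G)) s (A : form (s :: G)) (a : tm G s),
    nd T H (All s A) -> nd T H (inst A a)
| nd_exI : forall G (H : list (form G)) s (A : form (s :: G)) (a : tm G s),
    nd T H (inst A a) -> nd T H (Ex s A)
| nd_exE : forall G (H : list (form G)) s (A : form (s :: G)) (C : form G),
    nd T H (Ex s A) ->
    nd T (A :: map (ren_form (@wk G s)) H) (ren_form (@wk G s) C) ->
    nd T H C
| nd_eq_refl : forall G (H : list (form G)) a,
    nd T H (Eq a a)
| nd_eq_subst : forall G (H : list (form G)) (A : form (ty0 :: G)) a b,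
    nd T H (Eq a b) -> nd T H (inst A a) -> nd T H (inst A b).

Definition proves (T : theory) (A : sentence) : Prop := @nd T [] [] A.

Local Open Scope tm_scope.
Local Open Scope form_scope.

Fixpoint eq_at (t : ty) : forall G, tm G t -> tm G t -> form G :=
  match t with
  | ty0 => fun G x y => x == y
  | Arr s t => fun G x y => All s (eq_at (x^^ @ v0) (y^^ @ v0))
  end.

Fixpoint qf G (A : form G) : Prop :=
  match A with
  | Eq _ _ | Lt _ _ | Bot => True
  | And A B | Or A B | Imp A B => qf A /\ qf B
  | All _ _ | Ex _ _ => False
  end.

(** Discreteness of the order and the existence of predecessors are not listed:
    they follow by quantifier-free induction and recursion. *)
Definition semiring_axioms : list sentence :=
  [ All ty0 (All ty0 (All ty0 ((v2 + v1) + v0 == v2 + (v1 + v0))));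
    All ty0 (All ty0 (v1 + v0 == v0 + v1));
    All ty0 (v0 + 0 == v0);
    All ty0 (All ty0 (All ty0 ((v2 * v1) * v0 == v2 * (v1 * v0))));
    All ty0 (All ty0 (v1 * v0 == v0 * v1));
    All ty0 (v0 * 1 == v0);
    All ty0 (v0 * 0 == 0);
    All ty0 (All ty0 (All ty0 (v2 * (v1 + v0) == v2 * v1 + v2 * v0)));
    All ty0 (~ (v0 << v0));
    All ty0 (All ty0 (All ty0 (v2 << v1 --> v1 << v0 --> v2 << v0)));
    All ty0 (All ty0 (v1 << v0 \/ v1 == v0 \/ v0 << v1));
    All ty0 (All ty0 (All ty0 (v2 << v1 --> v2 + v0 << v1 + v0)));
    All ty0 (All ty0 (All ty0 (0 << v0 --> v2 << v1 --> v2 * v0 << v1 * v0)));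
    0 << 1;
    All ty0 (0 <<= v0) ].

Definition qf_induction G (A : form (ty0 :: G)) : form G :=
  inst A 0
  --> All ty0 (A --> subst_form (scons (v0 + 1) (fun s x => Var (vs x))) A)
  --> All ty0 A.

Definition choice (s t : ty) G (A : form (t :: s :: G)) : form G :=
  All s (Ex t A)
  --> Ex (s ~> t) (All s
        (subst_form (scons (v1 @ v0) (scons v0 (fun u x => Var (vs (vs x))))) A)).

Inductive RCA0w : theory :=
| RCA0w_semiring : forall A, In A semiring_axioms -> RCA0w A
| RCA0w_Pi : forall s t,
    RCA0w (All s (All t (eq_at (Pi @ v1 @ v0) v1)))
| RCA0w_Sig : forall r s t,
    RCA0w (All (r ~> s ~> t) (All (r ~> s) (All r
             (eq_at (Sig @ v2 @ v1 @ v0) (v2 @ v0 @ (v1 @ v0))))))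
| RCA0w_Rec_zero :
    RCA0w (All (ty0 ~> ty0 ~> ty0) (All ty0 (Rec @ v1 @ v0 @ 0 == v0)))
| RCA0w_Rec_succ :
    RCA0w (All (ty0 ~> ty0 ~> ty0) (All ty0 (All ty0
             (Rec @ v2 @ v1 @ (v0 + 1) == v2 @ v0 @ (Rec @ v2 @ v1 @ v0)))))
| RCA0w_ext : forall s t,
    RCA0w (All (s ~> t) (All s (All s
             (eq_at v1 v0 --> eq_at (v2 @ v1) (v2 @ v0)))))
| RCA0w_QFIA : forall G (A : form (ty0 :: G)),
    qf A -> RCA0w (close (qf_induction A))
| RCA0w_QFAC : forall G (A : form (ty0 :: ty1 :: G)),
    qf A -> RCA0w (close (choice A)).

(** Abstraction, by the usual combinator translation. *)
Definition lam_var G s t (x : var (s :: G) t) : tm G (s ~> t) :=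
  match x in var D t'
  return match D with [] => unit | u :: G0 => tm G0 (u ~> t') end with
  | @vz G0 u => Sig @ @Pi G0 u (u ~> u) @ @Pi G0 u u
  | vs y => Pi @ Var y
  end.

Fixpoint lam G s t (a : tm (s :: G) t) : tm G (s ~> t) :=
  match a with
  | Var x => lam_var x
  | App f b => Sig @ lam f @ lam b
  | Zero => Pi @ Zero
  | One => Pi @ One
  | Add => Pi @ Add
  | Mul => Pi @ Mul
  | Pi => Pi @ Pi
  | Sig => Pi @ Sig
  | Rec => Pi @ Rec
  end.

(** In the step term [f] of [rec f m n], [v1] is the stage and [v0] the value
    obtained so far. *)
Definition rec G (f : tm (ty0 :: ty0 :: G) ty0) (m n : tm G ty0) : tm G ty0 :=
  Rec @ lam (lam f) @ m @ n.

Definition pred G (n : tm G ty0) : tm G ty0 := rec v1 0 n.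

Definition monus G (m n : tm G ty0) : tm G ty0 := rec (pred v0) m n.

(** [a] if [c] is zero, [b] otherwise. *)
Definition ifz G (c a b : tm G ty0) : tm G ty0 := rec b^^^^ a c.

Definition pow2 G (n : tm G ty0) : tm G ty0 := rec (v0 + v0) 1 n.

(** The Cantor pairing function [(a + b)(a + b + 1)/2 + b]. *)
Definition tri G (n : tm G ty0) : tm G ty0 := rec (v0 + (v1 + 1)) 0 n.
Definition pair G (a b : tm G ty0) : tm G ty0 := tri (a + b) + b.

(** The largest [w] with [tri w <= z]. *)
Definition diag G (z : tm G ty0) : tm G ty0 :=
  rec (ifz (monus (tri (v0 + 1)) (v1 + 1)) (v0 + 1) v0) 0 z.
Definition psnd G (z : tm G ty0) : tm G ty0 := monus z (tri (diag z)).
Definition pfst G (z : tm G ty0) : tm G ty0 := monus (diag z) (psnd z).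

(** The code of [<g(0), ..., g(n-1)>]: the empty sequence has code [0], and
    appending [x] to the sequence coded by [s] gives [pair s x + 1]. *)
Definition bar G (g : tm G ty1) (n : tm G ty0) : tm G ty0 :=
  rec (pair v0 (g^^^^ @ v1) + 1) 0 n.

(** [<a_1, ..., a_k>] as an iterated pair, with [<a_1> = a_1]. *)
Definition tuple G (l : list (tm G ty0)) : tm G ty0 :=
  match l with
  | [] => 0
  | a :: l => fold_left (@pair G) l a
  end.

(** [k] alternating function quantifiers, starting with an existential one iff
    [b], followed by the number quantifier of the next kind, applied to
    [f <g_1|n, ..., g_m|n> = 0], where [gs] lists the functions
    quantified so far. *)
Fixpoint normal_form (k : nat) (b : bool) G (f : tm G ty1)
    (gs : list (tm G ty1)) : form G :=
  match k with
  | O =>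
      let matrix : form (ty0 :: G) :=
        f^^ @ tuple (map (fun g => bar g^^ v0) gs) == 0 in
      if b then Ex ty0 matrix else All ty0 matrix
  | S k =>
      let body : form (ty1 :: G) :=
        normal_form k (negb b) f^^ (map (fun g => g^^) gs ++ [v0]) in
      if b then Ex ty1 body else All ty1 body
  end.

Definition Sk (k : nat) : sentence :=
  Ex ty2
    (All ty1 (v1 @ v0 == 0 \/ v1 @ v0 == 1)
     /\ All ty1 (normal_form k true v0 [] <--> v1 @ v0 == 0)).

(** The axioms of all the theories [RCA0w + Sk k] together: since a derivation
    uses finitely many axioms and [Sk (k + 1)] yields [Sk k], this proves the
    same sentences as the union of those theories. *)
Definition Z2w : theory :=
  fun A => (RCA0w A \/ exists k : nat, (1 <= k)%nat /\ A = Sk k)%type.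

(** Every number codes a rational: [pair (pair a b) c] codes
    [(a - b) / (c + 1)]. *)
Definition qpos G (q : tm G ty0) : tm G ty0 := pfst (pfst q).
Definition qneg G (q : tm G ty0) : tm G ty0 := psnd (pfst q).
Definition qden G (q : tm G ty0) : tm G ty0 := psnd q + 1.

(** [q < r + e / 2^n] and [q <= r + e / 2^n], with denominators cleared and
    negative terms moved to the other side. *)
Definition rat_lt G (q r e n : tm G ty0) : form G :=
  pow2 n * (qpos q * qden r + qneg r * qden q)
  << pow2 n * (qneg q * qden r + qpos r * qden q) + e * (qden q * qden r).
Definition rat_le G (q r e n : tm G ty0) : form G :=
  pow2 n * (qpos q * qden r + qneg r * qden q)
  <<= pow2 n * (qneg q * qden r + qpos r * qden q) + e * (qden q * qden r).

(** [|q_n - q_(n+i)| < 2^-n] for all [n] and [i]. *)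
Definition is_real G (x : tm G ty1) : form G :=
  All ty0 (All ty0
    (rat_lt (x^^^^ @ v1) (x^^^^ @ (v1 + v0)) 1 v1
     /\ rat_lt (x^^^^ @ (v1 + v0)) (x^^^^ @ v1) 1 v1)).

Definition le_real G (x y : tm G ty1) : form G :=
  All ty0 (rat_le (x^^ @ v0) (y^^ @ v0) (1 + 1) v0).

(** [|q_n - r_n| <= 2^(-n+1)] for all [n]. *)
Definition eq_real G (x y : tm G ty1) : form G :=
  All ty0
    (rat_le (x^^ @ v0) (y^^ @ v0) (1 + 1) v0
     /\ rat_le (y^^ @ v0) (x^^ @ v0) (1 + 1) v0).

Definition real_zero G : tm G ty1 := lam (pair (pair 0 0) 0).
Definition real_one G : tm G ty1 := lam (pair (pair 1 0) 0).

Definition in_unit G (x : tm G ty1) : form G :=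
  is_real x /\ le_real (real_zero G) x /\ le_real x (real_one G).

(** [Y] represents a function from [[0,1]] to the natural numbers: it respects
    equality of reals there, and is unconstrained on other arguments. *)
Definition unit_fun G (Y : tm G ty2) : form G :=
  All ty1 (All ty1
    (in_unit v1 /\ in_unit v0 /\ eq_real v1 v0
     --> Y^^^^ @ v1 == Y^^^^ @ v0)).

Definition not_injective G (Y : tm G ty2) : form G :=
  Ex ty1 (Ex ty1
    (in_unit v1 /\ in_unit v0 /\ ~ eq_real v1 v0
     /\ Y^^^^ @ v1 == Y^^^^ @ v0)).

Definition NIN : sentence :=
  All ty2 (unit_fun v0 --> not_injective v0).

Definition NBI : sentence :=
  All ty2 (unit_fun v0 -->
    not_injective v0
    \/ Ex ty0 (All ty1 (in_unit v0 --> ~ (v2 @ v0 == v1)))).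

(** A functional [Y(f, n)] of a function and a number argument is curried. *)
Notation ty_family := (ty1 ~> ty0 ~> ty0).

Definition sigma_of G (Y : tm G ty_family) (n : tm G ty0) : form G :=
  Ex ty1 (Y^^ @ v0 @ n^^ == 0).

(** Subsets of the natural numbers are given by characteristic functions. *)
Definition is_set G (X : tm G ty1) : form G :=
  All ty0 (X^^ @ v0 == 0 \/ X^^ @ v0 == 1).
Definition elem G (n : tm G ty0) (X : tm G ty1) : form G := X @ n == 1.

Definition DeltaCA : sentence :=
  All ty_family (All ty_family
    (All ty0 (sigma_of v2 v0 <--> ~ sigma_of v1 v0)
     --> Ex ty1 (is_set v0 /\ All ty0 (elem v0 v1 <--> sigma_of (Var (vs (vs (vs vz)))) v0)))).

(* Main.v *)
(** Positive part.  Suppose that [Y] is injective on [[0,1]] and takes every value, and let [x_N]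
    be the real with value [N].  The reals of a closed interval with dyadic end points are, up
    to equality of reals, the values of a term, so [x_N < q] and [q <= x_N] are both of the form
    [exists f, Y (t f) = N], and Delta-comprehension decides [x_N < q] for all [N] and all dyadic
    [q] at once.  Nested intervals then give a real different from all the [x_N].  The argument
    is carried out in an arbitrary extensional model of the base theory, and a Henkin
    construction turns it into a derivation.

    Negative part.  Force with injections from a part of Baire space into the numbers whose
    range has an infinite complement, together with finite sets of values that the range has to
    avoid.  A name of type [t] is a family of objects of type [t] of the full type structure,
    indexed by the total extensions of the generic injection; the names that exist at a
    condition are singled out by a Kripke logical relation.  What a condition says about a
    number only depends on its injection, and countably many dense sets of that kind have a
    dense intersection.  Hence every type 1 object is in the ground model, so that the truth
    functionals of the ground model witness [Sk k], and countably many existential statements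
    can be witnessed at once, which gives Delta-comprehension.  Composed with a choice of
    representatives of the reals, the generic injection is a counterexample to [NIN]. *)

Require Import Defs.
From Stdlib Require Import List FunctionalExtensionality Classical ClassicalEpsilon
  PropExtensionality Eqdep_dec PeanoNat Cantor Lia.
From mathcomp Require Import ssreflect.
Import ListNotations.
Import Defs.

Set Implicit Arguments.
Unset Strict Implicit.
Unset Printing Implicit Defensive.
Unset Asymmetric Patterns.
(* ssreflect opens a scope of the same name as the one of formulas. *)
Local Close Scope form_scope.

(** A bijection of the unit interval with the numbers would contradict Delta-comprehension, while an
    injection must not. This is why conditions can forbid values. A forced negation speaks about all
    extensions of a condition, hence about the forbidden values, and a limit of conditions forgets
    most of these; only existential information survives a limit. Delta-comprehension can live with
    that because both sides of its equivalence are existential. Indexing names by total oracles lets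
    terms be evaluated pointwise in the full type structure, so the equations of the combinators and
    recursors are inherited; the logical relation then discards the families on which forcing has no
    grip.

    In the positive half, Delta-comprehension only accepts an equation under one function
    quantifier, whereas being a real and lying below [q] need number quantifiers. Hence the search
    does not run over reals with a property, but over the parameters of a term all of whose values
    have it. Since the term reaches closed intervals only, a half-open interval is exhausted by
    closed ones, and the index of the closed interval is hidden in the first value of the
    parameter. *)

Lemma var_cons_ind s G (P : forall t, var (s :: G) t -> Prop) :
  P s vz -> (forall t (x : var G t), P t (vs x)) -> forall t x, P t x.
Proof.
move=> h0 hS t x.
refine (match x as x' in var D t' return
  match D as D' return var D' t' -> Prop with
  | [] => fun _ => True
  | u :: D0 => fun y => forall P : forall t, var (u :: D0) t -> Prop,
      P u vz -> (forall t z, P t (vs z)) -> P t' y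
  end x' with vz => _ | vs y => _ end P h0 hS); auto.
Qed.

Lemma var_nil_ind (P : forall t, var [] t -> Prop) t x : P t x.
Proof.
exact (match x as x' in var D t' return
  match D as D' return var D' t' -> Prop with
  | [] => fun y => P t' y
  | _ => fun _ => True end x' with vz => I | vs _ => I end).
Qed.

Lemma var_map_ext G (T : ty -> Type) (f g : forall s, var G s -> T s) :
  (forall s x, f s x = g s x) -> f = g.
Proof.
by move=> h; apply: functional_extensionality_dep => s;
   apply: functional_extensionality_dep => x.
Qed.

Lemma var_cons_ext s G (T : ty -> Type) (f g : forall t, var (s :: G) t -> T t) :
  f s vz = g s vz -> (forall t x, f t (vs x) = g t (vs x)) -> f = g.
Proof. by move=> h0 hS; apply: var_map_ext; apply: var_cons_ind. Qed.

Ltac env_ext := first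
  [ apply: (@var_cons_ext _ _ (var _)) | apply: (@var_cons_ext _ _ (tm _))
  | apply: (@var_cons_ext _ _ _) ].

Lemma var_nil_ext (T : ty -> Type) (f g : forall t, var [] t -> T t) : f = g.
Proof. apply: var_map_ext; exact: var_nil_ind. Qed.

(** * Renaming and substitution *)

Definition subst_id G : substitution G G := fun s x => Var x.

Lemma ren_tm_ren G D E (r : renaming G D) (r' : renaming D E) s (a : tm G s) :
  ren_tm r' (ren_tm r a) = ren_tm (fun s x => r' s (r s x)) a.
Proof. by elim: a => //= ? ? f -> a ->. Qed.

Lemma ren_form_ren G (A : form G) : forall D E (r : renaming G D) (r' : renaming D E),
  ren_form r' (ren_form r A) = ren_form (fun s x => r' s (r s x)) A.
Proof.
elim: A => {G} //= [G a b|G a b|G A IHA B IHB|G A IHA B IHB|G A IHA B IHB|G s A IH|G s A IH] D E r r';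
  rewrite ?ren_tm_ren ?IHA ?IHB //; rewrite IH; f_equal; f_equal;
  by env_ext.
Qed.

Lemma subst_tm_ren G D E (r : renaming G D) (e : substitution D E) s (a : tm G s) :
  subst_tm e (ren_tm r a) = subst_tm (fun s x => e s (r s x)) a.
Proof. by elim: a => //= ? ? f -> a ->. Qed.

Lemma subst_form_ren G (A : form G) : forall D E (r : renaming G D) (e : substitution D E),
  subst_form e (ren_form r A) = subst_form (fun s x => e s (r s x)) A.
Proof.
elim: A => {G} //= [G a b|G a b|G A IHA B IHB|G A IHA B IHB|G A IHA B IHB|G s A IH|G s A IH] D E r r';
  rewrite ?subst_tm_ren ?IHA ?IHB //; rewrite IH; f_equal; f_equal;
  by env_ext.
Qed.

Lemma ren_tm_subst G D E (e : substitution G D) (r : renaming D E) s (a : tm G s) :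
  ren_tm r (subst_tm e a) = subst_tm (fun s x => ren_tm r (e s x)) a.
Proof. by elim: a => //= ? ? f -> a ->. Qed.

Lemma ren_form_subst G (A : form G) : forall D E (e : substitution G D) (r : renaming D E),
  ren_form r (subst_form e A) = subst_form (fun s x => ren_tm r (e s x)) A.
Proof.
elim: A => {G} //= [G a b|G a b|G A IHA B IHB|G A IHA B IHB|G A IHA B IHB|G s A IH|G s A IH] D E r r';
  rewrite ?ren_tm_subst ?IHA ?IHB //; rewrite IH; f_equal; f_equal;
  env_ext => //= t x; by rewrite !ren_tm_ren.
Qed.

Lemma subst_tm_subst G D E (e : substitution G D) (e' : substitution D E) s (a : tm G s) :
  subst_tm e' (subst_tm e a) = subst_tm (fun s x => subst_tm e' (e s x)) a.
Proof. by elim: a => //= ? ? f -> a ->. Qed.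

Lemma subst_form_subst G (A : form G) : forall D E (e : substitution G D) (e' : substitution D E),
  subst_form e' (subst_form e A) = subst_form (fun s x => subst_tm e' (e s x)) A.
Proof.
elim: A => {G} //= [G a b|G a b|G A IHA B IHB|G A IHA B IHB|G A IHA B IHB|G s A IH|G s A IH] D E r r';
  rewrite ?subst_tm_subst ?IHA ?IHB //; rewrite IH; f_equal; f_equal;
  env_ext => //= t x; by rewrite subst_tm_ren ren_tm_subst.
Qed.

Lemma subst_tm_id G s (a : tm G s) : subst_tm (@subst_id G) a = a.
Proof. by elim: a => //= ? ? f -> a ->. Qed.

Lemma subst_form_id G (A : form G) : subst_form (@subst_id G) A = A.
Proof.
have lift G' t : lift_subst (@subst_id G') = @subst_id (t :: G') by env_ext.
by elim: A => {G} //= [G a b|G a b|G A IHA B IHB|G A IHA B IHB|G A IHA B IHB|G s A IH|G s A IH];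
  rewrite ?subst_tm_id ?IHA ?IHB ?lift ?IH.
Qed.

Lemma inst_wk_id G t (A : form (t :: G)) : inst (ren_form (lift_ren (@wk G t)) A) v0 = A.
Proof.
rewrite /inst subst_form_ren -[RHS]subst_form_id; congr (subst_form _ _); by env_ext.
Qed.

Lemma subst_tm_var G D (r : renaming G D) s (a : tm G s) :
  subst_tm (fun s x => Var (r s x)) a = ren_tm r a.
Proof. by elim: a => //= ? ? f -> a ->. Qed.

Lemma subst_form_var G (A : form G) : forall D (r : renaming G D),
  subst_form (fun s x => Var (r s x)) A = ren_form r A.
Proof.
elim: A => {G} //= [G a b|G a b|G A IHA B IHB|G A IHA B IHB|G A IHA B IHB|G s A IH|G s A IH] D r;
  rewrite ?subst_tm_var ?IHA ?IHB //; rewrite -IH; f_equal; f_equal;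
  by env_ext.
Qed.

Lemma inst_subst_lift G D (e : substitution G D) t (A : form (t :: G)) (a : tm D t) :
  inst (subst_form (lift_subst e) A) a = subst_form (scons a e) A.
Proof.
rewrite /inst subst_form_subst; congr (subst_form _ _).
env_ext => //= s x.
by rewrite subst_tm_ren subst_tm_id.
Qed.

Lemma ren_form_inst G D (r : renaming G D) t (A : form (t :: G)) (a : tm G t) :
  ren_form r (inst A a) = inst (ren_form (lift_ren r) A) (ren_tm r a).
Proof.
rewrite /inst ren_form_subst subst_form_ren; congr (subst_form _ _).
by env_ext.
Qed.

Lemma ren_form_wk G D (r : renaming G D) t (A : form G) :
  ren_form (lift_ren r) (ren_form (@wk G t) A) = ren_form (@wk D t) (ren_form r A).
Proof. by rewrite !ren_form_ren. Qed.

(** * Weakening and renaming of derivations *)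

Lemma nd_weaken T G (H : list (form G)) A : nd T H A ->
  forall H', incl H H' -> nd T H' A.
Proof.
elim => {G H A}.
- by move=> *; apply: nd_ax.
- by move=> G H A hA H' hi; apply: nd_hyp; apply: hi.
- move=> G H A _ IH H' hi; apply: nd_raa; apply: IH.
  by apply: incl_cons; [left|apply: incl_tl].
- by move=> G H A B _ IHA _ IHB H' hi; apply: nd_andI; [apply: IHA|apply: IHB].
- by move=> G H A B _ IH H' hi; apply: nd_andE1; apply: IH.
- by move=> G H A B _ IH H' hi; apply: nd_andE2; apply: IH.
- by move=> G H A B _ IH H' hi; apply: nd_orI1; apply: IH.
- by move=> G H A B _ IH H' hi; apply: nd_orI2; apply: IH.
- move=> G H A B C _ IH _ IHA _ IHB H' hi; apply: nd_orE; first exact: IH hi.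
  + by apply: IHA; apply: incl_cons; [left|apply: incl_tl].
  + by apply: IHB; apply: incl_cons; [left|apply: incl_tl].
- move=> G H A B _ IH H' hi; apply: nd_impI; apply: IH.
  by apply: incl_cons; [left|apply: incl_tl].
- by move=> G H A B _ IH _ IHA H' hi; apply: nd_impE; [apply: IH|apply: IHA].
- by move=> G H s A _ IH H' hi; apply: nd_allI; apply: IH; apply: incl_map.
- by move=> G H s A a _ IH H' hi; apply: nd_allE; apply: IH.
- by move=> G H s A a _ IH H' hi; apply: nd_exI; apply: IH.
- move=> G H s A C _ IH _ IHC H' hi; apply: nd_exE; first exact: IH hi.
  by apply: IHC; apply: incl_cons; [left|apply: incl_tl; apply: incl_map].
- by move=> *; apply: nd_eq_refl.
- by move=> G H A a b _ IH _ IHA H' hi; apply: nd_eq_subst; [apply: IH|apply: IHA].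
Qed.

(** Each Henkin step enlarges the context, so derivations have to be moved along [wk]. All renamings
    are treated at once because the quantifier rules turn [r] into [lift_ren r]. *)
Lemma nd_ren T G (H : list (form G)) A : nd T H A ->
  forall D (r : renaming G D), nd T (map (ren_form r) H) (ren_form r A).
Proof.
have mapwk G' D (r : renaming G' D) s (H' : list (form G')) :
    map (ren_form (lift_ren r)) (map (ren_form (@wk G' s)) H') =
    map (ren_form (@wk D s)) (map (ren_form r) H').
  by rewrite !map_map; apply: map_ext => B; apply: ren_form_wk.
elim => {G H A}.
- move=> G H A hA D r; rewrite ren_form_ren.
  have -> : (fun s x => r s (@nil_ren G s x)) = @nil_ren D by apply: (@var_nil_ext (var D)).
  exact: nd_ax.
- by move=> G H A hA D r; apply: nd_hyp; apply: in_map.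
- by move=> G H A _ IH D r; apply: nd_raa; apply: (IH D r).
- by move=> G H A B _ IHA _ IHB D r; apply: nd_andI; [apply: IHA|apply: IHB].
- by move=> G H A B _ IH D r; apply: nd_andE1; apply: (IH D r).
- by move=> G H A B _ IH D r; apply: nd_andE2; apply: (IH D r).
- by move=> G H A B _ IH D r; apply: nd_orI1; apply: (IH D r).
- by move=> G H A B _ IH D r; apply: nd_orI2; apply: (IH D r).
- move=> G H A B C _ IH _ IHA _ IHB D r.
  apply: nd_orE; [exact: (IH D r)|exact: (IHA D r)|exact: (IHB D r)].
- by move=> G H A B _ IH D r; apply: nd_impI; apply: (IH D r).
- by move=> G H A B _ IH _ IHA D r; apply: nd_impE; [apply: (IH D r)|apply: IHA].
- move=> G H s A _ IH D r; apply: nd_allI; rewrite -mapwk; exact: IH.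
- by move=> G H s A a _ IH D r; rewrite ren_form_inst; apply: nd_allE; apply: (IH D r).
- by move=> G H s A a _ IH D r; apply: (@nd_exI _ _ _ _ _ (ren_tm r a));
    rewrite -ren_form_inst; apply: IH.
- move=> G H s A C _ IH _ IHC D r; apply: nd_exE; first exact: (IH D r).
  by rewrite -mapwk -ren_form_wk; apply: (IHC _ (lift_ren r)).
- by move=> *; apply: nd_eq_refl.
- move=> G H A a b _ IH _ IHA D r; rewrite ren_form_inst.
  apply: nd_eq_subst; first exact: (IH D r).
  by rewrite -ren_form_inst; apply: IHA.
Qed.

(** * Structures and satisfaction *)

Record structure := Structure {
  dom : ty -> Type;
  app : forall s t, dom (s ~> t) -> dom s -> dom t;
  zeroM : dom ty0; oneM : dom ty0;
  addM : dom (ty0 ~> ty0 ~> ty0); mulM : dom (ty0 ~> ty0 ~> ty0);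
  piM : forall s t, dom (s ~> t ~> s);
  sigM : forall r s t, dom ((r ~> s ~> t) ~> (r ~> s) ~> r ~> t);
  recM : forall s, dom ((ty0 ~> s ~> s) ~> s ~> ty0 ~> s);
  eqM : dom ty0 -> dom ty0 -> Prop;
  ltM : dom ty0 -> dom ty0 -> Prop }.

Definition assign (T : ty -> Type) (G : ctx) := forall s, var G s -> T s.

Definition anil (T : ty -> Type) : assign T [] := fun s x =>
  match x in var D s' return match D with [] => T s' | _ => unit end with
  | vz => tt | vs _ => tt end.

Definition acons (T : ty -> Type) t G (a : T t) (e : assign T G) : assign T (t :: G) :=
  fun s x =>
  match x in var G' s'
  return match G' with
         | [] => unit
         | u :: G0 => T u -> assign T G0 -> T s'
         end with
  | vz => fun a _ => a
  | vs y => fun _ e => e _ y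
  end a e.

Arguments acons {T t G} a e s x.
Arguments anil {T} s x.

Section Sat.
Variable M : structure.

Fixpoint eval G s (a : tm G s) (e : assign (dom M) G) : dom M s :=
  match a with
  | Var x => e _ x
  | App f b => app (eval f e) (eval b e)
  | Zero => zeroM M
  | One => oneM M
  | Add => addM M
  | Mul => mulM M
  | Pi => @piM M _ _
  | Sig => @sigM M _ _ _
  | Rec => @recM M _
  end.

Fixpoint sat G (A : form G) : assign (dom M) G -> Prop :=
  match A with
  | Eq a b => fun e => eqM (eval a e) (eval b e)
  | Lt a b => fun e => ltM (eval a e) (eval b e)
  | Bot => fun _ => False
  | And A B => fun e => (sat A e /\ sat B e)%type
  | Or A B => fun e => (sat A e \/ sat B e)%type
  | Imp A B => fun e => sat A e -> sat B e
  | All s A => fun e => forall x : dom M s, sat A (acons x e)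
  | Ex s A => fun e => exists x : dom M s, sat A (acons x e)
  end.

Lemma eval_ren G D (r : renaming G D) s (a : tm G s) e :
  eval (ren_tm r a) e = eval a (fun s x => e s (r s x)).
Proof. by elim: a => //= ? ? f -> a ->. Qed.

Lemma eval_wk G t s (a : tm G s) (x : dom M t) e :
  eval (ren_tm (@wk G t) a) (acons x e) = eval a e.
Proof. by rewrite eval_ren. Qed.

Lemma eval_subst G D (r : substitution G D) s (a : tm G s) e :
  eval (subst_tm r a) e = eval a (fun s x => eval (r s x) e).
Proof. by elim: a => //= ? ? f -> a ->. Qed.

Lemma sat_subst G (A : form G) : forall D (r : substitution G D) e,
  sat (subst_form r A) e <-> sat A (fun s x => eval (r s x) e).
Proof.
have lift G' D (r : substitution G' D) e s (x : dom M s) :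
    (fun t (y : var (s :: G') t) => eval (lift_subst r y) (acons x e)) =
    acons x (fun t y => eval (r t y) e).
  by env_ext => //= t y; rewrite eval_wk.
elim: A => {G} //= [G a b|G a b|G A IHA B IHB|G A IHA B IHB|G A IHA B IHB|G s A IH|G s A IH] D r e;
  rewrite ?eval_subst ?IHA ?IHB //.
- by split=> h x; move: (h x); rewrite IH lift.
- by split=> -[x h]; exists x; move: h; rewrite IH lift.
Qed.

Lemma sat_inst G t (A : form (t :: G)) (a : tm G t) e :
  sat (inst A a) e <-> sat A (acons (eval a e) e).
Proof.
rewrite /inst sat_subst.
have -> // : (fun s x => eval (@scons G G t a (fun s x => Var x) s x) e) = acons (eval a e) e.
by env_ext.
Qed.

Lemma sat_close G (A : form G) : sat (close A) (@anil (dom M)) <-> forall e, sat A e.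
Proof.
elim: G A => [|s G IH] A /=.
  split=> [h e|]; last exact.
  by have -> : e = @anil (dom M) by apply: (@var_nil_ext (dom M)).
rewrite IH /=; split=> h e; last by move=> x; apply: h.
have -> : e = acons (e _ vz) (fun t x => e t (vs x)) by by env_ext.
exact: h.
Qed.

(** The two combinator equations are hypotheses, so that the lemma serves both the standard
    structure and arbitrary extensional models. *)
Lemma eval_lam :
  (forall s t (x : dom M s) (y : dom M t), app (app (@piM M s t) x) y = x) ->
  (forall r s t (x : dom M (r ~> s ~> t)) (y : dom M (r ~> s)) (z : dom M r),
     app (app (app (@sigM M r s t) x) y) z = app (app x z) (app y z)) ->
  forall G s t (a : tm (s :: G) t) e x, app (eval (lam a) e) x = eval a (acons x e).
Proof.
move=> hK hS G s t a e x.
elim: a => {t} [u y|u w f IHf b IHb|||||u w|r u w|u] /=; rewrite ?hK ?hS //; last by rewrite IHf IHb.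
move: u y; apply: var_cons_ind => [|u y] /=; by rewrite ?hS ?hK.
Qed.

End Sat.

Definition models (M : structure) (T : theory) := forall A, T A -> sat (M := M) A (@anil _).

(** * Completeness *)

Lemma ty_eq_dec (s t : ty) : {s = t} + {s <> t}.
Proof. decide equality. Qed.

Lemma existT_ty_inj (P : ty -> Type) s (x y : P s) : existT P s x = existT P s y -> x = y.
Proof. exact: (inj_pair2_eq_dec _ ty_eq_dec). Qed.

(** * Injective numberings of the syntax *)

Definition npair (a b : nat) : nat := Cantor.to_nat (a, b).

Lemma npair_inj a b c d : npair a b = npair c d -> a = c /\ b = d.
Proof. by move=> /Cantor.to_nat_inj [-> ->]. Qed.

Fixpoint code_ty (t : ty) : nat :=
  match t with ty0 => 0 | Arr s t => S (npair (code_ty s) (code_ty t)) end.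

Lemma code_ty_inj s t : code_ty s = code_ty t -> s = t.
Proof.
by elim: s t => [|s IHs s' IHs'] [|t t'] //= [/npair_inj [/IHs -> /IHs' ->]].
Qed.

Fixpoint code_var G s (x : var G s) : nat :=
  match x with vz => 0 | vs y => S (code_var y) end.

Lemma code_var_inj G s (x : var G s) s' (y : var G s') :
  code_var x = code_var y -> existT (var G) s x = existT (var G) s' y.
Proof.
move: s x s' y; elim: G => [|t G IH].
  by move=> s x; exact: (@var_nil_ind (fun _ _ => _) s x).
apply: var_cons_ind => [|s x]; apply: var_cons_ind => [|s' y] //= [e].
by have := IH _ _ _ _ e => E; have [e1] := E; subst s'; rewrite (existT_ty_inj E).
Qed.

Fixpoint code_tm G s (a : tm G s) : nat :=
  match a with
  | Var x => npair 0 (code_var x)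
  | App f b => npair 1 (npair (code_tm f) (code_tm b))
  | Zero => npair 2 0
  | One => npair 3 0
  | Add => npair 4 0
  | Mul => npair 5 0
  | @Pi _ s t => npair 6 (npair (code_ty s) (code_ty t))
  | @Sig _ r s t => npair 7 (npair (code_ty r) (npair (code_ty s) (code_ty t)))
  | @Rec _ s => npair 8 (code_ty s)
  end.

(** The types may differ: the code of an application does not record the type of its argument, so
    the induction has to recover it. *)
Lemma code_tm_inj G s (a : tm G s) s' (b : tm G s') :
  code_tm a = code_tm b -> existT (tm G) s a = existT (tm G) s' b.
Proof.
elim: a s' b => {s} [s x|s t f IHf a IHa|||||s t|r s t|s] s'
  [s1 y|s1 t1 f1 a1|||||s1 t1|r1 s1 t1|s1] //= /npair_inj [] // _.
- by move/code_var_inj => E; have [e1] := E; subst s1; rewrite (existT_ty_inj E).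
- move/npair_inj => [/IHf E /IHa E']; have [e1 e2] := E; subst s1 t1.
  by rewrite (existT_ty_inj E) (existT_ty_inj E').
- by move/npair_inj => [/code_ty_inj -> /code_ty_inj ->].
- by move/npair_inj => [/code_ty_inj -> /npair_inj [/code_ty_inj -> /code_ty_inj ->]].
- by move/code_ty_inj => ->.
Qed.

Lemma code_tm_inj' G s (a b : tm G s) : code_tm a = code_tm b -> a = b.
Proof. by move=> h; exact: (existT_ty_inj (code_tm_inj h)). Qed.

Fixpoint code_form G (A : form G) : nat :=
  match A with
  | Eq a b => npair 0 (npair (code_tm a) (code_tm b))
  | Lt a b => npair 1 (npair (code_tm a) (code_tm b))
  | Bot => npair 2 0
  | And A B => npair 3 (npair (code_form A) (code_form B))
  | Or A B => npair 4 (npair (code_form A) (code_form B))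
  | Imp A B => npair 5 (npair (code_form A) (code_form B))
  | All s A => npair 6 (npair (code_ty s) (code_form A))
  | Ex s A => npair 7 (npair (code_ty s) (code_form A))
  end.

Lemma code_form_inj G (A B : form G) : code_form A = code_form B -> A = B.
Proof.
elim: A B => {G} [G a b|G a b|G|G A IHA B IHB|G A IHA B IHB|G A IHA B IHB|G s A IH|G s A IH]
  [a1 b1|a1 b1||A1 B1|A1 B1|A1 B1|s1 A1|s1 A1] //= /npair_inj [] // _ /npair_inj [].
- by move=> /code_tm_inj' -> /code_tm_inj' ->.
- by move=> /code_tm_inj' -> /code_tm_inj' ->.
- by move=> /IHA -> /IHB ->.
- by move=> /IHA -> /IHB ->.
- by move=> /IHA -> /IHB ->.
- by move=> /code_ty_inj e; subst s1; move=> /IH ->.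
- by move=> /code_ty_inj e; subst s1; move=> /IH ->.
Qed.

Definition nth_form G (n : nat) : form G :=
  epsilon (inhabits Bot) (fun A => code_form A = n).

Lemma nth_form_code G (A : form G) : nth_form G (code_form A) = A.
Proof.
apply: code_form_inj.
by apply: (epsilon_spec (inhabits Bot) (fun B => code_form B = code_form A)); exists A.
Qed.

Lemma nd_cut T G (H : list (form G)) A B : nd T H A -> nd T (A :: H) B -> nd T H B.
Proof. by move=> hA hB; apply: nd_impE hA; apply: nd_impI. Qed.

(** * The Henkin construction *)

Section Henkin.
Variables (T : theory) (B0 : sentence).
Hypothesis unprovable : ~ proves T B0.

Definition consistent G (H : list (form G)) : Prop := ~ nd T H Bot.

(* [tasks i j] is the [j]-th formula in the variables available after [i] steps. *)
Record stage := Stage {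
  vars : ctx; hyps : list (form vars); tasks : nat -> nat -> form vars }.

(** The Cantor pairing has [i <= n] when [n] codes [(i, j)], so row [i] of the tasks is filled
    before step [n] reads it. *)
Definition task (n : nat) (S : stage) : form (vars S) :=
  tasks S (fst (Cantor.of_nat n)) (snd (Cantor.of_nat n)).

Definition decided (n : nat) (S : stage) : form (vars S) :=
  if excluded_middle_informative (consistent (task n S :: hyps S)) is left _
  then task n S else Neg (task n S).

(* Every step adds one variable; without an existential formula to witness it is a dummy. *)
Definition witness (n : nat) (S : stage) : {s : ty & form (s :: vars S)} :=
  match decided n S with
  | Ex s A => existT _ s A
  | _ => existT _ ty0 (Eq v0 v0)
  end.

(** Row [n + 1] of the tasks is filled here, since its context only comes into being at this step;
    the other rows are carried along by weakening. *)
Definition next (n : nat) (S : stage) : stage :=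
  let s := projT1 (witness n S) in
  {| vars := s :: vars S;
     hyps := projT2 (witness n S) :: map (ren_form (@wk (vars S) s)) (decided n S :: hyps S);
     tasks := fun i j => if Nat.eqb i (Datatypes.S n) then nth_form _ j
                         else ren_form (@wk (vars S) s) (tasks S i j) |}.

Fixpoint stg (n : nat) : stage :=
  match n with
  | O => {| vars := []; hyps := [Neg B0]; tasks := fun _ j => nth_form [] j |}
  | Datatypes.S n => next n (stg n)
  end.

Definition ctype (n : nat) : ty := projT1 (witness n (stg n)).

Lemma consistent_decided n S : consistent (hyps S) -> consistent (decided n S :: hyps S).
Proof.
move=> hc; rewrite /decided; case: excluded_middle_informative => // hn h.
apply: hc; apply: nd_cut h; apply: nd_impI; exact: NNPP hn.
Qed.

Lemma nd_witness n S : nd T (decided n S :: hyps S)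
  (Ex (projT1 (witness n S)) (projT2 (witness n S))).
Proof.
have dflt D : nd T (D :: hyps S) (Ex ty0 (Eq v0 v0)).
  by apply: (@nd_exI _ _ _ _ _ Zero); apply: nd_eq_refl.
rewrite /witness; case E : (decided n S) => [||||||s A|s A] /=; try exact: dflt.
by apply: nd_hyp; left.
Qed.

Lemma consistent_stg n : consistent (hyps (stg n)).
Proof.
elim: n => [|n IH] /=.
  by move=> h; apply: unprovable; apply: nd_raa.
move=> h; apply: (consistent_decided (n := n) IH).
apply: nd_exE (nd_witness n (stg n)) _; exact: h.
Qed.

(** The elements of the term model must not depend on a stage, while variables do. A witness is
    therefore named by the step that introduces it, and [real] reads it as a variable of any later
    stage. *)
Inductive itm : ty -> Type :=
| IConst : forall n, itm (ctype n)
| IApp : forall s t, itm (s ~> t) -> itm s -> itm t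
| IZero : itm ty0
| IOne : itm ty0
| IAdd : itm (ty0 ~> ty0 ~> ty0)
| IMul : itm (ty0 ~> ty0 ~> ty0)
| IPi : forall s t, itm (s ~> t ~> s)
| ISig : forall r s t, itm ((r ~> s ~> t) ~> (r ~> s) ~> r ~> t)
| IRec : forall s, itm ((ty0 ~> s ~> s) ~> s ~> ty0 ~> s).

Fixpoint closed_tm G (t : ty) : tm G t :=
  match t with ty0 => Zero | Arr s t => Pi @ closed_tm G t end.

Fixpoint lookup (N n : nat) : tm (vars (stg N)) (ctype n) :=
  match N with
  | O => closed_tm _ _
  | Datatypes.S N =>
      match Nat.eq_dec N n with
      | left e => match e in _ = m return tm (ctype N :: vars (stg N)) (ctype m) with eq_refl => v0 end
      | right _ => ren_tm (@wk _ _) (lookup N n)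
      end
  end.

(* Constants introduced after stage [N] get a junk value. *)
Fixpoint real (N : nat) s (a : itm s) : tm (vars (stg N)) s :=
  match a with
  | IConst n => lookup N n
  | IApp f b => App (real N f) (real N b)
  | IZero => Zero
  | IOne => One
  | IAdd => Add
  | IMul => Mul
  | IPi s t => Pi
  | ISig r s t => Sig
  | IRec s => Rec
  end.

Fixpoint height s (a : itm s) : nat :=
  match a with
  | IConst n => Datatypes.S n
  | IApp f b => max (height f) (height b)
  | _ => 0
  end.

Lemma real_wk N s (a : itm s) : height a <= N ->
  real (Datatypes.S N) a = ren_tm (@wk _ _) (real N a).
Proof.
elim: a => //= [n hn|{}s t f IHf a IHa h].
  by case: Nat.eq_dec => // e; lia.
by rewrite IHf ?IHa //; lia.
Qed.

Definition inst_at G (e : assign itm G) (N : nat) : substitution G (vars (stg N)) :=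
  fun s x => real N (e s x).

Definition bounded G (e : assign itm G) (N : nat) : Prop :=
  forall s (x : var G s), height (e s x) <= N.

Lemma bounded_ex G (e : assign itm G) : exists N, bounded e N.
Proof.
elim: G e => [|s G IH] e; first by exists 0 => s x; exact: (@var_nil_ind (fun _ _ => _) s x).
have [N hN] := IH (fun t x => e t (vs x)).
exists (max N (height (e s vz))); apply: var_cons_ind => [|t x]; first lia.
by have := hN t x; lia.
Qed.

Lemma bounded_le G (e : assign itm G) N N' : N <= N' -> bounded e N -> bounded e N'.
Proof. by move=> h hb s x; have := hb s x; lia. Qed.

Definition holds_at G (A : form G) (e : assign itm G) (N : nat) : Prop :=
  nd T (hyps (stg N)) (subst_form (inst_at e N) A).

Lemma subst_inst_at_S G (A : form G) e N : bounded e N ->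
  subst_form (inst_at e (Datatypes.S N)) A =
  ren_form (@wk _ _) (subst_form (inst_at e N) A).
Proof.
move=> hb; rewrite ren_form_subst; congr (subst_form _ _).
apply: var_map_ext => s x; exact: real_wk (hb s x).
Qed.

Lemma nd_next n A : nd T (decided n (stg n) :: hyps (stg n)) A ->
  nd T (hyps (stg (Datatypes.S n))) (ren_form (@wk _ _) A).
Proof.
move=> h; apply: nd_weaken (nd_ren h (@wk _ _)) _ _; exact: incl_tl (incl_refl _).
Qed.

Lemma holds_at_S G (A : form G) e N : bounded e N -> holds_at A e N ->
  holds_at A e (Datatypes.S N).
Proof.
move=> hb h; rewrite /holds_at subst_inst_at_S //; apply: nd_next.
by apply: nd_weaken h _ _; apply: incl_tl (incl_refl _).
Qed.

Lemma holds_at_le G (A : form G) e N N' : N <= N' -> bounded e N -> holds_at A e N ->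
  holds_at A e N'.
Proof.
move=> h hb; elim: h => // m hm IH hA; apply: holds_at_S (IH hA); exact: bounded_le hb.
Qed.

Definition holds G (A : form G) (e : assign itm G) : Prop :=
  exists2 N, bounded e N & holds_at A e N.

(** Finitely many premises hold together at a common stage, and a derivation that is uniform in the
    substitution can be carried out there. *)
Lemma holds_mp G (L : list (form G)) (A : form G) e :
  (forall D (r : substitution G D) H, (forall B, In B L -> nd T H (subst_form r B)) ->
     nd T H (subst_form r A)) ->
  (forall B, In B L -> holds B e) -> holds A e.
Proof.
move=> hA hL.
have [N hN hLN] : exists2 N, bounded e N & forall B, In B L -> holds_at B e N.
  elim: L hL {hA} => [|B L IH] hL; first by have [N hN] := bounded_ex e; exists N.
  have [N hN hLN] := IH (fun C hC => hL C (or_intror hC)).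
  have [N' hN' hB] := hL B (or_introl eq_refl).
  exists (max N N'); first by apply: bounded_le hN; lia.
  move=> C [<-|hC]; first by apply: holds_at_le hN' hB; lia.
  by apply: holds_at_le hN (hLN C hC); lia.
by exists N => //; apply: hA.
Qed.

Lemma holds_consistent G (A : form G) e : holds A e -> ~ holds (Neg A) e.
Proof.
move=> hA hn; have [N hN h] : holds (G := G) Bot e.
  apply: (holds_mp (L := [A; Neg A])) => [D r H h|C [<-|[<-|[]]]] //.
  by apply: nd_impE (h (Neg A) _) (h A _); [right; left|left].
exact: (@consistent_stg N).
Qed.

Lemma tasks_stg G (A : form G) e N k : bounded e N ->
  tasks (stg (k + N)) N (code_form (subst_form (inst_at e N) A)) =
  subst_form (inst_at e (k + N)) A.
Proof.
move=> hb; elim: k => [|k IH].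
  case: N hb => [|N] hb; first exact: nth_form_code.
  by rewrite /= Nat.eqb_refl nth_form_code.
rewrite /= (_ : Nat.eqb N (Datatypes.S (k + N)) = false); last by apply/Nat.eqb_neq; lia.
by rewrite IH -subst_inst_at_S //; apply: bounded_le hb; lia.
Qed.

Lemma task_ex G (A : form G) e N0 : bounded e N0 ->
  exists n, bounded e n /\ N0 <= n /\ task n (stg n) = subst_form (inst_at e n) A.
Proof.
move=> hb; set c := code_form (subst_form (inst_at e N0) A).
have hle : N0 <= npair N0 c.
  have := Cantor.to_nat_non_decreasing N0 c; rewrite /npair; lia.
exists (npair N0 c); split; first exact: bounded_le hb.
split=> //; have E : npair N0 c = (npair N0 c - N0) + N0 by lia.
have := @tasks_stg _ A e N0 (npair N0 c - N0) hb; rewrite -E -/c.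
by rewrite /task /npair Cantor.cancel_of_to.
Qed.

Lemma holds_decide G (A : form G) e : holds A e \/ holds (Neg A) e.
Proof.
have [N0 hN0] := bounded_ex e; have [n [hb [_ hn]]] := @task_ex _ A e N0 hN0.
have : nd T (decided n (stg n) :: hyps (stg n)) (decided n (stg n)) by apply: nd_hyp; left.
rewrite {2}/decided; case: excluded_middle_informative => _ /nd_next h; [left|right];
  exists (Datatypes.S n); try (apply: bounded_le hb; lia).
  by rewrite /holds_at subst_inst_at_S // -hn.
by rewrite /holds_at subst_inst_at_S //= -hn.
Qed.

Lemma lookup_S n : lookup (Datatypes.S n) n = (v0 : tm (ctype n :: vars (stg n)) (ctype n)).
Proof.
rewrite /=; case: Nat.eq_dec => // e.
by rewrite (UIP_dec Nat.eq_dec e eq_refl).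
Qed.

Lemma holds_witness G s (A : form (s :: G)) e : holds (Ex s A) e ->
  exists c : itm s, holds A (acons c e).
Proof.
move=> [N0 hN0 hA]; have [n [hb [hle hn]]] := @task_ex _ (Ex s A) e N0 hN0.
have {}hA : holds_at (Ex s A) e n by apply: holds_at_le hA.
(* The existential formula is already derivable at stage [n], so adding it is consistent and
   [decided] returns it. *)
have hdec : decided n (stg n) = Ex s (subst_form (lift_subst (inst_at e n)) A).
  rewrite /decided; case: excluded_middle_informative => [_|h]; first by rewrite hn.
  case: h => h; apply: (@consistent_stg n); rewrite hn in h; exact: nd_cut hA h.
have hw : witness n (stg n) = existT _ s (subst_form (lift_subst (inst_at e n)) A).
  by rewrite /witness hdec.
(* The type of the new constant is [s] only up to this equation; after rewriting with it, decidable
   equality of types lets the second components be compared. *)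
have es : s = ctype n by rewrite /ctype hw.
move: A hA hdec hw {hn}; rewrite es => A hA hdec hw.
have {}hw : projT2 (witness n (stg n)) = subst_form (lift_subst (inst_at e n)) A.
  apply: (existT_ty_inj (P := fun s => form (s :: vars (stg n)))).
  by rewrite -hw; exact: (eq_sym (sigT_eta _)).
have hb' : bounded (acons (IConst n) e) (Datatypes.S n).
  apply: var_cons_ind => //= t x; by have := hb t x; lia.
exists (IConst n), (Datatypes.S n) => //.
rewrite /holds_at.
have -> : inst_at (acons (IConst n) e) (Datatypes.S n) = lift_subst (inst_at e n).
  apply: (@var_cons_ext _ _ (tm _)); first exact: lookup_S.
  by move=> t x; exact: real_wk (hb t x).
by rewrite -hw; apply: nd_hyp; left.
Qed.

Definition henkin : structure := {|
  dom := itm; app := IApp; zeroM := IZero; oneM := IOne; addM := IAdd; mulM := IMul;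
  piM := IPi; sigM := ISig; recM := IRec;
  eqM := fun a b => holds (Eq v1 v0) (acons b (acons a (@anil itm)));
  ltM := fun a b => holds (Lt v1 v0) (acons b (acons a (@anil itm))) |}.

Lemma real_eval G s (a : tm G s) (e : assign itm G) N :
  real N (eval (M := henkin) a e) = subst_tm (inst_at e N) a.
Proof. by elim: a => //= {}s t f -> a ->. Qed.

Lemma holds_atom (P : forall D, tm D ty0 -> tm D ty0 -> form D) G (a b : tm G ty0) e :
  (forall D D' (r : substitution D D') c d,
     subst_form r (P D c d) = P D' (subst_tm r c) (subst_tm r d)) ->
  holds (P _ v1 v0) (acons (eval (M := henkin) b e) (acons (eval (M := henkin) a e) (@anil itm))) <->
  holds (P _ a b) e.
Proof.
move=> hP; set e' := acons _ _.
have same N : holds_at (P _ v1 v0) e' N <-> holds_at (P _ a b) e N.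
  by rewrite /holds_at !hP /= /inst_at /e' /= !real_eval.
have [N1 h1] := bounded_ex e; have [N2 h2] := bounded_ex e'.
split=> -[N hN h]; exists (max N (max N1 N2)).
- by apply: bounded_le h1; lia.
- by apply/same; apply: holds_at_le hN h; lia.
- by apply: bounded_le h2; lia.
- by apply/same; apply: holds_at_le hN h; lia.
Qed.

Lemma nd_not_all S G (H : list (form G)) s (A : form (s :: G)) :
  nd S H (Neg (All s A)) -> nd S H (Ex s (Neg A)).
Proof.
move=> h; apply: nd_raa; apply: nd_impE (nd_weaken h _) _; first exact: incl_tl (incl_refl _).
apply: nd_allI; apply: nd_raa.
apply: nd_impE; first by apply: nd_hyp; right; left; reflexivity.
by apply: (@nd_exI _ _ _ _ _ v0); apply: nd_hyp; left; rewrite -{1}(inst_wk_id A).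
Qed.

Lemma sat_henkin G (A : form G) : forall e, sat (M := henkin) A e <-> holds A e.
Proof.
elim: A => {G} /= [G a b|G a b|G|G A IHA B IHB|G A IHA B IHB|G A IHA B IHB|G s A IH|G s A IH] e.
- exact: (holds_atom (P := Eq)).
- exact: (holds_atom (P := Lt)).
- by split=> // -[N _ h]; apply: (@consistent_stg N).
- rewrite IHA IHB; split.
    move=> [hA hB]; apply: (holds_mp (L := [A; B])) => [D r H h|C [<-|[<-|[]]]] //=.
    by apply: nd_andI; apply: h => /=; auto.
  move=> h; split; apply: (holds_mp (L := [And A B])) => [D r H h'|C [<-|[]]] //.
    by apply: nd_andE1 (h' (And A B) _); left.
  by apply: nd_andE2 (h' (And A B) _); left.
- rewrite IHA IHB; split.
    case=> h.
      apply: (holds_mp (L := [A])) => [D r H h'|C [<-|[]]] //=.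
      by apply: nd_orI1; apply: h'; left.
    apply: (holds_mp (L := [B])) => [D r H h'|C [<-|[]]] //=.
    by apply: nd_orI2; apply: h'; left.
  move=> h; case: (holds_decide A e) => hA; first by left.
  case: (holds_decide B e) => hB; first by right.
  case: (@holds_consistent _ (Or A B) e h).
  apply: (holds_mp (L := [Neg A; Neg B])) => [D r H h'|C [<-|[<-|[]]]] //=.
  apply: nd_impI; apply: nd_orE; first by apply: nd_hyp; left.
    apply: nd_impE (nd_weaken (h' (Neg A) _) _) (nd_hyp _ _); first by left.
      by move=> C hC; right; right.
    by left.
  apply: nd_impE (nd_weaken (h' (Neg B) _) _) (nd_hyp _ _); first by right; left.
    by move=> C hC; right; right.
  by left.
- rewrite IHA IHB; split.
    move=> h; case: (holds_decide A e) => hA.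
      apply: (holds_mp (L := [B])) => [D r H h'|C [<-|[]]] //=; last by auto.
      by apply: nd_impI; apply: nd_weaken (h' B _) _ _; [left|apply: incl_tl (incl_refl _)].
    apply: (holds_mp (L := [Neg A])) => [D r H h'|C [<-|[]]] //=.
    apply: nd_impI; apply: nd_raa.
    apply: nd_impE (nd_weaken (h' (Neg A) _) _) (nd_hyp _ _); first by left.
      by move=> C hC; right; right.
    by right; left.
  move=> h hA; apply: (holds_mp (L := [Imp A B; A])) => [D r H h'|C [<-|[<-|[]]]] //.
  by apply: nd_impE (h' (Imp A B) _) (h' A _); [left|right; left].
- split.
    move=> h; case: (holds_decide (All s A) e) => // hn.
    have : holds (Ex s (Neg A)) e.
      apply: (holds_mp (L := [Neg (All s A)])) => [D r H h'|C [<-|[]]] //.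
      by apply: nd_not_all; apply: (h' (Neg (All s A))); left.
    case/holds_witness => c hc.
    by case: (holds_consistent (proj1 (IH _) (h c))).
  move=> h a; apply/IH.
  have [N1 hN1] := bounded_ex (acons a e); have [N hN hA] := h.
  exists (max N N1); first by apply: bounded_le hN1; lia.
  have : holds_at (All s A) e (max N N1) by apply: holds_at_le hN hA; lia.
  move=> /(@nd_allE _ _ _ _ _ (real (max N N1) a)); rewrite inst_subst_lift.
  rewrite /holds_at (_ : inst_at (acons a e) _ = scons (real (max N N1) a) (inst_at e (max N N1))) //.
  by apply: (@var_cons_ext _ _ (tm _)).
- split.
    move=> [a /IH h]; have [N1 hN1] := bounded_ex e; have [N hN hA] := h.
    exists (max N N1); first by apply: bounded_le hN1; lia.
    have : holds_at A (acons a e) (max N N1) by apply: holds_at_le hN hA; lia.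
    rewrite /holds_at => h'; apply: (@nd_exI _ _ _ _ _ (real (max N N1) a)).
    rewrite inst_subst_lift.
    rewrite (_ : scons (real (max N N1) a) (inst_at e (max N N1)) = inst_at (acons a e) (max N N1)) //.
    by apply: (@var_cons_ext _ _ (tm _)).
  by case/holds_witness => c hc; exists c; apply/IH.
Qed.

Lemma subst_nil G (e : substitution [] G) (A : sentence) : subst_form e A = ren_form (@nil_ren G) A.
Proof.
by rewrite -subst_form_var; congr (subst_form _ _); apply: (@var_nil_ext (tm G)).
Qed.

Lemma henkin_models : models henkin T.
Proof.
move=> A hA; apply/sat_henkin; exists 0; first by move=> s x; exact: (@var_nil_ind (fun _ _ => _) s x).
by rewrite /holds_at subst_nil; apply: nd_ax.
Qed.

Lemma henkin_refutes : ~ sat (M := henkin) B0 (@anil itm).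
Proof.
move/sat_henkin => h; apply: (holds_consistent h).
exists 0; first by move=> s x; exact: (@var_nil_ind (fun _ _ => _) s x).
by apply: nd_hyp; left; rewrite subst_nil -(subst_nil (@subst_id [])) subst_form_id.
Qed.

Lemma henkin_eq_refl a : @eqM henkin a a.
Proof.
have [N hN] := bounded_ex (acons a (acons a (@anil itm))).
by exists N => //; apply: nd_eq_refl.
Qed.

Lemma henkin_eq_subst G (A : form (ty0 :: G)) e (a b : itm ty0) : @eqM henkin a b ->
  sat (M := henkin) A (acons a e) -> sat (M := henkin) A (acons b e).
Proof.
have key c N : subst_form (inst_at (acons c e) N) A =
    inst (subst_form (lift_subst (inst_at e N)) A) (real N c).
  rewrite inst_subst_lift; congr (subst_form _ _); by apply: (@var_cons_ext _ _ (tm _)).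
move=> [N1 hN1 hab] /sat_henkin [N2 hN2 hA]; apply/sat_henkin.
have [N3 hN3] := bounded_ex (acons b e).
exists (max N1 (max N2 N3)); first by apply: bounded_le hN3; lia.
rewrite /holds_at key; apply: (@nd_eq_subst _ _ _ _ (real (max N1 (max N2 N3)) a)).
  by apply: (holds_at_le (A := Eq v1 v0) _ hN1 hab); lia.
by rewrite -key; apply: (holds_at_le _ hN2 hA); lia.
Qed.

End Henkin.

Theorem completeness (T : theory) (B : sentence) :
  (forall M : structure, models M T -> (forall a, @eqM M a a) ->
     (forall G (A : form (ty0 :: G)) e (a b : dom M ty0), eqM a b ->
        sat (M := M) A (acons a e) -> sat (M := M) A (acons b e)) ->
     sat (M := M) B (@anil _)) ->
  proves T B.
Proof.
move=> h; apply: NNPP => hn; apply: (henkin_refutes hn); apply: h.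
- exact: henkin_models.
- exact: henkin_eq_refl.
- by move=> *; apply: henkin_eq_subst; eassumption.
Qed.

(** * The extensional quotient of a model *)

Fixpoint eqv (M : structure) (s : ty) : dom M s -> dom M s -> Prop :=
  match s with
  | ty0 => fun x y => eqM x y
  | Arr s t => fun x y => forall z : dom M s, @eqv M t (app x z) (app y z)
  end.

Lemma sat_eq_at (M : structure) s G (a b : tm G s) e :
  sat (M := M) (eq_at a b) e <-> eqv (eval a e) (eval b e).
Proof.
elim: s G a b e => [|s _ t IH] G a b e //=.
by split=> h z; move: (h z); rewrite IH /= !eval_wk.
Qed.

Section Quotient.
Variable M : structure.
Hypothesis eqM_refl : forall a, @eqM M a a.
Hypothesis eqM_subst : forall G (A : form (ty0 :: G)) e (a b : dom M ty0), eqM a b ->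
  sat (M := M) A (acons a e) -> sat (M := M) A (acons b e).
Hypothesis M_models : models M RCA0w.

Lemma eqM_sym a b : @eqM M a b -> eqM b a.
Proof.
move=> h; have := eqM_subst (A := Eq v0 v1) (e := acons a (@anil _)) h; apply; exact: eqM_refl.
Qed.

Lemma eqM_trans a b c : @eqM M a b -> eqM b c -> eqM a c.
Proof. by move=> h1 h2; have := eqM_subst (A := Eq v1 v0) (e := acons a (@anil _)) h2; apply. Qed.

Lemma ltM_congr a a' b b' : @eqM M a a' -> eqM b b' -> ltM a b -> ltM a' b'.
Proof.
move=> ha hb h.
have h1 := eqM_subst (A := Lt v0 v1) (e := acons b (@anil _)) ha h.
exact: (eqM_subst (A := Lt v1 v0) (e := acons a' (@anil _)) hb h1).
Qed.

Lemma eqv_refl s (x : dom M s) : eqv x x.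
Proof. by elim: s x => [|s _ t IH] x /=; [exact: eqM_refl|move=> z; apply: IH]. Qed.

Lemma eqv_sym s (x y : dom M s) : eqv x y -> eqv y x.
Proof. by elim: s x y => [|s _ t IH] x y /=; [exact: eqM_sym|move=> h z; apply: IH]. Qed.

Lemma eqv_trans s (x y z : dom M s) : eqv x y -> eqv y z -> eqv x z.
Proof.
elim: s x y z => [|s _ t IH] x y z /=; first exact: eqM_trans.
move=> h1 h2 w; exact: IH (h1 w) (h2 w).
Qed.

(** Congruence in the function is the definition of [eqv]; congruence in the argument is the
    extensionality axiom of the base theory, read in [M]. *)
Lemma eqv_app s t (f g : dom M (s ~> t)) x y : eqv f g -> eqv x y -> eqv (app f x) (app g y).
Proof.
move=> hf hx; apply: (@eqv_trans _ _ (app f y)); last exact: hf.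
pose E : assign (dom M) [s; s; s ~> t] := acons y (acons x (acons f (@anil _))).
apply/(sat_eq_at (v2 @ v1)%tm (v2 @ v0)%tm E).
apply: (M_models (RCA0w_ext s t) f x y); exact: (proj2 (sat_eq_at v1 v0 E) hx).
Qed.

(** A class is represented by a chosen element; [repr_eq] shows that the choice depends on the class
    only, so the fixed points of [repr] form the quotient. *)
Definition repr s (x : dom M s) : dom M s := epsilon (inhabits x) (eqv x).

Lemma eqv_repr s (x : dom M s) : eqv x (repr x).
Proof. by apply: (epsilon_spec (inhabits x) (eqv x)); exists x; apply: eqv_refl. Qed.

Lemma repr_eq s (x y : dom M s) : eqv x y -> repr x = repr y.
Proof.
move=> h; rewrite /repr (proof_irrelevance _ (inhabits x) (inhabits y)); congr epsilon.
apply: functional_extensionality => z; apply: propositional_extensionality.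
split=> h'; [exact: eqv_trans (eqv_sym h) h'|exact: eqv_trans h h'].
Qed.

Definition qdom (s : ty) : Type := {x : dom M s | repr x = x}.

Definition cls s (x : dom M s) : qdom s :=
  exist _ (repr x) (eq_sym (repr_eq (eqv_repr x))).

Definition rep s (u : qdom s) : dom M s := proj1_sig u.

Lemma eqv_rep_cls s (x : dom M s) : eqv (rep (cls x)) x.
Proof. exact: eqv_sym (eqv_repr x). Qed.

Lemma qdom_eq s (u v : qdom s) : eqv (rep u) (rep v) -> u = v.
Proof.
case: u v => [x hx] [y hy] /= /repr_eq; rewrite hx hy => e; subst y.
by rewrite (proof_irrelevance _ hx hy).
Qed.

Lemma cls_eq s (x y : dom M s) : eqv x y -> cls x = cls y.
Proof.
move=> h; apply: qdom_eq; apply: eqv_trans (eqv_rep_cls x) _.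
apply: eqv_trans h _; exact: eqv_sym (eqv_rep_cls y).
Qed.

Definition quotient : structure := {|
  dom := qdom;
  app := fun s t f x => cls (app (rep f) (rep x));
  zeroM := cls (zeroM M); oneM := cls (oneM M);
  addM := cls (addM M); mulM := cls (mulM M);
  piM := fun s t => cls (@piM M s t);
  sigM := fun r s t => cls (@sigM M r s t);
  recM := fun s => cls (@recM M s);
  eqM := eq;
  ltM := fun a b => ltM (rep a) (rep b) |}.

Definition env_rep G (e : assign qdom G) : assign (dom M) G := fun s x => rep (e s x).

Lemma eval_quotient G s (a : tm G s) e :
  eval (M := quotient) a e = cls (eval (M := M) a (env_rep e)).
Proof.
elim: a => {s} [s x|s t f IHf b IHb|||||s t|r s t|s] //=.
  apply: qdom_eq; exact: eqv_sym (eqv_rep_cls _).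
by rewrite IHf IHb; apply: cls_eq; apply: eqv_app; apply: eqv_rep_cls.
Qed.

Lemma eval_eqv G s (a : tm G s) (e e' : assign (dom M) G) :
  (forall t (x : var G t), eqv (e t x) (e' t x)) -> eqv (eval a e) (eval a e').
Proof. by move=> h; elim: a => //= *; try exact: eqv_refl; apply: eqv_app. Qed.

Lemma sat_eqv G (A : form G) : forall e e' : assign (dom M) G,
  (forall t (x : var G t), eqv (e t x) (e' t x)) -> sat (M := M) A e -> sat (M := M) A e'.
Proof.
have sym G' (e e' : assign (dom M) G') :
    (forall t (x : var G' t), eqv (e t x) (e' t x)) ->
    (forall t (x : var G' t), eqv (e' t x) (e t x)) by move=> h t x; exact: eqv_sym (h t x).
have cons G' s (x : dom M s) (e e' : assign (dom M) G') :
    (forall t (x : var G' t), eqv (e t x) (e' t x)) ->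
    forall t (y : var (s :: G') t), eqv (acons x e t y) (acons x e' t y).
  by move=> h; apply: var_cons_ind => //; exact: eqv_refl.
elim: A => {G} //= [G a b|G a b|G A IHA B IHB|G A IHA B IHB|G A IHA B IHB|G s A IH|G s A IH] e e' he.
- move=> h; apply: eqM_trans (eval_eqv b he); apply: eqM_trans h.
  exact: eqM_sym (eval_eqv a he).
- apply: ltM_congr; exact: (eval_eqv _ he).
- by move=> [hA hB]; split; [apply: IHA hA|apply: IHB hB].
- by move=> [] h; [left; apply: IHA h|right; apply: IHB h].
- by move=> h hA; apply: (IHB e e' he); apply: h; apply: (IHA e' e (sym _ _ _ he)).
- by move=> h x; apply: IH (cons _ _ x _ _ he) (h x).
- by move=> [x h]; exists x; apply: IH (cons _ _ x _ _ he) h.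
Qed.

Lemma sat_quotient G (A : form G) : forall e,
  sat (M := quotient) A e <-> sat (M := M) A (env_rep e).
Proof.
have cons G' s (u : qdom s) (e : assign qdom G') :
    env_rep (acons u e) = acons (rep u) (env_rep e).
  by apply: (@var_cons_ext _ _ (dom M)).
have consE G' s (A' : form (s :: G')) (x : dom M s) e :
    sat (M := M) A' (env_rep (acons (cls x) e)) <-> sat (M := M) A' (acons x (env_rep e)).
  by rewrite cons; split; apply: sat_eqv; apply: var_cons_ind => *;
    try exact: eqv_refl; [exact: eqv_rep_cls|exact: eqv_sym (eqv_rep_cls _)].
elim: A => {G} //= [G a b|G a b|G A IHA B IHB|G A IHA B IHB|G A IHA B IHB|G s A IH|G s A IH] e;
  rewrite ?IHA ?IHB //.
- rewrite !eval_quotient; split; last exact: (@cls_eq ty0).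
  move=> h; apply: (@eqv_trans ty0 _ (rep (cls (eval a (env_rep e))))).
    exact: eqv_sym (eqv_rep_cls _).
  by rewrite h; apply: eqv_rep_cls.
- rewrite !eval_quotient; split; apply: ltM_congr.
  + exact: (@eqv_rep_cls ty0).
  + exact: (@eqv_rep_cls ty0).
  + exact: eqM_sym (@eqv_rep_cls ty0 _).
  + exact: eqM_sym (@eqv_rep_cls ty0 _).
- split=> h x; first by apply/consE; apply/IH.
  by apply/IH; rewrite cons; apply: h.
- split=> -[x h]; first by exists (rep x); rewrite -cons; apply/IH.
  by exists (cls x); apply/IH; apply/consE.
Qed.

Lemma quotient_ext s t (f g : qdom (s ~> t)) :
  (forall x, @app quotient _ _ f x = @app quotient _ _ g x) -> f = g.
Proof.
move=> h; apply: qdom_eq => z /=.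
have hz : eqv (app (rep f) (rep (cls z))) (app (rep g) (rep (cls z))).
  apply: eqv_trans (eqv_sym (eqv_rep_cls _)) _.
  have e := h (cls z); rewrite /= in e; rewrite e; exact: eqv_rep_cls.
apply: eqv_trans (eqv_trans _ hz) _; apply: eqv_app; try exact: eqv_refl.
  exact: eqv_sym (eqv_rep_cls z).
exact: eqv_rep_cls.
Qed.

End Quotient.

Definition extensional (M : structure) : Prop :=
  (forall a b, @eqM M a b <-> a = b) /\
  (forall s t (f g : dom M (s ~> t)), (forall x, app f x = app g x) -> f = g).

Theorem extensional_completeness (B : sentence) :
  (forall M, models M RCA0w -> extensional M -> sat (M := M) B (@anil _)) -> proves RCA0w B.
Proof.
move=> h; apply: completeness => M hM hr hs.
have eE : env_rep (@anil (qdom M)) = @anil (dom M) by apply: (@var_nil_ext (dom M)).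
have sE A : sat (M := quotient hr hs) A (@anil _) <-> sat (M := M) A (@anil _).
  by rewrite -[X in _ <-> sat A X]eE; exact: (@sat_quotient M hr hs hM [] A (@anil _)).
apply/sE; apply: h; first by move=> A hA; apply/sE; apply: hM.
by split=> // s t f g; apply: (quotient_ext hM).
Qed.

(** * Forcing *)

Fixpoint F (t : ty) : Type :=
  match t with ty0 => nat | Arr s t => F s -> F t end.

Definition std : structure := {|
  dom := F;
  app := fun s t (f : F (s ~> t)) x => f x;
  zeroM := 0; oneM := 1;
  addM := Nat.add; mulM := Nat.mul;
  piM := fun s t (x : F s) (_ : F t) => x;
  sigM := fun r s t (x : F (r ~> s ~> t)) (y : F (r ~> s)) z => x z (y z);
  recM := fun s (f : F (ty0 ~> s ~> s)) (m : F s) n => nat_rect (fun _ => F s) m f n;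
  eqM := @eq nat; ltM := lt |}.

(** * Conditions, density and fusion *)

Definition baire := nat -> nat.
Definition oracle := baire -> nat.

(** Finite graphs would not do, because [fusion] takes unions of infinite chains. [gr_room] bounds
    nothing but keeps infinitely many values free, so that a further argument can always be given a
    value outside the finite list [av]. *)
Record cond := Cond {
  gr : baire -> nat -> Prop;
  av : list nat;
  gr_fun : forall f n m, gr f n -> gr f m -> n = m;
  gr_inj : forall f g n, gr f n -> gr g n -> f = g;
  gr_av : forall f n, gr f n -> ~ In n av;
  gr_room : forall k, exists n, k <= n /\ forall f, ~ gr f n }.

Definition ext (d c : cond) : Prop :=
  (forall f n, gr c f n -> gr d f n) /\ incl (av c) (av d).

(** Only the graph constrains [Y], so that [decides] is insensitive to the avoided values; this is
    what makes it [positive]. *)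
Definition agrees (c : cond) (Y : oracle) : Prop := forall f n, gr c f n -> Y f = n.

Definition dense (c : cond) (P : cond -> Prop) : Prop :=
  forall d, ext d c -> exists2 d', ext d' d & P d'.

Definition decides (c : cond) (P : oracle -> Prop) : Prop := forall Y, agrees c Y -> P Y.

Lemma ext_refl c : ext c c.
Proof. by split=> // n. Qed.

Lemma ext_trans a b c : ext a b -> ext b c -> ext a c.
Proof.
move=> [h1 h2] [h3 h4]; split=> [f n h|]; first by apply: h1; apply: h3.
exact: incl_tran h4 h2.
Qed.

Lemma agrees_ext c d Y : ext d c -> agrees d Y -> agrees c Y.
Proof. by move=> [h _] hY f n /h; apply: hY. Qed.

Lemma decides_ext c d P : ext d c -> decides c P -> decides d P.
Proof. by move=> h hP Y /(agrees_ext h); apply: hP. Qed.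

Lemma agrees_ex c : exists Y, agrees c Y.
Proof.
exists (fun f => epsilon (inhabits 0) (gr c f)) => f n h.
apply: (gr_fun (c := c) (f := f)) => //; apply: epsilon_spec; by exists n.
Qed.

Lemma dense_ext c d P : ext d c -> dense c P -> dense d P.
Proof. by move=> h hP d' h'; apply: hP; apply: ext_trans h. Qed.

Lemma dense_all c (P : cond -> Prop) : (forall d, ext d c -> P d) -> dense c P.
Proof. by move=> h d hd; exists d; [apply: ext_refl|apply: h]. Qed.

Lemma dense_bind c (P Q : cond -> Prop) :
  dense c P -> (forall d, ext d c -> P d -> dense d Q) -> dense c Q.
Proof.
move=> hP hQ d hd; have [d1 h1 p1] := hP d hd.
have h1c := ext_trans h1 hd.
have [d2 h2 q2] := hQ d1 h1c p1 _ (ext_refl d1).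
by exists d2 => //; apply: ext_trans h1.
Qed.

Lemma dense_map c (P Q : cond -> Prop) :
  dense c P -> (forall d, ext d c -> P d -> Q d) -> dense c Q.
Proof.
move=> hP hQ d hd; have [d1 h1 p1] := hP d hd.
exists d1 => //; apply: hQ => //; exact: ext_trans hd.
Qed.

Definition avoid_new c (k : nat) :
  {d : cond | ext d c /\ exists2 n, k <= n & In n (av d)}.
Proof.
apply: constructive_indefinite_description.
have [n [hn hg]] := gr_room c k.
have hav f m : gr c f m -> ~ In m (n :: av c).
  move=> h [e|]; [by subst m; apply: hg h|exact: gr_av h].
exists (Cond (@gr_fun c) (@gr_inj c) hav (@gr_room c)).
split; first by split=> //= m hm; right.
by exists n => //; left.
Qed.

Definition positive (U : cond -> Prop) : Prop :=
  forall c d, (forall f n, gr c f n -> gr d f n) -> U c -> U d.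

Lemma positive_decides P : positive (fun c => decides c P).
Proof. move=> c d h hP Y hY; apply: hP => f n /h; exact: hY. Qed.

(* Before meeting the [i]-th dense set, reserve a fresh value at least [i] for the
   complement of the range.  The union of the graphs then omits all the reserved
   values, so it is a condition again, although their set is infinite; it lies in
   all the dense sets because these do not look at the avoided values. *)
Lemma fusion c (U : nat -> cond -> Prop) :
  (forall i, positive (U i)) -> (forall i, dense c (U i)) ->
  dense c (fun d => forall i, U i d).
Proof.
move=> hpos hd d hdc.
have stp (i : nat) (x : {x | ext x c}) : {y | ext y c /\ ext y (proj1_sig x) /\ U i y /\
    exists2 n, i <= n & In n (av y)}.
  apply: constructive_indefinite_description; case: x => x hx /=.
  have [y [hy [n hn hin]]] := avoid_new x i.
  have [z hz hU] := hd i y (ext_trans hy hx).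
  exists z; split; [exact: ext_trans hz (ext_trans hy hx)|split; [exact: ext_trans hy|split=> //]].
  by exists n => //; apply: (proj2 hz).
pose s := fix s i : {x | ext x c} := match i with
  | O => exist _ d hdc
  | S i => let (y, h) := stp i (s i) in exist _ y (proj1 h) end.
have sS i : ext (proj1_sig (s (S i))) (proj1_sig (s i)) /\ U i (proj1_sig (s (S i))) /\
    exists2 n, i <= n & In n (av (proj1_sig (s (S i)))).
  rewrite /=; by case: (stp i (s i)) => y [h1 h2].
have mono j i : ext (proj1_sig (s (j + i))) (proj1_sig (s i)).
  elim: j => [|j IH]; first exact: ext_refl.
  exact: ext_trans (proj1 (sS (j + i))) IH.
have mono' i j : i <= j -> ext (proj1_sig (s j)) (proj1_sig (s i)).
  move=> h; have -> : j = (j - i) + i by lia.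
  exact: mono.
pose g f n := exists i, gr (proj1_sig (s i)) f n.
have up i j f n : gr (proj1_sig (s i)) f n -> gr (proj1_sig (s (max i j))) f n.
  by apply: (proj1 (mono' _ _ _)); lia.
have gfun f n m : g f n -> g f m -> n = m.
  move=> [i hi] [j hj]; move/(up _ j): hi; move/(up _ i): hj; rewrite Nat.max_comm.
  by move=> h1 h2; apply: (gr_fun h2 h1).
have ginj f f' n : g f n -> g f' n -> f = f'.
  move=> [i hi] [j hj]; move/(up _ j): hi; move/(up _ i): hj; rewrite Nat.max_comm.
  by move=> h1 h2; apply: (gr_inj h2 h1).
have gav f n : g f n -> ~ In n (av d).
  move=> [i hi] hin; apply: (gr_av hi); by apply: (proj2 (mono' 0 i _)); first lia.
have groom k : exists n, k <= n /\ forall f, ~ g f n.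
  have [_ [_ [n hn hin]]] := sS k; exists n; split=> // f [i /(up _ (S k)) hi].
  apply: (gr_av hi); apply: (proj2 (mono' (S k) _ _)) hin; lia.
exists (Cond gfun ginj gav groom).
  by split=> //= f n h; exists 0.
move=> i; apply: hpos (proj1 (proj2 (sS i))) => f n h; by exists (S i).
Qed.

(* Names: families indexed by the total functions that extend the generic injection. *)
Definition nm (s : ty) : Type := oracle -> F s.

(** A name exists at [c] when it is related to itself. At base type this means that its value can be
    decided densely below [c]; at function types related arguments must have related values at every
    extension, which builds in extensionality. *)
Fixpoint peq (s : ty) (c : cond) : nm s -> nm s -> Prop :=
  match s with
  | ty0 => fun x y => dense c (fun d => exists n, decides d (fun Y => x Y = n /\ y Y = n))
  | Arr s t => fun x y => forall d, ext d c -> forall u v : nm s, peq d u v ->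
      @peq t d (fun Y => x Y (u Y)) (fun Y => y Y (v Y))
  end.

Lemma peq_ext s c d (x y : nm s) : ext d c -> peq c x y -> peq d x y.
Proof.
case: s x y => [|s t] x y hd /=; first exact: dense_ext.
by move=> h d' hd'; apply: h; apply: ext_trans hd.
Qed.

(** Locality of the relation: it allows a proof to pass to extensions that decide the numbers
    involved. *)
Lemma peq_dense s c (x y : nm s) : dense c (fun d => peq d x y) -> peq c x y.
Proof.
elim: s c x y => [|s _ t IH] c x y /= h; first exact: dense_bind h _.
move=> d hd u v huv; apply: IH; apply: dense_map (dense_ext hd h) _ => d' hd' h'.
by apply: h'; [exact: ext_refl|exact: peq_ext huv].
Qed.

Lemma peq_sym s c (x y : nm s) : peq c x y -> peq c y x.
Proof.
elim: s c x y => [|s IHs t IH] c x y /= h.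
  apply: dense_map h _ => d _ [n hn]; exists n => Y /hn; tauto.
move=> d hd u v huv; apply: IH; apply: h => //; exact: IHs.
Qed.

Lemma peq_trans s c (x y z : nm s) : peq c x y -> peq c y z -> peq c x z.
Proof.
elim: s c x y z => [|s IHs t IH] c x y z /= h1 h2.
  apply: dense_bind h1 _ => d hd [n hn].
  apply: dense_map (dense_ext hd h2) _ => d' hd' [m hm].
  exists m => Y hY; have [? ?] := hm Y hY; have [? ?] := hn Y (agrees_ext hd' hY).
  by split=> //; congruence.
move=> d hd u v huv; apply: IH (h1 d hd u v huv) (h2 d hd v v _).
exact: (IHs _ _ _ _ (peq_sym huv) huv).
Qed.

Lemma peq_left s c (x y : nm s) : peq c x y -> peq c x x.
Proof. by move=> h; exact: (peq_trans h (peq_sym h)). Qed.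

Lemma peq_decides s c (x x' y : nm s) : decides c (fun Y => x Y = x' Y) -> peq c x y -> peq c x' y.
Proof.
elim: s c x x' y => [|s _ t IH] c x x' y /= hx h.
  apply: dense_map h _ => d hd [n hn]; exists n => Y hY.
  by rewrite -(hx Y (agrees_ext hd hY)); apply: hn.
move=> d hd u v huv; apply: IH (h d hd u v huv) => Y hY.
by rewrite (hx Y (agrees_ext hd hY)).
Qed.

Lemma peq_const0 c n : @peq ty0 c (fun _ => n) (fun _ => n).
Proof. by apply: dense_all => d _; exists n => Y _. Qed.

(* This is where [fusion] is used to keep new functions on numbers out. *)
Lemma peq1_ground c (u v : nm ty1) : peq c u v ->
  dense c (fun d => exists g, decides d (fun Y => u Y = g /\ v Y = g)).
Proof.
move=> /= h.
pose U i d := exists n, decides d (fun Y => u Y i = n /\ v Y i = n).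
have hU : dense c (fun d => forall i, U i d).
  apply: fusion => i; last exact: (h c (ext_refl c) (fun _ => i) (fun _ => i) (@peq_const0 c i)).
  by move=> d d' hd [n hn]; exists n; apply: positive_decides hd hn.
apply: dense_map hU _ => d _ hd.
exists (fun i => proj1_sig (constructive_indefinite_description _ (hd i))) => Y hY.
by split; apply: functional_extensionality => i;
   case: (constructive_indefinite_description _ (hd i)) => n hn; have [] := hn Y hY.
Qed.

(** * Terms at names, the forcing relation and its soundness *)

Definition at_oracle G (e : assign nm G) (Y : oracle) : assign F G := fun s x => e s x Y.

Definition evaln G s (a : tm G s) (e : assign nm G) : nm s :=
  fun Y => eval (M := std) a (at_oracle e Y).

Definition peq_env G c (e e' : assign nm G) : Prop := forall s (x : var G s), peq c (e s x) (e' s x).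

Lemma peq_env_cons G c s x x' (e e' : assign nm G) :
  peq c x x' -> peq_env c e e' -> peq_env c (acons (t := s) x e) (acons x' e').
Proof. by move=> hx he; apply: var_cons_ind. Qed.

Lemma peq_env_ext G c d (e e' : assign nm G) : ext d c -> peq_env c e e' -> peq_env d e e'.
Proof. by move=> h he s x; apply: peq_ext h (he s x). Qed.

Lemma peq_env_sym G c (e e' : assign nm G) : peq_env c e e' -> peq_env c e' e.
Proof. by move=> h s x; apply: peq_sym (h s x). Qed.

Lemma peq_env_left G c (e e' : assign nm G) : peq_env c e e' -> peq_env c e e.
Proof. by move=> h s x; apply: peq_left (h s x). Qed.

Lemma peq_env_nil c e e' : peq_env (G := []) c e e'.
Proof. move=> s x; exact: (@var_nil_ind (fun t x => peq c (e t x) (e' t x)) s x). Qed.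

Lemma peq_rec s c (f f' : nm (ty0 ~> s ~> s)) (m m' : nm s) (n n' : nm ty0) :
  peq c f f' -> peq c m m' -> peq c n n' ->
  peq c (fun Y => nat_rect (fun _ => F s) (m Y) (f Y) (n Y))
      (fun Y => nat_rect (fun _ => F s) (m' Y) (f' Y) (n' Y)).
Proof.
(* Locally the number of iterations is a fixed [k], and the step functions can be applied [k] times
   by induction outside the model. *)
move=> hf hm hn; apply: peq_dense; apply: dense_map hn _ => d hd [k hk].
have step i : peq d (fun Y => nat_rect (fun _ => F s) (m Y) (f Y) i)
                  (fun Y => nat_rect (fun _ => F s) (m' Y) (f' Y) i).
  elim: i => [|i IH] /=; first exact: peq_ext hm.
  exact: (hf d hd _ _ (@peq_const0 d i) d (ext_refl d) _ _ IH).
have e1 : decides d (fun Y => nat_rect (fun _ => F s) (m Y) (f Y) k =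
                        nat_rect (fun _ => F s) (m Y) (f Y) (n Y)).
  by move=> Y /hk [-> _].
have e2 : decides d (fun Y => nat_rect (fun _ => F s) (m' Y) (f' Y) k =
                        nat_rect (fun _ => F s) (m' Y) (f' Y) (n' Y)).
  by move=> Y /hk [_ ->].
apply: peq_decides e1 _; apply: peq_sym; apply: peq_decides e2 _; apply: peq_sym; exact: step.
Qed.

(** The fundamental lemma of the logical relation. With [e' = e] it says that terms in existing
    names denote existing names. *)
Lemma peq_evaln G s (a : tm G s) c e e' : peq_env c e e' -> peq c (evaln a e) (evaln a e').
Proof.
elim: a c e e' => {s}.
- by move=> s x c e e' he; apply: he.
- move=> s t f IHf b IHb c e e' he.
  exact: (IHf c e e' he c (ext_refl c) _ _ (IHb c e e' he)).
- by move=> c e e' he; exact: peq_const0.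
- by move=> c e e' he; exact: peq_const0.
- move=> c e e' he d hd u v huv d' hd' u' v' huv'.
  apply: dense_bind (dense_ext hd' huv) _ => d1 h1 [n hn].
  apply: dense_map (dense_ext h1 huv') _ => d2 h2 [m hm].
  exists (n + m) => Y hY; have [a1 a2] := hn Y (agrees_ext h2 hY).
  by have [b1 b2] := hm Y hY; rewrite /evaln /= a1 a2 b1 b2.
- move=> c e e' he d hd u v huv d' hd' u' v' huv'.
  apply: dense_bind (dense_ext hd' huv) _ => d1 h1 [n hn].
  apply: dense_map (dense_ext h1 huv') _ => d2 h2 [m hm].
  exists (n * m) => Y hY; have [a1 a2] := hn Y (agrees_ext h2 hY).
  by have [b1 b2] := hm Y hY; rewrite /evaln /= a1 a2 b1 b2.
- by move=> s t c e e' he d hd u v huv d' hd' u' v' huv'; exact (peq_ext hd' huv).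
- move=> r s t c e e' he d1 h1 u1 w1 r1 d2 h2 u2 w2 r2 d3 h3 u3 w3 r3.
  have a1 := r1 d3 (ext_trans h3 h2) _ _ r3.
  exact: (a1 d3 (ext_refl d3) _ _ (r2 d3 h3 _ _ r3)).
- move=> s c e e' he d1 h1 u1 w1 r1 d2 h2 u2 w2 r2 d3 h3 u3 w3 r3.
  exact (peq_rec (@peq_ext (ty0 ~> s ~> s) d1 d3 u1 w1 (ext_trans h3 h2) r1) (@peq_ext s _ _ _ _ h3 r2) r3).
Qed.

(** Atoms, disjunction and the existential quantifier ask for density only, which makes every clause
    local ([force_dense]). Locality is what validates classical logic without a negative
    translation. *)
Fixpoint force G (A : form G) (c : cond) : assign nm G -> Prop :=
  match A with
  | Eq a b => fun e => dense c (fun d => decides d (fun Y => evaln a e Y = evaln b e Y))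
  | Lt a b => fun e => dense c (fun d => decides d (fun Y => evaln a e Y < evaln b e Y))
  | Bot => fun _ => False
  | And A B => fun e => (force A c e /\ force B c e)%type
  | Or A B => fun e => dense c (fun d => force A d e \/ force B d e)
  | Imp A B => fun e => forall d, ext d c -> force A d e -> force B d e
  | All s A => fun e => forall d, ext d c -> forall x : nm s, peq d x x -> force A d (acons x e)
  | Ex s A => fun e => dense c (fun d => exists2 x : nm s, peq d x x & force A d (acons x e))
  end.

Lemma force_ext G (A : form G) c d e : ext d c -> force A c e -> force A d e.
Proof.
elim: A c d e => {G} //= [G a b|G a b|G A IHA B IHB|G A IHA B IHB|G A IHA B IHB|G s A IH|G s A IH] c d e hd;
  try exact: dense_ext hd.
- by move=> [hA hB]; split; [apply: IHA hA|apply: IHB hB].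
- by move=> h d' hd'; apply: h; apply: ext_trans hd.
- by move=> h d' hd'; apply: h; apply: ext_trans hd.
Qed.

Lemma force_dense G (A : form G) c e : dense c (fun d => force A d e) -> force A c e.
Proof.
elim: A c e => {G} /= [G a b|G a b|G|G A IHA B IHB|G A IHA B IHB|G A IHA B IHB|G s A IH|G s A IH] c e h;
  try by apply: dense_bind h _.
- by have [] := h c (ext_refl c).
- by split; [apply: IHA|apply: IHB]; apply: dense_map h _ => d _ [].
- move=> d hd hA; apply: IHB; apply: dense_map (dense_ext hd h) _ => d' hd' h'.
  by apply: h'; [exact: ext_refl|exact: force_ext hA].
- move=> d hd x hx; apply: IH; apply: dense_map (dense_ext hd h) _ => d' hd' h'.
  by apply: h'; [exact: ext_refl|exact: peq_ext hx].
Qed.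

Lemma dense_decides_congr (P : nat -> nat -> Prop) c (x x' y y' : nm ty0) :
  peq c x x' -> peq c y y' ->
  dense c (fun d => decides d (fun Y => P (x Y) (y Y))) ->
  dense c (fun d => decides d (fun Y => P (x' Y) (y' Y))).
Proof.
move=> hx hy h.
apply: dense_bind hx _ => d1 h1 [n hn].
apply: dense_bind (dense_ext h1 hy) _ => d2 h2 [m hm].
apply: dense_map (dense_ext h2 (dense_ext h1 h)) _ => d3 h3 hP Y hY.
have := hP Y hY; have hY2 := agrees_ext h3 hY.
have [-> ->] := hm Y hY2; by have [-> ->] := hn Y (agrees_ext h2 hY2).
Qed.

Lemma force_congr G (A : form G) c e e' : peq_env c e e' -> force A c e -> force A c e'.
Proof.
elim: A c e e' => {G} //= [G a b|G a b|G A IHA B IHB|G A IHA B IHB|G A IHA B IHB|G s A IH|G s A IH] c e e' he h.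
- by apply: dense_decides_congr h; apply: peq_evaln.
- by apply: (dense_decides_congr (P := lt)) h; apply: peq_evaln.
- by case: h => [hA hB]; split; [apply: IHA hA|apply: IHB hB].
- apply: dense_map h _ => d hd [] h'; [left; apply: IHA h'|right; apply: IHB h'];
    exact: peq_env_ext he.
- move=> d hd hA; apply: IHB (peq_env_ext hd he) _; apply: h => //.
  apply: IHA hA; exact: peq_env_sym (peq_env_ext hd he).
- move=> d hd x hx; apply: IH (h d hd x hx); apply: peq_env_cons => //; exact: peq_env_ext he.
- apply: dense_map h _ => d hd [x hx h']; exists x => //.
  apply: IH h'; apply: peq_env_cons => //; exact: peq_env_ext he.
Qed.

Lemma evaln_wk G t s (a : tm G s) (x : nm t) e : evaln (ren_tm (@wk G t) a) (acons x e) = evaln a e.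
Proof. by apply: functional_extensionality => Y; rewrite /evaln eval_ren. Qed.

Lemma evaln_subst G D (r : substitution G D) s (a : tm G s) e :
  evaln (subst_tm r a) e = evaln a (fun s x => evaln (r s x) e).
Proof. by apply: functional_extensionality => Y; rewrite /evaln eval_subst. Qed.

Lemma force_subst G (A : form G) : forall D (r : substitution G D) c e,
  force (subst_form r A) c e <-> force A c (fun s x => evaln (r s x) e).
Proof.
have lift G' D (r : substitution G' D) e s (x : nm s) :
    (fun t (y : var (s :: G') t) => evaln (lift_subst r y) (acons x e)) =
    acons x (fun t y => evaln (r t y) e).
  by apply: (@var_cons_ext _ _ nm) => //= t y; rewrite evaln_wk.
elim: A => {G} //= [G a b|G a b|G A IHA B IHB|G A IHA B IHB|G A IHA B IHB|G s A IH|G s A IH] D r c e.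
- by rewrite !evaln_subst.
- by rewrite !evaln_subst.
- by rewrite IHA IHB.
- by split=> h; apply: dense_map h _ => d _; rewrite IHA IHB.
- by split=> h d hd; move: (h d hd); rewrite IHA IHB.
- by split=> h d hd x hx; move: (h d hd x hx); rewrite IH lift.
- by split=> h; apply: dense_map h _ => d _ [x hx h']; exists x => //; move: h'; rewrite IH lift.
Qed.

Lemma force_wk G (A : form G) t (x : nm t) c e :
  force (ren_form (@wk G t) A) c (acons x e) <-> force A c e.
Proof. by rewrite -subst_form_var force_subst. Qed.

Lemma force_inst G t (A : form (t :: G)) (a : tm G t) c e :
  force (inst A a) c e <-> force A c (acons (evaln a e) e).
Proof.
rewrite /inst force_subst.
have -> // : (fun s x => evaln (@scons G G t a (fun s x => Var x) s x) e) = acons (evaln a e) e.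
by apply: (@var_cons_ext _ _ nm).
Qed.

Theorem force_sound (T : theory) : (forall A c, T A -> force A c (@anil nm)) ->
  forall G (H : list (form G)) A, nd T H A ->
  forall c e, peq_env c e e -> (forall B, In B H -> force B c e) -> force A c e.
Proof.
move=> hT G H A; elim => {G H A}.
- move=> G H A hA c e he _; rewrite -subst_form_var force_subst.
  have -> : (fun s x => evaln (Var (@nil_ren G s x)) e) = @anil nm by apply: (@var_nil_ext nm).
  exact: hT.
- by move=> G H A hA c e _; apply.
- move=> G H A _ IH c e he hH; apply: force_dense => d hd.
  (* If no extension of [d] forces [A], then [d] forces the negation of [A], which the induction
     hypothesis refutes. *)
  apply: NNPP => hn; apply: (IH d e (peq_env_ext hd he)) => B [<-|hB].
    by move=> d' hd' hA; apply: hn; exists d'.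
  exact: force_ext hd (hH B hB).
- by move=> G H A B _ IHA _ IHB c e he hH; split; [apply: IHA|apply: IHB].
- by move=> G H A B _ IH c e he hH; case: (IH c e he hH).
- by move=> G H A B _ IH c e he hH; case: (IH c e he hH).
- by move=> G H A B _ IH c e he hH; apply: dense_all => d hd; left; apply: force_ext hd (IH _ _ _ _).
- by move=> G H A B _ IH c e he hH; apply: dense_all => d hd; right; apply: force_ext hd (IH _ _ _ _).
- move=> G H A B C _ IH _ IHA _ IHB c e he hH; apply: force_dense.
  apply: dense_map (IH c e he hH) _ => d hd [] h; [apply: IHA|apply: IHB];
    try exact: peq_env_ext he; by move=> D [<-|hD] //; apply: force_ext hd (hH D hD).
- move=> G H A B _ IH c e he hH d hd hA; apply: IH; first exact: peq_env_ext he.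
  by move=> D [<-|hD] //; apply: force_ext hd (hH D hD).
- move=> G H A B _ IH _ IHA c e he hH; exact: (IH c e he hH c (ext_refl c) (IHA c e he hH)).
- move=> G H s A _ IH c e he hH d hd x hx; apply: IH.
    by apply: peq_env_cons => //; apply: peq_env_ext he.
  by move=> B /in_map_iff [D [<- hD]]; rewrite force_wk; apply: force_ext hd (hH D hD).
- move=> G H s A a _ IH c e he hH; rewrite force_inst.
  by apply: (IH c e he hH c (ext_refl c)); apply: peq_evaln.
- move=> G H s A a _ IH c e he hH; apply: dense_all => d hd; exists (evaln a e).
    by apply: peq_evaln; apply: peq_env_ext he.
  exact: (proj1 (force_inst A a d e) (force_ext hd (IH c e he hH))).
- move=> G H s A C _ IH _ IHC c e he hH; apply: force_dense.
  apply: dense_map (IH c e he hH) _ => d hd [x hx hA].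
  rewrite -(force_wk C x); apply: IHC.
    by apply: peq_env_cons => //; apply: peq_env_ext he.
  move=> B [<-|/in_map_iff [D [<- hD]]] //.
  by rewrite force_wk; apply: force_ext hd (hH D hD).
- by move=> G H a c e he hH; apply: dense_all => d hd Y hY.
- move=> G H A a b _ IH _ IHA c e he hH; rewrite force_inst.
  apply: force_congr (proj1 (force_inst A a c e) (IHA c e he hH)).
  apply: peq_env_cons => //.
  have ra := @peq_evaln _ _ a _ _ _ he.
  apply: dense_bind ra _ => d hd [n hn].
  apply: dense_map (dense_ext hd (IH c e he hH)) _ => d' hd' hab.
  exists n => Y hY; rewrite -(hab Y hY); exact: hn (agrees_ext hd' hY).
Qed.

(** * Forcing the axioms of the base theory *)

Local Notation fcons s := (@acons F s _).
Local Notation ncons s := (@acons nm s _).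

Lemma at_oracle_cons G s (x : nm s) (e : assign nm G) Y :
  at_oracle (acons x e) Y = acons (x Y) (at_oracle e Y).
Proof. by apply: (@var_cons_ext _ _ F). Qed.

Lemma decides_absurd c : ~ decides c (fun _ => False).
Proof. by move=> h; have [Y /h] := agrees_ex c. Qed.

Definition qf_holds G (A : form G) (e : assign nm G) (Y : oracle) : Prop :=
  sat (M := std) A (at_oracle e Y).

Lemma atom_decided c (x y : nm ty0) (P : nat -> nat -> Prop) : peq c x x -> peq c y y ->
  dense c (fun d => decides d (fun Y => P (x Y) (y Y)) \/ decides d (fun Y => ~ P (x Y) (y Y))).
Proof.
move=> hx hy; apply: dense_bind hx _ => d1 h1 [n hn].
apply: dense_map (dense_ext h1 hy) _ => d2 h2 [m hm].
case: (classic (P n m)) => h; [left|right] => Y hY;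
  by have [-> _] := hn Y (agrees_ext h2 hY); have [-> _] := hm Y hY.
Qed.

(** Truth at each oracle and forcing are two readings of [A] that agree once the atoms are decided.
    The induction carries both together, for [A] and for its negation, because an implication needs
    all four facts about its parts. *)
Lemma qf_decided G (A : form G) c e : qf A -> peq_env c e e ->
  dense c (fun d => (decides d (qf_holds A e) /\ force A d e) \/
                    (decides d (fun Y => ~ qf_holds A e Y) /\ force (Neg A) d e)).
Proof.
have atom d (P : oracle -> Prop) : dense d (fun d' => decides d' P) ->
    decides d (fun Y => ~ P Y) -> False.
  move=> h h'; have [d' hd' hP] := h d (ext_refl d).
  by apply: (@decides_absurd d') => Y hY; apply: (h' Y (agrees_ext hd' hY)); apply: hP.
elim: A c e => {G} // [G a b|G a b|G|G A IHA B IHB|G A IHA B IHB|G A IHA B IHB] c e hq he.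
- have ha := @peq_evaln _ _ a _ _ _ he; have hb := @peq_evaln _ _ b _ _ _ he.
  apply: dense_map (@atom_decided c _ _ (@eq nat) ha hb) _ => d hd [] h; [left|right]; split=> //.
    by apply: dense_all => d' hd'; apply: decides_ext h.
  by move=> d' hd' h'; apply: atom h' _; apply: decides_ext hd' h.
- have ha := @peq_evaln _ _ a _ _ _ he; have hb := @peq_evaln _ _ b _ _ _ he.
  apply: dense_map (@atom_decided c _ _ lt ha hb) _ => d hd [] h; [left|right]; split=> //.
    by apply: dense_all => d' hd'; apply: decides_ext h.
  by move=> d' hd' h'; apply: atom h' _; apply: decides_ext hd' h.
- by apply: dense_all => d hd; right; split=> // Y _.
- case: hq => hqA hqB; apply: dense_bind (IHA c e hqA he) _ => d1 h1 hA.
  apply: dense_map (IHB d1 e hqB (peq_env_ext h1 he)) _ => d2 h2 hB.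
  case: hA => -[a1 a2]; last first.
    right; split=> [Y hY [hYA _]|d' hd' [hA _]].
      exact: (a1 Y (agrees_ext h2 hY)).
    exact: (a2 d' (ext_trans hd' h2) hA).
  case: hB => -[b1 b2]; [left|right]; split.
  + move=> Y hY; split; [exact: (a1 Y (agrees_ext h2 hY))|exact: b1].
  + by split=> //; apply: force_ext h2 a2.
  + by move=> Y hY [_ hB]; apply: (b1 Y hY).
  + by move=> d' hd' [_ hB]; apply: (b2 d' hd').
- case: hq => hqA hqB; apply: dense_bind (IHA c e hqA he) _ => d1 h1 hA.
  apply: dense_map (IHB d1 e hqB (peq_env_ext h1 he)) _ => d2 h2 hB.
  case: hA => -[a1 a2].
    left; split=> [Y hY|]; first by left; apply: (a1 Y (agrees_ext h2 hY)).
    by apply: dense_all => d' hd'; left; apply: force_ext (ext_trans hd' h2) a2.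
  case: hB => -[b1 b2]; [left|right]; split.
  + by move=> Y hY; right; apply: b1.
  + by apply: dense_all => d' hd'; right; apply: force_ext hd' b2.
  + move=> Y hY [] h; [exact: (a1 Y (agrees_ext h2 hY))|exact: (b1 Y hY)].
  + move=> d' hd' h; have [d3 h3 []] := h d' (ext_refl d').
      exact: (a2 d3 (ext_trans (ext_trans h3 hd') h2)).
    exact: (b2 d3 (ext_trans h3 hd')).
- case: hq => hqA hqB; apply: dense_bind (IHA c e hqA he) _ => d1 h1 hA.
  apply: dense_map (IHB d1 e hqB (peq_env_ext h1 he)) _ => d2 h2 hB.
  case: hA => -[a1 a2]; last first.
    left; split=> [Y hY hYA|d' hd' hA].
      by case: (a1 Y (agrees_ext h2 hY)).
    by case: (a2 d' (ext_trans hd' h2) hA).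
  case: hB => -[b1 b2]; [left|right]; split.
  + by move=> Y hY _; apply: b1.
  + by move=> d' hd' _; apply: force_ext hd' b2.
  + by move=> Y hY h; apply: (b1 Y hY); apply: h; apply: (a1 Y (agrees_ext h2 hY)).
  + move=> d' hd' h; apply: (b2 d' hd'); apply: (h d' (ext_refl d')).
    exact: force_ext (ext_trans hd' h2) a2.
Qed.

Lemma force_qf G (A : form G) c e : qf A -> peq_env c e e ->
  force A c e <-> dense c (fun d => decides d (qf_holds A e)).
Proof.
move=> hq he; split=> h.
  apply: dense_map (qf_decided hq he) _ => d hd [[]//|[_ hn]].
  by case: (hn d (ext_refl d) (force_ext hd h)).
apply: force_dense; apply: dense_bind h _ => d hd h.
apply: dense_map (dense_ext hd (qf_decided hq he)) _ => d' hd' [[]//|[hn _]].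
case: (@decides_absurd d') => Y hY; apply: (hn Y hY); exact: h (agrees_ext hd' hY).
Qed.

Lemma force_of_sat G (A : form G) c e : qf A -> peq_env c e e ->
  (forall Y, qf_holds A e Y) -> force A c e.
Proof. by move=> hq he h; apply/(force_qf hq he); apply: dense_all => d _ Y _. Qed.

Lemma force_close G (A : form G) :
  (forall c e, peq_env c e e -> force A c e) -> forall c, force (close A) c (@anil nm).
Proof.
elim: G A => [|s G IH] A h c /=; first by apply: h; apply: peq_env_nil.
by apply: IH => {}c e he d hd x hx; apply: h; apply: peq_env_cons => //; apply: peq_env_ext he.
Qed.

Lemma peq_force_eq_at s G (a b : tm G s) c e : peq_env c e e ->
  peq c (evaln a e) (evaln b e) <-> force (eq_at a b) c e.
Proof.
elim: s G a b c e => [|s IHs t IH] G a b c e he /=.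
  split=> h; first by apply: dense_map h _ => d _ [n hn] Y /hn [-> ->].
  have ra := @peq_evaln _ _ a _ _ _ he.
  apply: dense_bind ra _ => d hd [n hn].
  apply: dense_map (dense_ext hd h) _ => d' hd' hab; exists n => Y hY.
  by rewrite -(hab Y hY); apply: hn (agrees_ext hd' hY).
have eqs (f : tm G (s ~> t)) (x : nm s) :
    evaln (App (ren_tm (@wk G s) f) v0) (acons x e) = (fun Y => evaln f e Y (x Y)).
  by apply: functional_extensionality => Y; rewrite /evaln /= eval_ren.
split=> h d hd.
  move=> x hx; apply/IH; first by apply: peq_env_cons => //; apply: peq_env_ext he.
  rewrite !eqs; exact: h.
move=> u v huv.
have := h d hd u (peq_left huv); rewrite -IH; last first.
  exact (peq_env_cons (peq_left huv) (peq_env_ext hd he)).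
rewrite !eqs.
(* The formula compares [a] and [b] at the same argument [u]; that [b] is related to itself moves it
   on to the related argument [v]. *)
move=> huu; apply: peq_trans huu _.
exact: (@peq_ext (s ~> t) _ _ _ _ hd (@peq_evaln _ _ b _ _ _ he) d (ext_refl d) u v huv).
Qed.

Ltac force_alls := repeat (lazymatch goal with |- force (All _ _) _ _ => idtac end; let d := fresh "d" in let hd := fresh "hd" in
  let x := fresh "x" in let hx := fresh "hx" in move=> d hd x hx).
Ltac renv := repeat first [ exact: peq_env_nil | apply: peq_env_cons
  | assumption | eapply peq_ext; [|eassumption] | eapply peq_env_ext; [|eassumption]
  | assumption | apply: ext_refl | eapply ext_trans; [eassumption|] ].

Lemma force_semiring A c : In A semiring_axioms -> force A c (@anil nm).
Proof.
rewrite /semiring_axioms /=.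
do ?[case=> [<-|]] => //.
all: force_alls; apply: force_of_sat; [by cbn; tauto|by renv|].
all: rewrite /qf_holds => Y /=; try lia; nia.
Qed.

(** A name of a number is locally a standard number, so induction outside the model suffices. *)
Lemma force_induction G (A : form (ty0 :: G)) : qf A -> forall c e, peq_env c e e ->
  force (qf_induction A) c e.
Proof.
move=> hq c e he d hd /force_inst h0 d1 h1 hS d2 h2 x hx.
have hn n d' : ext d' d1 -> force A d' (ncons ty0 (fun _ => n) e).
  elim: n d' => [|n IH] d' hd'; first exact: force_ext (ext_trans hd' h1) h0.
  have h : force (subst_form (@scons G (ty0 :: G) ty0 (v0 + 1)%tm (fun s x => Var (vs x))) A) d'
      (ncons ty0 (fun _ => n) e).
    exact: (hS d' hd' (fun _ => n) (@peq_const0 d' n) d' (ext_refl d') (IH d' hd')).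
  move: h; rewrite force_subst.
  have -> // : (fun s y => evaln (@scons (G) (ty0 :: G) ty0 (v0 + 1)%tm (fun s x => Var (vs x)) s y)
      (ncons ty0 (fun _ => n) e)) = ncons ty0 (fun _ => S n) e.
  apply: (@var_cons_ext _ _ nm) => //=.
  by apply: functional_extensionality => Y; rewrite /evaln /= Nat.add_1_r.
apply: force_dense; apply: dense_map hx _ => d3 h3 [n hx].
apply: force_congr (hn n d3 (ext_trans h3 h2)).
apply: peq_env_cons; last by renv.
apply: peq_sym; apply: dense_all => d4 h4; exists n => Y hY.
by case: (hx Y (agrees_ext h4 hY)).
Qed.

Lemma least_number (P : nat -> Prop) n : P n -> exists m, P m /\ forall k, k < m -> ~ P k.
Proof.
move=> hn; apply: NNPP => h; move: hn.
have : forall m k, k < m -> ~ P k; last by move/(_ (S n) n (Nat.lt_succ_diag_r n)).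
elim=> [|m IH] k hk; first by lia.
move=> hP; apply: h; exists k; split=> // j hj; apply: IH; lia.
Qed.

Definition least (P : nat -> Prop) : nat :=
  epsilon (inhabits 0) (fun m => P m /\ forall k, k < m -> ~ P k).

Lemma least_eq (P : nat -> Prop) m : P m -> (forall k, k < m -> ~ P k) -> least P = m.
Proof.
move=> hm hk; have [h1 h2] : P (least P) /\ forall k, k < least P -> ~ P k.
  by apply: (epsilon_spec (inhabits 0) (fun m => P m /\ forall k, k < m -> ~ P k)); exists m.
case: (Nat.lt_trichotomy (least P) m) => [h|[//|h]].
  by case: (hk _ h).
by case: (h2 _ h).
Qed.

(** The choice functional takes the least witness at each oracle. Its existence as a name requires
    that the least witness be decided, that is, the truth of [A] at all smaller numbers as well. As
    the argument is locally a ground function, one fusion decides [A] at all numbers. *)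
Lemma force_choice G (A : form (ty0 :: ty1 :: G)) : qf A -> forall c e, peq_env c e e ->
  force (choice A) c e.
Proof.
move=> hq c e he c1 hc1 hA.
pose Z : nm ty2 := fun Y f => least (fun n => sat (M := std) A (fcons ty0 n (fcons ty1 f (at_oracle e Y)))).
have key d (u w : nm ty1) : ext d c1 -> peq d u w -> dense d (fun d' => exists n,
    decides d' (fun Y => (Z Y (u Y) = n /\ Z Y (w Y) = n) /\
       sat (M := std) A (fcons ty0 n (fcons ty1 (u Y) (at_oracle e Y))))).
  move=> hd huw.
  have hed : peq_env d e e by apply: peq_env_ext (ext_trans hd hc1) he.
  apply: dense_bind (peq1_ground huw) _ => d1 h1 [g hg].
  pose E n : assign nm (ty0 :: ty1 :: G) := ncons ty0 (fun _ => n) (ncons ty1 u e).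
  have hE n d' : ext d' d -> peq_env d' (E n) (E n).
    move=> h; apply: peq_env_cons; first exact: peq_const0.
    by apply: peq_env_cons; [apply: peq_ext h (peq_left huw)|apply: peq_env_ext h hed].
  have hdec : dense d1 (fun d' => forall n, decides d' (qf_holds A (E n)) \/
      decides d' (fun Y => ~ qf_holds A (E n) Y)).
    apply: fusion => n; first by move=> a b hab [] h; [left|right]; apply: positive_decides hab h.
    by apply: dense_map (qf_decided hq (hE n d1 h1)) _ => d' _ [] [h _]; [left|right].
  apply: dense_bind hdec _ => d2 h2 hdec.
  have hex := hA d2 (ext_trans h2 (ext_trans h1 hd)) u (peq_ext (ext_trans h2 h1) (peq_left huw)).
  apply: dense_bind hex _ => d3 h3 [a ha hfa].
  apply: dense_bind ha _ => d4 h4 [n hn].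
  have h42 := ext_trans h4 h3.
  have hfn : force A d4 (E n).
    apply: force_congr (force_ext h4 hfa); apply: peq_env_cons.
      by apply: dense_all => d5 h5; exists n => Y /(agrees_ext h5) /hn [].
    exact: (fun s (x : var (ty1 :: G) s) => hE n d4 (ext_trans h42 (ext_trans h2 h1)) s (vs x)).
  have hyes m : ~ decides d4 (fun Y => ~ qf_holds A (E m) Y) -> decides d4 (qf_holds A (E m)).
    case: (hdec m) => [h _|h h']; first exact: decides_ext h42 h.
    by case: h'; apply: decides_ext h42 h.
  have hno m : ~ decides d4 (qf_holds A (E m)) -> decides d4 (fun Y => ~ qf_holds A (E m) Y).
    by move=> h; apply: NNPP => h'; apply: h; apply: hyes.
  have hn' : decides d4 (qf_holds A (E n)).
    (* Here [d4] forces [A] at [n], so the negative decision is impossible; below, the least [m]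
       with a positive decision has negative decisions at all smaller numbers. *)
    apply: hyes => h.
    have := proj1 (force_qf hq (hE n d4 (ext_trans h42 (ext_trans h2 h1)))) hfn.
    move=> hd4; have [d5 h5 hd5] := hd4 d4 (ext_refl d4).
    by apply: (@decides_absurd d5) => Y hY; apply: (h Y (agrees_ext h5 hY)); apply: hd5.
  have [m [hm hk]] := least_number (P := fun m => decides d4 (qf_holds A (E m))) hn'.
  apply: dense_all => d5 h5; exists m => Y hY.
  have hY4 := agrees_ext h5 hY.
  have [eu ew] := hg Y (agrees_ext (ext_trans h42 h2) hY4).
  have hmY := hm Y hY4; rewrite /qf_holds /E !at_oracle_cons in hmY.
  have Zu : Z Y (u Y) = m.
    apply: least_eq => // k hkm; have := hno k (hk k hkm) Y hY4.
    by rewrite /qf_holds /E !at_oracle_cons.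
  by split=> //; split=> //; rewrite ew -eu.
apply: dense_all => c2 hc2; exists Z.
  move=> d hd u w huw; apply: dense_map (key d u w (ext_trans hd hc2) huw) _ => d' _ [n hn].
  by exists n => Y /hn [].
move=> d hd x hx.
refine (proj2 (@force_subst _ A (ty1 :: ty2 :: G) _ d (ncons ty1 x (ncons ty2 Z e))) _).
have -> : (fun s y => evaln (@scons (ty1 :: G) (ty1 :: ty2 :: G) ty0 (v1 @ v0)%tm
      (scons v0 (fun u x => Var (vs (vs x)))) s y) (ncons ty1 x (ncons ty2 Z e))) =
    ncons ty0 (fun Y => Z Y (x Y)) (acons x e).
  apply: (@var_cons_ext _ _ nm) => //; exact: var_cons_ind.
have hdc1 := ext_trans hd hc2; have hdc := ext_trans hdc1 hc1.
apply/(force_qf hq).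
  apply: peq_env_cons; last by renv.
  by apply: dense_map (key d x x hdc1 hx) _ => d' _ [n hn]; exists n => Y /hn [].
apply: dense_map (key d x x hdc1 hx) _ => d' _ [n hn] Y /hn [[hZ _] h].
by rewrite /qf_holds !at_oracle_cons hZ.
Qed.

Lemma force_RCA0w A c : RCA0w A -> force A c (@anil nm).
Proof.
move=> hA; case: {A} hA c => [A hA|s t|r s t|||s t|G A hq|G A hq] c.
- exact: force_semiring.
- move=> d1 h1 x hx d2 h2 y hy; apply/peq_force_eq_at; first by renv.
  exact: peq_ext h2 hx.
- move=> d1 h1 x hx d2 h2 y hy d3 h3 z hz; apply/peq_force_eq_at; first by renv.
  refine (@peq_evaln _ t (v2 @ v0 @ (v1 @ v0))%tm d3
    (ncons r z (ncons (r ~> s) y (ncons (r ~> s ~> t) x (@anil nm)))) _ _); by renv.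
- force_alls; apply: force_of_sat => //; by renv.
- force_alls; apply: force_of_sat => //; first by renv.
  by move=> Y; rewrite /qf_holds /= Nat.add_1_r.
- move=> d1 h1 f hf d2 h2 x hx d3 h3 y hy d4 h4 /peq_force_eq_at h.
  apply/peq_force_eq_at; first by renv.
  have hxy : peq d4 x y by apply: h; renv.
  exact: (hf d4 (ext_trans h4 (ext_trans h3 h2)) _ _ hxy).
- by apply: force_close; apply: force_induction.
- by apply: force_close; apply: force_choice.
Qed.

(** * Ground objects as names, and Delta-comprehension *)

Lemma peq_const1 c (g : baire) : @peq ty1 c (fun _ => g) (fun _ => g).
Proof.
move=> d hd u v huv; apply: dense_map huv _ => d' _ [n hn]; exists (g n) => Y /hn [-> ->] //.
Qed.

(** For an arbitrary, possibly discontinuous [S] this rests on [peq1_ground]: two related names of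
    functions are locally one and the same ground function. *)
Lemma peq_const2 c (S : F ty2) : @peq ty2 c (fun _ => S) (fun _ => S).
Proof.
move=> d hd u v huv; apply: dense_map (peq1_ground huv) _ => d' _ [g hg].
by exists (S g) => Y /hg [-> ->].
Qed.

(** A witness can be taken in the ground model, so that being witnessed becomes a positive property
    of conditions. *)
Lemma force_sigma G (Z : tm G ty_family) (n : tm G ty0) c e : peq_env c e e ->
  force (sigma_of Z n) c e <->
  dense c (fun d => exists g, decides d (fun Y => evaln Z e Y g (evaln n e Y) = 0)).
Proof.
move=> he; have eqn (f : nm ty1) Y :
    evaln (ren_tm (@wk _ _) Z @ v0 @ ren_tm (@wk _ _) n)%tm (ncons ty1 f e) Y =
    evaln Z e Y (f Y) (evaln n e Y) by rewrite /evaln /= !eval_ren.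
rewrite /sigma_of /=; split=> h.
  apply: dense_bind h _ => d hd [f hf hZ].
  apply: dense_bind (peq1_ground hf) _ => d1 h1 [g hg].
  apply: dense_map (dense_ext h1 hZ) _ => d2 h2 hZ2; exists g => Y hY.
  by have := hZ2 Y hY; rewrite eqn; have [-> _] := hg Y (agrees_ext h2 hY).
apply: dense_map h _ => d hd [g hg]; exists (fun _ => g); first exact: peq_const1.
by apply: dense_all => d' hd' Y hY; rewrite eqn; apply: hg (agrees_ext hd' hY).
Qed.

Lemma peq0_ground c (x : nm ty0) : peq c x x -> dense c (fun d => exists n, peq d x (fun _ => n)).
Proof.
move=> h; apply: dense_map h _ => d hd [n hn]; exists n.
by apply: dense_all => d' hd'; exists n => Y /(agrees_ext hd') /hn [].
Qed.

(** That [A_0(n)] fails is not a positive property: it depends on the avoided values. The hypothesis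
    replaces it by a witness for [A_1(n)], so [fusion] can settle all [n] by one condition. *)
Lemma force_DeltaCA c : force DeltaCA c (@anil nm).
Proof.
move=> c1 h1 Z0 hZ0 c2 h2 Z1 hZ1 c3 h3 hH.
pose e : assign nm [ty_family; ty_family] := ncons ty_family Z1 (ncons ty_family Z0 (@anil nm)).
have he d : ext d c2 -> peq_env d e e.
  by move=> hd; apply: peq_env_cons; [apply: peq_ext hd _|apply: peq_env_cons;
    [apply: peq_ext (ext_trans hd h2) _|apply: peq_env_nil]].
pose en i : assign nm (ty0 :: [ty_family; ty_family]) := ncons ty0 (fun _ => i) e.
have hen i d : ext d c2 -> peq_env d (en i) (en i).
  by move=> hd; apply: peq_env_cons; [exact: peq_const0|apply: he].
have hHn i d : ext d c3 -> force (sigma_of (G := [ty0; ty_family; ty_family]) v2 v0 <-->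
   ~ sigma_of v1 v0)%form d (en i).
  by move=> hd; apply: hH => //; exact: peq_const0.
pose s0 d i := exists g, decides d (fun Y => Z0 Y g i = 0).
pose s1 d i := exists g, decides d (fun Y => Z1 Y g i = 0).
have f0 d i : ext d c3 -> force (sigma_of (G := [ty0; ty_family; ty_family]) v2 v0) d (en i) <->
    dense d (fun d' => s0 d' i).
  by move=> hd; apply: force_sigma; apply: hen (ext_trans hd h3).
have f1 d i : ext d c3 -> force (sigma_of (G := [ty0; ty_family; ty_family]) v1 v0) d (en i) <->
    dense d (fun d' => s1 d' i).
  by move=> hd; apply: force_sigma; apply: hen (ext_trans hd h3).
have mono (Z : nm ty_family) d d' i : ext d' d ->
    (exists g, decides d (fun Y => Z Y g i = 0)) ->
    (exists g, decides d' (fun Y => Z Y g i = 0)).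
  by move=> hd [g hg]; exists g; apply: decides_ext hg.
have hU : dense c3 (fun d => forall i, s0 d i \/ s1 d i).
  apply: fusion => i.
    by move=> a b hab [] [g hg]; [left|right]; exists g; apply: positive_decides hab hg.
  move=> d hd.
  case: (classic (exists2 d', ext d' d & s0 d' i)) => [[d' hd' h]|hn0].
    by exists d' => //; left.
  case: (classic (exists2 d', ext d' d & s1 d' i)) => [[d' hd' h]|hn1].
    by exists d' => //; right.
  (* If neither side can be witnessed below [d], then [d] forces the negation of [A_1] at [i], hence
     [A_0] at [i], and so a witness after all. *)
  have [_ h10] := hHn i d hd.
  have : force (sigma_of (G := [ty0; ty_family; ty_family]) v2 v0) d (en i).
    apply: (h10 d (ext_refl d)) => d' hd' /f1 hs.
    have [d2 hd2 hs2] := hs (ext_trans hd' hd) d' (ext_refl d').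
    by apply: hn1; exists d2 => //; apply: ext_trans hd'.
  move/(f0 _ _ hd)/(_ d (ext_refl d)) => [d2 hd2 hs2].
  by case: hn0; exists d2.
apply: dense_map hU _ => d hd hU.
(* The condition [d] by itself settles every instance, so the set is a ground object and its
   constant name exists. *)
pose X i := if excluded_middle_informative (s0 d i) is left _ then 1 else 0.
have hX01 i : X i = 0 \/ X i = 1 by rewrite /X; case: excluded_middle_informative; auto.
have hX1 i : X i = 1 <-> s0 d i.
  by rewrite /X; case: excluded_middle_informative.
exists (fun _ => X); first exact: peq_const1.
have hdc2 := ext_trans hd h3.
split.
  move=> d1 hd1 x hx.
  refine (@force_of_sat _ (v1 @ v0 == 0 \/ v1 @ v0 == 1)%form d1
    (ncons ty0 x (ncons ty1 (fun _ => X) e)) (conj I I) _ _).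
    apply: peq_env_cons => //; apply: peq_env_cons; first exact: peq_const1.
    exact: he (ext_trans hd1 hdc2).
  by move=> Y; apply: hX01.
move=> d1 hd1 x hx.
change (force (G := [ty0; ty1; ty_family; ty_family])
  (elem v0 v1 <--> sigma_of (Var (vs (vs (vs vz)))) v0)%form d1
  (ncons ty0 x (ncons ty1 (fun _ => X) e))).
apply: force_dense; apply: dense_map (peq0_ground hx) _ => d2 h2' [i hi].
have hd2 := ext_trans h2' hd1; have hd2c := ext_trans hd2 hd.
have henv : peq_env d2 (ncons ty0 (fun _ => i) (ncons ty1 (fun _ => X) e))
                    (ncons ty0 x (ncons ty1 (fun _ => X) e)).
  apply: peq_env_cons; first exact: peq_sym hi.
  apply: peq_env_cons; first exact: peq_const1.
  exact: he (ext_trans hd2c h3).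
apply: (force_congr henv); have {}henv := peq_env_left henv.
have fs d3 : ext d3 d2 -> force (sigma_of (G := [ty0; ty1; ty_family; ty_family])
      (Var (vs (vs (vs vz)))) v0) d3
      (ncons ty0 (fun _ => i) (ncons ty1 (fun _ => X) e)) <-> dense d3 (fun d' => s0 d' i).
  by move=> h; apply: force_sigma; apply: peq_env_ext h henv.
split=> d3 hd3.
  move=> hX; apply/(fs d3 hd3).
  have [d4 h4 hX4] := hX d3 (ext_refl d3).
  have [Y hY] := agrees_ex d4.
  have /hX1 h0 : X i = 1 := hX4 Y hY.
  by apply: dense_all => d5 h5; apply: mono h0; apply: ext_trans (ext_trans h5 hd3) hd2.
move/(fs d3 hd3) => hs.
have hXi : X i = 1.
  (* A witness for [A_1] at [i] would contradict the equivalence at [d3], where [A_0] is forced. *)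
  apply/hX1; case: (hU i) => // h1'.
  have [h01 _] := hHn i d3 (ext_trans hd3 hd2c).
  case: (h01 d3 (ext_refl d3) _ d3 (ext_refl d3)).
    by apply/f0 => //; apply: ext_trans hd3 hd2c.
  apply/f1; first by apply: ext_trans hd3 hd2c.
  by apply: dense_all => d5 h5; apply: mono h1'; apply: ext_trans (ext_trans h5 hd3) hd2.
by apply: dense_all => d5 h5 Y _.
Qed.

(** * Second-order truth and the functionals deciding it *)

Fixpoint second_order G (A : form G) : Prop :=
  match A with
  | Eq _ _ | Lt _ _ | Bot => True
  | And A B | Or A B | Imp A B => (second_order A /\ second_order B)%type
  | All s A | Ex s A => ((s = ty0 \/ s = ty1) /\ second_order A)%type
  end.

Lemma peq_const_low s c (x : F s) : s = ty0 \/ s = ty1 -> peq c (fun _ => x) (fun _ => x).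
Proof. by case=> e; subst s; [exact: peq_const0|exact: peq_const1]. Qed.

Lemma peq_ground_low s c (x : nm s) : s = ty0 \/ s = ty1 -> peq c x x ->
  dense c (fun d => exists n, peq d x (fun _ => n)).
Proof.
case=> e; subst s; first exact: peq0_ground.
move/peq1_ground => h; apply: dense_map h _ => d hd [g hg]; exists g.
by apply: peq_decides (@peq_const1 d g) => Y /hg [].
Qed.

(* No new functions on the numbers are added, so forcing second-order statements about
   objects of the standard model is truth there. *)
Lemma force_second_order G (A : form G) : second_order A -> forall (e : assign F G),
  (forall c, peq_env c (fun s x _ => e s x) (fun s x _ => e s x)) ->
  forall c, force A c (fun s x _ => e s x) <-> sat (M := std) A e.
Proof.
have cst (c : cond) (P : Prop) : dense c (fun d => decides d (fun _ => P)) <-> P.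
  split=> [h|h]; last by apply: dense_all => d hd Y _.
  have [d hd hP] := h c (ext_refl c); have [Y hY] := agrees_ex d; exact: hP hY.
have cstd (c : cond) (P : Prop) : dense c (fun d => P) <-> P.
  split=> [h|h]; last by apply: dense_all.
  by have [d hd hP] := h c (ext_refl c).
have envc G' s (x : F s) (e : assign F G') :
    ncons s (fun _ => x) (fun s x _ => e s x) = (fun s' y _ => fcons s x e s' y).
  by apply: (@var_cons_ext _ _ nm).
elim: A => {G} [G a b|G a b|G|G A IHA B IHB|G A IHA B IHB|G A IHA B IHB|G s A IH|G s A IH] hs e he c //=.
- exact: (cst c (eval (M := std) a e = eval (M := std) b e)).
- exact: (cst c (eval (M := std) a e < eval (M := std) b e)).
- by case: hs => hA hB; rewrite IHA // IHB.
- case: hs => hA hB; split=> h.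
    by apply/(cstd c); apply: dense_map h _ => d _; rewrite IHA // IHB.
  by apply: dense_all => d _; rewrite IHA // IHB.
- case: hs => hA hB; split=> [h hsA|h d hd]; last by rewrite IHA // IHB.
  by apply/(IHB hB e he c); apply: h; [exact: ext_refl|apply/IHA].
- case: hs => hs hA.
  have he' x d : peq_env d (fun s' y _ => fcons s x e s' y) (fun s' y _ => fcons s x e s' y).
    by rewrite -envc; apply: peq_env_cons => //; apply: peq_const_low.
  split=> [h x|h d hd x hx].
    have := h c (ext_refl c) (fun _ => x) (peq_const_low c x hs).
    by rewrite envc IH.
  apply: force_dense; apply: dense_map (peq_ground_low hs hx) _ => d' hd' [n hn].
  apply: (@force_congr _ _ _ (ncons s (fun _ => n) (fun s x _ => e s x))).
    by apply: peq_env_cons => //; apply: peq_sym.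
  by rewrite envc IH.
- case: hs => hs hA.
  have he' x d : peq_env d (fun s' y _ => fcons s x e s' y) (fun s' y _ => fcons s x e s' y).
    by rewrite -envc; apply: peq_env_cons => //; apply: peq_const_low.
  split=> [h|[x h]].
    apply/(cstd c); apply: dense_bind h _ => d hd [x hx hf].
    apply: dense_map (peq_ground_low hs hx) _ => d' hd' [n hn]; exists n.
    apply/(IH hA _ (he' n) d'); rewrite -envc.
    apply: (@force_congr _ _ _ (ncons s x (fun s x _ => e s x))); last exact: force_ext hf.
    by apply: peq_env_cons.
  apply: dense_all => d hd; exists (fun _ => x); first exact: peq_const_low.
  by rewrite envc IH.
Qed.

Lemma eval_lam_std G s t (a : tm (s :: G) t) (e : assign F G) (x : F s) :
  eval (M := std) (lam a) e x = eval (M := std) a (fcons s x e).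
Proof. exact: (eval_lam (M := std)). Qed.

Lemma eval_tuple G G' (l : list (tm G ty0)) (l' : list (tm G' ty0)) (e : assign F G) e' :
  map (fun a => eval (M := std) a e) l = map (fun a => eval (M := std) a e') l' ->
  eval (M := std) (tuple l) e = eval (M := std) (tuple l') e'.
Proof.
have [P pairE] : exists P, forall D (a b : tm D ty0) (d : assign F D), eval (M := std) (pair a b) d =
    P (eval (M := std) a d) (eval (M := std) b d).
  by exists (fun x y => eval (M := std) (pair v1 v0 : tm [ty0; ty0] ty0)
    (fcons ty0 y (fcons ty0 x (@anil F)))).
case: l l' => [|a l] [|a' l'] //= [ha hl].
elim: l l' a a' ha hl => [|b l IH] [|b' l'] //= a a' ha [hb hl].
by apply: IH; [rewrite !pairE ha hb; reflexivity|exact: hl].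
Qed.

Lemma eval_rec_std G (f : tm (ty0 :: ty0 :: G) ty0) m n (e : assign F G) :
  eval (M := std) (rec f m n) e =
  nat_rect (fun _ => nat) (eval (M := std) m e)
    (fun i v => eval (M := std) f (fcons ty0 v (fcons ty0 i e))) (eval (M := std) n e).
Proof.
rewrite /rec /=; congr (nat_rect _ _ _ _).
apply: functional_extensionality => i; apply: functional_extensionality => v.
by rewrite !eval_lam_std.
Qed.

Lemma eval_bar G G' (g : tm G ty1) (g' : tm G' ty1) (e : assign F G) e' n :
  eval (M := std) g e = eval (M := std) g' e' ->
  eval (M := std) (bar (ren_tm (@wk _ _) g) v0) (fcons ty0 n e) =
  eval (M := std) (bar (ren_tm (@wk _ _) g') v0) (fcons ty0 n e').
Proof.
move=> h; rewrite /bar !eval_rec_std.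
congr (nat_rect _ _ _ _); apply: functional_extensionality => i.
apply: functional_extensionality => v /=; congr (_ + _).
by rewrite !eval_ren /= h.
Qed.

(** Truth of a normal form depends only on the values of [f] and [gs]. In [Sk] the formula stands in
    a context that also contains the functional, and this lemma allows that entry to be changed. *)
Lemma sat_normal_form k : forall b G G' (f : tm G ty1) (f' : tm G' ty1) gs gs' e e',
  eval (M := std) f e = eval (M := std) f' e' ->
  map (fun a => eval (M := std) a e) gs = map (fun a => eval (M := std) a e') gs' ->
  sat (M := std) (normal_form k b f gs) e -> sat (M := std) (normal_form k b f' gs') e'.
Proof.
elim: k => [|k IH] b G G' f f' gs gs' e e' hf hg /=.
  have body n : eval (M := std) (ren_tm (@wk _ _) f @
        tuple (map (fun g => bar (ren_tm (@wk _ _) g) v0) gs))%tm (fcons ty0 n e) =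
      eval (M := std) (ren_tm (@wk _ _) f' @
        tuple (map (fun g => bar (ren_tm (@wk _ _) g) v0) gs'))%tm (fcons ty0 n e').
    rewrite /= !eval_wk hf; congr (_ _); apply: eval_tuple; rewrite !map_map.
    elim: gs gs' hg => [|g gs IH] [|g' gs'] //= [h1 h2].
    by congr (_ :: _); [exact: eval_bar|exact: IH].
  case: b => /=; first by move=> [n hn]; exists n; exact: (eq_trans (eq_sym (body n)) hn).
  by move=> h n; exact: (eq_trans (eq_sym (body n)) (h n)).
have step x : eval (M := std) (ren_tm (@wk G ty1) f) (fcons ty1 x e) =
    eval (M := std) (ren_tm (@wk G' ty1) f') (fcons ty1 x e') /\
  map (fun a => eval (M := std) a (fcons ty1 x e)) (map (fun g => ren_tm (@wk G ty1) g) gs ++ [v0]) =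
  map (fun a => eval (M := std) a (fcons ty1 x e')) (map (fun g => ren_tm (@wk G' ty1) g) gs' ++ [v0]).
  rewrite !eval_wk; split=> //; rewrite !map_app !map_map; congr (_ ++ _).
  rewrite -(map_ext (fun a => eval (M := std) a e)); last by move=> a; rewrite eval_wk.
  by rewrite hg; apply: map_ext => a; rewrite eval_wk.
case: b => /=.
  by move=> [x hx]; exists x; have [h1 h2] := step x; apply: IH h1 h2 hx.
by move=> h x; have [h1 h2] := step x; apply: IH h1 h2 (h x).
Qed.

Lemma second_order_normal_form k : forall b G (f : tm G ty1) gs,
  second_order (normal_form k b f gs).
Proof. by elim: k => [|k IH] [] G f gs //=; split; auto. Qed.

Lemma force_Sk k c : force (Sk k) c (@anil nm).
Proof.
pose P g (S : F ty2) := sat (M := std) (normal_form k true v0 []) (fcons ty1 g (fcons ty2 S (@anil F))).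
(* The functional being defined belongs to the environment of the formula it decides. The dummy
   entry [fun _ => 0] avoids the circularity, and [sat_normal_form] exchanges it for [S]. *)
pose S : F ty2 := fun g => if excluded_middle_informative (P g (fun _ => 0)) is left _ then 0 else 1.
have hS01 g : S g = 0 \/ S g = 1 by rewrite /S; case: excluded_middle_informative; auto.
have hS g : S g = 0 <-> P g S.
  have -> : P g S <-> P g (fun _ => 0) by split; apply: sat_normal_form.
  by rewrite /S; case: excluded_middle_informative.
apply: dense_all => c1 h1; exists (fun _ => S); first exact: peq_const2.
split=> d hd x hx.
  refine (@force_of_sat _ (v1 @ v0 == 0 \/ v1 @ v0 == 1)%form d
    (ncons ty1 x (ncons ty2 (fun _ => S) (@anil nm))) (conj I I) _ _).
    apply: peq_env_cons => //; apply: peq_env_cons; [exact: peq_const2|exact: peq_env_nil].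
  by move=> Y; apply: hS01.
change (force (G := [ty1; ty2]) (normal_form k true v0 [] <--> v1 @ v0 == 0)%form d
  (ncons ty1 x (ncons ty2 (fun _ => S) (@anil nm)))).
apply: force_dense; apply: dense_map (peq_ground_low (or_intror eq_refl) hx) _ => d' hd' [g hg].
apply: (@force_congr _ _ _ (ncons ty1 (fun _ => g) (ncons ty2 (fun _ => S) (@anil nm)))).
  apply: peq_env_cons; first exact: peq_sym.
  apply: peq_env_cons; [exact: peq_const2|exact: peq_env_nil].
have -> : ncons ty1 (fun _ => g) (ncons ty2 (fun _ => S) (@anil nm)) =
    (fun s x _ => fcons ty1 g (fcons ty2 S (@anil F)) s x).
  apply: (@var_cons_ext _ _ nm) => //; apply: var_cons_ind => // t y.
  by move: t y; apply: var_nil_ind.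
apply/force_second_order.
- by split; split=> //; apply: second_order_normal_form.
- move=> c'; apply: var_cons_ind; first exact: peq_const1.
  apply: var_cons_ind; first exact: peq_const2.
  by move=> t y; exact: (@var_nil_ind (fun _ _ => _) t y).
- by split=> /hS.
Qed.

(* Real numbers in the standard structure *)
From Stdlib Require Import Reals Lra.

Lemma eval_pow2_std G (n : tm G ty0) (e : assign F G) :
  eval (M := std) (pow2 n) e = 2 ^ eval (M := std) n e.
Proof.
rewrite /pow2 eval_rec_std; elim: (eval (M := std) n e) => //= n' ->; lia.
Qed.

Definition qpos_std (q : nat) : nat := eval (M := std) (qpos v0) (fcons ty0 q (@anil F)).
Definition qneg_std (q : nat) : nat := eval (M := std) (qneg v0) (fcons ty0 q (@anil F)).
Definition qden_std (q : nat) : nat := eval (M := std) (qden v0) (fcons ty0 q (@anil F)).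

Definition qval (q : nat) : R := ((INR (qpos_std q) - INR (qneg_std q)) / INR (qden_std q))%R.

(** The difference of the two sides is [x - y - k / 2^N] times the positive factor [2^N * d * d'],
    so the signs agree. *)
Lemma scaled_fractions (p n d p' n' d' k N : nat) : 0 < d -> 0 < d' ->
  let x := ((INR p - INR n) / INR d)%R in let y := ((INR p' - INR n') / INR d')%R in
  let lhs := 2 ^ N * (p * d' + n' * d) in
  let rhs := 2 ^ N * (n * d' + p' * d) + k * (d * d') in
  (lhs <= rhs <-> (x - y <= INR k * / 2 ^ N)%R) /\ (lhs < rhs <-> (x - y < INR k * / 2 ^ N)%R).
Proof.
move=> /lt_0_INR hd /lt_0_INR hd' x y lhs rhs.
have ht : (0 < 2 ^ N)%R by apply: pow_lt; lra.
have hp : (0 < 2 ^ N * (INR d * INR d'))%R.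
  by apply: Rmult_lt_0_compat => //; apply: Rmult_lt_0_compat.
have hdiff : (INR lhs - INR rhs = (x - y - INR k * / 2 ^ N) * (2 ^ N * (INR d * INR d')))%R.
  rewrite /lhs /rhs !plus_INR !mult_INR !plus_INR !mult_INR !pow_INR /x /y.
  rewrite (_ : INR 2 = 2%R) //; field; lra.
move: hdiff hp; set z := (x - y - _)%R; set w := (2 ^ N * _)%R => hdiff hp.
have -> : (x - y <= INR k * / 2 ^ N <-> z <= 0)%R by rewrite /z; split; lra.
have -> : (x - y < INR k * / 2 ^ N <-> z < 0)%R by rewrite /z; split; lra.
have [-> ->] : (lhs <= rhs <-> (INR lhs <= INR rhs)%R) /\ (lhs < rhs <-> (INR lhs < INR rhs)%R).
  by split; split; [apply: le_INR|apply: INR_le|apply: lt_INR|apply: INR_lt].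
move: (INR lhs) (INR rhs) hdiff => a b hdiff; clearbody z w; split; split=> h.
- apply: Rnot_lt_le => hz; have := Rmult_lt_0_compat _ _ hz hp; lra.
- have : (0 <= - z * w)%R by apply: Rmult_le_pos; lra.
  lra.
- apply: Rnot_le_lt => hz; have : (0 <= z * w)%R by apply: Rmult_le_pos; lra.
  lra.
- have : (0 < - z * w)%R by apply: Rmult_lt_0_compat; lra.
  lra.
Qed.

Lemma rat_le_std G (q r k n : tm G ty0) e :
  sat (M := std) (rat_le q r k n) e <->
  (qval (eval (M := std) q e) - qval (eval (M := std) r e) <=
   INR (eval (M := std) k e) * / 2 ^ eval (M := std) n e)%R.
Proof.
have pos x : 0 < qden_std x by rewrite /qden_std /=; lia.
rewrite -(proj1 (scaled_fractions _ _ _ _ _ _ (pos _) (pos _))).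
rewrite -eval_pow2_std Nat.le_lteq; exact: iff_refl.
Qed.

Lemma rat_lt_std G (q r k n : tm G ty0) e :
  sat (M := std) (rat_lt q r k n) e <->
  (qval (eval (M := std) q e) - qval (eval (M := std) r e) <
   INR (eval (M := std) k e) * / 2 ^ eval (M := std) n e)%R.
Proof.
have pos x : 0 < qden_std x by rewrite /qden_std /=; lia.
rewrite -(proj2 (scaled_fractions _ _ _ _ _ _ (pos _) (pos _))).
rewrite -eval_pow2_std; exact: iff_refl.
Qed.

Definition unit_real (g : baire) : Prop :=
  (forall n i : nat, qval (g n) - qval (g (n + i)%nat) < / 2 ^ n /\
     qval (g (n + i)%nat) - qval (g n) < / 2 ^ n)%R /\
  (forall n : nat, 0 - qval (g n) <= 2 * / 2 ^ n /\ qval (g n) - 1 <= 2 * / 2 ^ n)%R.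

Definition same_real (g h : baire) : Prop :=
  (forall n, qval (g n) - qval (h n) <= 2 * / 2 ^ n /\ qval (h n) - qval (g n) <= 2 * / 2 ^ n)%R.

Lemma sat_eq_real_std G (x y : tm G ty1) (e : assign F G) :
  sat (M := std) (eq_real x y) e <-> same_real (eval (M := std) x e) (eval (M := std) y e).
Proof.
have wk2 (a : tm G ty1) (n : nat) :
    eval (M := std) (ren_tm (@wk _ _) a @ v0)%tm (fcons ty0 n e) = eval (M := std) a e n.
  by rewrite /= eval_ren.
split=> H n; have [h1 h2] := H n.
  split.
    by have := proj1 (rat_le_std _ _ _ _ _) h1; rewrite !wk2.
  by have := proj1 (rat_le_std _ _ _ _ _) h2; rewrite !wk2.
by split; apply/rat_le_std; rewrite !wk2.
Qed.

Lemma sat_in_unit_std G (x : tm G ty1) (e : assign F G) :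
  sat (M := std) (in_unit x) e <-> unit_real (eval (M := std) x e).
Proof.
have wk1 (a : tm G ty1) (n : nat) :
    eval (M := std) (ren_tm (@wk _ _) a @ v0)%tm (fcons ty0 n e) = eval (M := std) a e n.
  by rewrite /= eval_ren.
have wk2 (t : tm (ty0 :: ty0 :: G) ty0) (n i : nat) :
    eval (M := std) (ren_tm (@wk _ _) (ren_tm (@wk _ _) x) @ t)%tm (fcons ty0 i (fcons ty0 n e)) =
    eval (M := std) x e (eval (M := std) t (fcons ty0 i (fcons ty0 n e))).
  by rewrite /= !eval_ren.
have z0 n : qval (eval (M := std) (real_zero G) e n) = 0%R.
  rewrite /real_zero eval_lam_std; set q := eval (M := std) _ _.
  have [e1 e2] : qpos_std q = 0 /\ qneg_std q = 0 by [].
  by rewrite /qval e1 e2 Rminus_diag /Rdiv Rmult_0_l.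
have z1 n : qval (eval (M := std) (real_one G) e n) = 1%R.
  rewrite /real_one eval_lam_std; set q := eval (M := std) _ _.
  have [e1 [e2 e3]] : qpos_std q = 1 /\ qneg_std q = 0 /\ qden_std q = 1 by [].
  by rewrite /qval e1 e2 e3 /=; field.
split=> [[H [H0 H1]]|[H H']].
  split=> [n i|n].
    have [h1 h2] := H n i.
    have := proj1 (rat_lt_std _ _ _ _ _) h1; have := proj1 (rat_lt_std _ _ _ _ _) h2.
    by rewrite !wk2 /= !Rmult_1_l.
  have := proj1 (rat_le_std _ _ _ _ _) (H0 n); have := proj1 (rat_le_std _ _ _ _ _) (H1 n).
  rewrite !wk1 z0 z1; tauto.
split; last split.
- move=> n i; have [h1 h2] := H n i.
  by split; apply/rat_lt_std; rewrite !wk2 /= !Rmult_1_l.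
- by move=> n; apply/rat_le_std; rewrite !wk1 z0; have [] := H' n.
- by move=> n; apply/rat_le_std; rewrite !wk1 z1; have [] := H' n.
Qed.

Lemma same_real_sym g h : same_real g h -> same_real h g.
Proof. move=> H n; have := H n; tauto. Qed.

Lemma same_real_refl g : same_real g g.
Proof.
move=> n; have : (0 < / 2 ^ n)%R by apply: Rinv_0_lt_compat; apply: pow_lt; lra.
lra.
Qed.

Lemma le_of_small_error (a b : R) : (forall m, a <= b + 4 * / 2 ^ m)%R -> (a <= b)%R.
Proof.
move=> H; apply: Rnot_lt_le => hab.
have h1 : (Rabs (/ 2) < 1)%R by rewrite Rabs_pos_eq; lra.
have h2 : (0 < (a - b) / 4)%R by lra.
have [N hN] := pow_lt_1_zero (/ 2) h1 _ h2.
have := hN N (Nat.le_refl N); rewrite pow_inv.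
have hp : (0 < / 2 ^ N)%R by apply: Rinv_0_lt_compat; apply: pow_lt; lra.
rewrite Rabs_pos_eq; last lra.
have := H N; lra.
Qed.

(** Comparing at index [n] directly would double the admissible error. Going through index [n + m]
    costs [1 / 2^n] for [x], the same for [z], and at most [4 / 2^m] for the two comparisons, which
    vanishes as [m] grows. *)
Lemma same_real_trans x y z : unit_real x -> unit_real z ->
  same_real x y -> same_real y z -> same_real x z.
Proof.
move=> [hx _] [hz _] hxy hyz n.
have key m : (/ 2 ^ (n + m) <= / 2 ^ m)%R.
  apply: Rinv_le_contravar; first by apply: pow_lt; lra.
  by apply: Rle_pow; [lra|lia].
split; apply: le_of_small_error => m;
  have := hx n m; have := hz n m;
  have := hxy (n + m); have := hyz (n + m); have := key m; lra.
Qed.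

(** The choice is made from a set that depends only on the real given by [g], so equal reals of the
    unit interval get the same function. *)
Definition representative (g : baire) : baire :=
  epsilon (inhabits g) (fun h => unit_real h /\ same_real g h).

Lemma representative_eq g h : unit_real g -> unit_real h ->
  representative g = representative h <-> same_real g h.
Proof.
move=> hg hh; split=> [e|e].
  have [r1 r2] : unit_real (representative g) /\ same_real g (representative g).
    apply: (epsilon_spec (inhabits g) (fun h => unit_real h /\ same_real g h)).
    by exists g; split=> //; apply: same_real_refl.
  have [s1 s2] : unit_real (representative h) /\ same_real h (representative h).
    apply: (epsilon_spec (inhabits h) (fun k => unit_real k /\ same_real h k)).
    by exists h; split=> //; apply: same_real_refl.
  apply: (same_real_trans hg hh r2); rewrite e; exact: same_real_sym.
rewrite /representative.
have -> : (fun k => unit_real k /\ same_real g k) = (fun k => unit_real k /\ same_real h k).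
  apply: functional_extensionality => k; apply: propositional_extensionality.
  split=> -[hk ek]; split=> //; last exact: (same_real_trans hg hk e ek).
  exact: (same_real_trans hh hk (same_real_sym e) ek).
by rewrite (proof_irrelevance _ (inhabits g) (inhabits h)).
Qed.

(** * The generic injection on reals *)

Definition generic : nm ty2 := fun Y g => Y (representative g).

Lemma decide_generic c g : exists2 d, ext d c & exists n, gr d (representative g) n.
Proof.
set r := representative g.
case: (classic (exists n, gr c r n)) => [h|hr]; first by exists c; [apply: ext_refl|].
(* [gr_room] only keeps clear of the graph; a value above the maximum of [av c] is also outside the
   avoided list. *)
have [n [hn hng]] := gr_room c (S (fold_right max 0 (av c))).
have hav : ~ In n (av c).
  have hmax : forall l : list nat, In n l -> n <= fold_right max 0 l.
    by elim=> [|a l IH] //= [->|/IH]; lia.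
  by move/hmax; lia.
pose G f m := gr c f m \/ (f = r /\ m = n).
have gfun f m m' : G f m -> G f m' -> m = m'.
  move=> [h|[e1 e2]] [h'|[e1' e2']]; subst=> //; first exact: gr_fun h h'.
    by case: hr; exists m.
  by case: hr; exists m'.
have ginj f f' m : G f m -> G f' m -> f = f'.
  move=> [h|[e1 e2]] [h'|[e1' e2']]; subst=> //; first exact: gr_inj h h'.
    by case: (hng f).
  by case: (hng f').
have gav f m : G f m -> ~ In m (av c).
  by move=> [h|[e1 e2]]; subst=> //; apply: gr_av h.
have groom k : exists m, k <= m /\ forall f, ~ G f m.
  (* The lower bound [S n] keeps the free value apart from the value [n] just assigned. *)
  have [m [hm hmg]] := gr_room c (max k (S n)).
  exists m; split; first lia.
  move=> f [h|[_ e]]; [exact: hmg h|lia].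
exists (Cond gfun ginj gav groom); first by split=> [f m h|//]; left.
by exists n; right.
Qed.

Lemma generic_decided c g : dense c (fun d => exists n, gr d (representative g) n).
Proof. by move=> d hd; apply: decide_generic. Qed.

(** Both arguments are locally the same ground function [g], and a further extension puts the
    representative of [g] into the graph. *)
Lemma peq_generic c : peq c generic generic.
Proof.
move=> d hd u v huv; apply: dense_bind (peq1_ground huv) _ => d1 h1 [g hg].
apply: dense_map (@generic_decided d1 g) _ => d2 h2 [n hn]; exists n => Y hY.
rewrite /generic; have [-> ->] := hg Y (agrees_ext h2 hY).
by split; apply: hY.
Qed.

Lemma force_ren G D (r : renaming G D) (A : form G) c e :
  force (ren_form r A) c e <-> force A c (fun s x => e s (r s x)).
Proof. by rewrite -subst_form_var force_subst. Qed.

Lemma force_two_reals (A : form [ty1; ty1]) (u v : nm ty1) g h c : second_order A ->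
  peq c u (fun _ => g) -> peq c v (fun _ => h) ->
  force A c (ncons ty1 v (ncons ty1 u (@anil nm))) <->
  sat (M := std) A (fcons ty1 h (fcons ty1 g (@anil F))).
Proof.
move=> hA hu hv; rewrite -(force_second_order hA _ c); last first.
  move=> d; apply: var_cons_ind; first exact: peq_const1.
  apply: var_cons_ind; first exact: peq_const1.
  by move=> t y; exact: (@var_nil_ind (fun _ _ => _) t y).
have he : peq_env c (ncons ty1 v (ncons ty1 u (@anil nm)))
    (fun s x _ => fcons ty1 h (fcons ty1 g (@anil F)) s x).
  apply: var_cons_ind => //; apply: var_cons_ind => //.
  by move=> t y; exact: (@var_nil_ind (fun _ _ => _) t y).
by split; apply: force_congr => //; apply: peq_env_sym.
Qed.

(** [force_second_order] needs an environment of ground objects, and [generic] is not one. Formulas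
    about the two reals are therefore moved to the context without the functional. *)
Definition two_in_three : renaming [ty1; ty1] [ty1; ty1; ty2] :=
  lift_ren (lift_ren (@nil_ren [ty2])).

Lemma peq_decided_const1 c (u : nm ty1) g : decides c (fun Y => u Y = g) -> peq c u (fun _ => g).
Proof. by move=> h; apply: peq_decides (@peq_const1 c g) => Y /h. Qed.

Lemma two_realsE (u v w : nm _) : ncons ty1 v (ncons ty1 u (@anil nm)) =
  (fun s x => ncons ty1 v (ncons ty1 u (ncons ty2 w (@anil nm))) s (two_in_three x)).
Proof.
apply: (@var_cons_ext _ _ nm) => //; apply: var_cons_ind => // t x.
exact: (@var_nil_ind (fun _ _ => _) t x).
Qed.

Lemma dense_two_grounds c (u v : nm ty1) : peq c u u -> peq c v v ->
  dense c (fun d => exists g h, decides d (fun Y => u Y = g /\ v Y = h)).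
Proof.
move=> hu hv; apply: dense_bind (peq1_ground hu) _ => d1 hd1 [g hg].
apply: dense_map (dense_ext hd1 (peq1_ground hv)) _ => d2 hd2 [h hh].
exists g, h => Y hY; have [-> _] := hg Y (agrees_ext hd2 hY).
by have [-> _] := hh Y hY.
Qed.

Lemma ren_rat_lt G D (r : renaming G D) (p q k n : tm G ty0) :
  ren_form r (rat_lt p q k n) = rat_lt (ren_tm r p) (ren_tm r q) (ren_tm r k) (ren_tm r n).
Proof. by []. Qed.

Lemma ren_rat_le G D (r : renaming G D) (p q k n : tm G ty0) :
  ren_form r (rat_le p q k n) = rat_le (ren_tm r p) (ren_tm r q) (ren_tm r k) (ren_tm r n).
Proof. by []. Qed.

Lemma ren_tm_wk G D (r : renaming G D) t s (a : tm G s) :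
  ren_tm (lift_ren r) (ren_tm (@wk G t) a) = ren_tm (@wk D t) (ren_tm r a).
Proof. by rewrite !ren_tm_ren. Qed.

Lemma ren_in_unit G D (r : renaming G D) (x : tm G ty1) :
  ren_form r (in_unit x) = in_unit (ren_tm r x).
Proof.
rewrite /in_unit /is_real /le_real; cbn [ren_form]; rewrite !ren_rat_lt !ren_rat_le; cbn [ren_tm].
by rewrite !ren_tm_wk.
Qed.

Lemma ren_eq_real G D (r : renaming G D) (x y : tm G ty1) :
  ren_form r (eq_real x y) = eq_real (ren_tm r x) (ren_tm r y).
Proof.
rewrite /eq_real; cbn [ren_form]; rewrite !ren_rat_le; cbn [ren_tm].
by rewrite !ren_tm_wk.
Qed.

Lemma second_order_in_unit G (x : tm G ty1) : second_order (in_unit x).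
Proof. by repeat split; left. Qed.

Lemma second_order_eq_real G (x y : tm G ty1) : second_order (eq_real x y).
Proof. by repeat split; left. Qed.

Section GenericPair.
Variables (u v : nm ty1) (g h : baire) (c : cond).
Hypothesis ground : decides c (fun Y => u Y = g /\ v Y = h).
Let e := ncons ty1 v (ncons ty1 u (ncons ty2 generic (@anil nm))).

Lemma force_two_reals_generic (A : form [ty1; ty1]) : second_order A ->
  force (ren_form two_in_three A) c e <-> sat (M := std) A (fcons ty1 h (fcons ty1 g (@anil F))).
Proof.
move=> hA; rewrite force_ren -two_realsE; apply: force_two_reals => //.
  by apply: peq_decided_const1 => Y /ground [].
by apply: peq_decided_const1 => Y /ground [].
Qed.

Lemma force_in_unit (x : tm [ty1; ty1] ty1) :
  force (in_unit (ren_tm two_in_three x)) c e <->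
  unit_real (eval (M := std) x (fcons ty1 h (fcons ty1 g (@anil F)))).
Proof.
by rewrite -ren_in_unit force_two_reals_generic ?sat_in_unit_std //; apply: second_order_in_unit.
Qed.

Lemma force_eq_real : force (eq_real v1 v0) c e <-> same_real g h.
Proof.
rewrite (_ : eq_real v1 v0 = ren_form two_in_three (eq_real v1 v0)); last by rewrite ren_eq_real.
by rewrite force_two_reals_generic ?sat_eq_real_std //; apply: second_order_eq_real.
Qed.

End GenericPair.

(** These equations unfold one connective at a time and leave the formulas about reals folded. *)
Lemma force_AllE G s (A : form (s :: G)) c e : force (All s A) c e =
  (forall d, ext d c -> forall x : nm s, peq d x x -> force A d (acons x e)).
Proof. by []. Qed.

Lemma force_ExE G s (A : form (s :: G)) c e : force (Ex s A) c e =
  dense c (fun d => exists2 x : nm s, peq d x x & force A d (acons x e)).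
Proof. by []. Qed.

Lemma force_ImpE G (A B : form G) c e : force (Imp A B) c e =
  (forall d, ext d c -> force A d e -> force B d e).
Proof. by []. Qed.

Lemma force_AndE G (A B : form G) c e : force (And A B) c e = (force A c e /\ force B c e).
Proof. by []. Qed.

Lemma force_unit_fun c : force (unit_fun v0) c (ncons ty2 generic (@anil nm)).
Proof.
rewrite /unit_fun force_AllE => c1 h1 u hu; rewrite force_AllE => c2 h2 v hv.
rewrite force_ImpE => c3 h3; rewrite force_AndE => -[hyp1]; rewrite force_AndE => -[hyp2 hyp3].
have hu3 := peq_ext (ext_trans h3 h2) hu; have hv3 := peq_ext h3 hv.
apply: dense_map (dense_two_grounds hu3 hv3) _ => d hd [g [h hgh]] Y hY.
have hg := proj1 (force_in_unit hgh v1) (force_ext hd hyp1).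
have hh := proj1 (force_in_unit hgh v0) (force_ext hd hyp2).
have he := proj1 (force_eq_real hgh) (force_ext hd hyp3).
have {he} : representative g = representative h by apply/representative_eq.
by rewrite /evaln /= /at_oracle /= /generic; have [-> ->] := hgh Y hY => ->.
Qed.

Lemma not_force_not_injective c : ~ force (not_injective v0) c (ncons ty2 generic (@anil nm)).
Proof.
rewrite /not_injective force_ExE => /(_ c (ext_refl c)) [c1 h1 [u hu]].
rewrite force_ExE => /(_ c1 (ext_refl c1)) [c2 h2 [v hv]].
have [c3 h3 [g [h hgh]]] := dense_two_grounds (peq_ext h2 hu) hv (ext_refl c2).
rewrite force_AndE => -[hyp1]; rewrite force_AndE => -[hyp2]; rewrite force_AndE => -[hyp3 heq].
have hg := proj1 (force_in_unit hgh v1) (force_ext h3 hyp1).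
have hh := proj1 (force_in_unit hgh v0) (force_ext h3 hyp2).
have hne : ~ same_real g h by move=> /(force_eq_real hgh); apply: hyp3.
(* Once both representatives are in the graph, equal values make them equal by injectivity of the
   graph, hence the reals are equal. *)
have [d1 hd1 [n hn]] := decide_generic c3 g.
have [d2 hd2 [m hm]] := decide_generic d1 h.
have [d3 hd3 hd] := heq d2 (ext_trans (ext_trans hd2 hd1) h3).
have [Y hY] := agrees_ex d3.
have := hd Y hY; rewrite /evaln /= /at_oracle /= /generic.
have [-> ->] := hgh Y (agrees_ext (ext_trans (ext_trans hd3 hd2) hd1) hY).
have hn2 : gr d2 (representative g) n by apply: (proj1 hd2).
rewrite (agrees_ext hd3 hY hn2) (agrees_ext hd3 hY hm) => e; subst m.
by apply: hne; apply/representative_eq => //; apply: gr_inj hn2 hm.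
Qed.

Definition empty_cond : cond.
Proof.
refine (@Cond (fun _ _ => False) [] _ _ _ _) => // k; by exists k; split=> // f.
Defined.

Theorem Z2w_DeltaCA_not_NIN : ~ proves (extend Z2w DeltaCA) NIN.
Proof.
move=> hp.
have : force NIN empty_cond (@anil nm).
  apply: force_sound hp _ _ _ _ => //; last exact: peq_env_nil.
  move=> A c [[hA|[k [_ ->]]]|->]; [exact: force_RCA0w|exact: force_Sk|exact: force_DeltaCA].
move/(_ _ (ext_refl _) generic (@peq_generic _) _ (ext_refl _)) => h.
apply: (@not_force_not_injective empty_cond); apply: h; exact: force_unit_fun.
Qed.

(** * Models of the base theory *)

From HB Require Import structures.
From mathcomp Require Import ssrfun ssrbool eqtype choice order ssralg ssrnum boolp.
From Stdlib Require Import Ring.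
Import Defs.
Record model := Model {
  str :> structure;
  str_models : models str RCA0w;
  str_ext : extensional str }.

(** * The ordered semi-ring of a model, and its ring of integers *)

Section SemiRing.
Variable m : model.
Local Notation M0 := (dom m ty0).

Lemma eqv_eq s (x y : dom m s) : eqv x y -> x = y.
Proof.
elim: s x y => [|s _ t IH] x y /=; first exact: (proj1 (proj1 (@str_ext m) x y)).
by move=> h; apply: (proj2 (@str_ext m)) => z; apply: IH.
Qed.

Lemma app_pi s t (x : dom m s) (y : dom m t) : app (app (@piM m s t) x) y = x.
Proof.
pose e : assign (dom m) [t; s] := acons y (acons x (@anil _)).
exact (eqv_eq (proj1 (sat_eq_at (Pi @ v1 @ v0)%tm v1 e) (@str_models m _ (RCA0w_Pi s t) x y))).
Qed.

Lemma app_sig r s t (x : dom m (r ~> s ~> t)) (y : dom m (r ~> s)) (z : dom m r) :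
  app (app (app (@sigM m r s t) x) y) z = app (app x z) (app y z).
Proof.
pose e : assign (dom m) [r; r ~> s; r ~> s ~> t] := acons z (acons y (acons x (@anil _))).
exact (eqv_eq (proj1 (sat_eq_at (Sig @ v2 @ v1 @ v0)%tm (v2 @ v0 @ (v1 @ v0))%tm e)
  (@str_models m _ (RCA0w_Sig r s t) x y z))).
Qed.

Definition eval_lam_model := @eval_lam m app_pi app_sig.

Definition add (a b : M0) : M0 := app (app (addM m) a) b.
Definition mul (a b : M0) : M0 := app (app (mulM m) a) b.
Definition zero : M0 := zeroM m.
Definition one : M0 := oneM m.
Definition ltm (a b : M0) : Prop := ltM a b.

Lemma eqM_eq (a b : M0) : eqM a b -> a = b.
Proof. exact: (proj1 (proj1 (@str_ext m) a b)). Qed.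

Lemma semiring_axiom A : In A semiring_axioms -> sat (M := m) A (@anil _).
Proof. by move=> h; apply: (@str_models m); apply: RCA0w_semiring. Qed.

Ltac in_list := rewrite /semiring_axioms /=; repeat (first [by left | right]).

Lemma addA a b c : add (add a b) c = add a (add b c).
Proof.
apply: eqM_eq;
  refine (semiring_axiom (A := All ty0 (All ty0 (All ty0 ((v2 + v1) + v0 == v2 + (v1 + v0)))))%form
    _ a b c); in_list.
Qed.
Lemma addC a b : add a b = add b a.
Proof.
apply: eqM_eq;
  refine (semiring_axiom (A := All ty0 (All ty0 (v1 + v0 == v0 + v1)))%form
    _ a b); in_list.
Qed.
Lemma add_0 a : add a zero = a.
Proof. apply: eqM_eq; refine (semiring_axiom (A := All ty0 (v0 + 0 == v0))%form _ a); in_list. Qed.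
Lemma mulA a b c : mul (mul a b) c = mul a (mul b c).
Proof.
apply: eqM_eq;
  refine (semiring_axiom (A := All ty0 (All ty0 (All ty0 ((v2 * v1) * v0 == v2 * (v1 * v0)))))%form
    _ a b c); in_list.
Qed.
Lemma mulC a b : mul a b = mul b a.
Proof.
apply: eqM_eq;
  refine (semiring_axiom (A := All ty0 (All ty0 (v1 * v0 == v0 * v1)))%form
    _ a b); in_list.
Qed.
Lemma mul_1 a : mul a one = a.
Proof. apply: eqM_eq; refine (semiring_axiom (A := All ty0 (v0 * 1 == v0))%form _ a); in_list. Qed.
Lemma mul_0 a : mul a zero = zero.
Proof. apply: eqM_eq; refine (semiring_axiom (A := All ty0 (v0 * 0 == 0))%form _ a); in_list. Qed.
Lemma mul_addr a b c : mul a (add b c) = add (mul a b) (mul a c).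
Proof.
apply: eqM_eq;
  refine (semiring_axiom (A := All ty0 (All ty0 (All ty0 (v2 * (v1 + v0) == v2 * v1 + v2 * v0))))%form
    _ a b c); in_list.
Qed.
Lemma ltm_irr a : ~ ltm a a.
Proof. refine (semiring_axiom (A := All ty0 (~ (Lt v0 v0)))%form _ a); in_list. Qed.
Lemma ltm_trans a b c : ltm a b -> ltm b c -> ltm a c.
Proof.
refine (semiring_axiom (A := All ty0 (All ty0 (All ty0 (Lt v2 v1 --> Lt v1 v0 --> Lt v2 v0))))%form
    _ a b c); in_list.
Qed.
Lemma ltm_total a b : ltm a b \/ a = b \/ ltm b a.
Proof.
have [h|[h|h]] : ltm a b \/ eqM a b \/ ltm b a; last by right; right.
- refine (semiring_axiom (A := All ty0 (All ty0 (Lt v1 v0 \/ v1 == v0 \/ Lt v0 v1)))%form _ a b); in_list.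
- by left.
- by right; left; apply: eqM_eq.
Qed.
Lemma ltm_add a b c : ltm a b -> ltm (add a c) (add b c).
Proof.
refine (semiring_axiom (A := All ty0 (All ty0 (All ty0 (Lt v2 v1 --> Lt (v2 + v0)%tm (v1 + v0)%tm))))%form
    _ a b c); in_list.
Qed.
Lemma ltm_mul a b c : ltm zero c -> ltm a b -> ltm (mul a c) (mul b c).
Proof.
refine (semiring_axiom (A := All ty0 (All ty0 (All ty0 (Imp (Lt Zero v0) (Lt v2 v1 --> Lt (v2 * v0)%tm (v1 * v0)%tm)))))%form
    _ a b c); in_list.
Qed.
Lemma ltm_0_1 : ltm zero one.
Proof. refine (semiring_axiom (A := Lt Zero One) _); in_list. Qed.
Lemma ge_0 a : ltm zero a \/ zero = a.
Proof.
have [h|h] : ltm zero a \/ eqM zero a; [|by left|by right; apply: eqM_eq].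
refine (semiring_axiom (A := All ty0 (Or (Lt Zero v0) (Eq Zero v0))) _ a); in_list.
Qed.

Lemma model_semi_ring : semi_ring_theory zero one add mul (@eq M0).
Proof.
split=> [a|a b|a b c|a|a|a b|a b c|a b c].
- by rewrite addC add_0.
- exact: addC.
- by rewrite addA.
- by rewrite mulC mul_1.
- by rewrite mulC mul_0.
- exact: mulC.
- by rewrite mulA.
- by rewrite mulC mul_addr !(mulC c).
Qed.

Lemma add_cancel a b c : add a c = add b c -> a = b.
Proof.
move=> h; case: (ltm_total a b) => [/(ltm_add c)|[//|/(ltm_add c)]]; rewrite h; by move/ltm_irr.
Qed.

Add Ring M0_ring : model_semi_ring.

Lemma model_induction G (A : form (ty0 :: G)) (e : assign (dom m) G) : qf A ->
  sat A (acons zero e) ->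
  (forall n : M0, sat A (acons n e) -> sat A (acons (add n one) e)) ->
  forall n : M0, sat A (acons n e).
Proof.
move=> hq h0 hS.
have h := proj1 (@sat_close m G (qf_induction A)) (@str_models m _ (RCA0w_QFIA hq)) e.
apply: h; first exact: (proj2 (sat_inst A Zero e) h0).
move=> n hn; apply/sat_subst.
have -> : (fun s y => eval (@scons G (ty0 :: G) ty0 (v0 + 1)%tm (fun s x => Var (vs x)) s y)
    (acons n e)) = acons (add n one) e by apply: (@var_cons_ext _ _ (dom m)).
exact: hS.
Qed.

Definition recm (h : dom m (ty0 ~> ty0 ~> ty0)) (a n : M0) : M0 :=
  app (app (app (@recM m ty0) h) a) n.

Lemma recm_0 h a : recm h a zero = a.
Proof. exact: eqM_eq (@str_models m _ RCA0w_Rec_zero h a). Qed.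

Lemma recm_S h a n : recm h a (add n one) = app (app h n) (recm h a n).
Proof. exact: eqM_eq (@str_models m _ RCA0w_Rec_succ h a n). Qed.

Definition step_fun G (f : tm (ty0 :: ty0 :: G) ty0) (e : assign (dom m) G) :
  dom m (ty0 ~> ty0 ~> ty0) := eval (lam (lam f)) e.

Lemma step_funE G (f : tm (ty0 :: ty0 :: G) ty0) e n a :
  app (app (step_fun f e) n) a = eval f (acons a (acons n e)).
Proof. by rewrite /step_fun !eval_lam_model. Qed.

Definition predm (n : M0) : M0 := eval (pred v0) (acons n (@anil _)).
Definition monusm (a b : M0) : M0 := eval (monus v1 v0) (acons b (acons a (@anil _))).

Lemma predm_0 : predm zero = zero.
Proof. exact: recm_0. Qed.

Lemma predm_S n : predm (add n one) = n.
Proof. rewrite [LHS]recm_S; exact (@step_funE [ty0] v1 (acons n (@anil _)) n _). Qed.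

Lemma monusm_0 a : monusm a zero = a.
Proof. exact: recm_0. Qed.

Lemma monusm_S a n : monusm a (add n one) = predm (monusm a n).
Proof. rewrite [LHS]recm_S; exact (@step_funE [ty0; ty0] (pred v0) (acons n (acons a (@anil _))) n _). Qed.

Lemma zero_or_succ n : n = zero \/ n = add (predm n) one.
Proof.
pose A : form [ty0] := Or (Eq v0 Zero) (Eq v0 (pred v0 + 1)%tm).
have key : sat A (acons n (@anil _)).
  apply: model_induction n => //=; first by left; apply/(proj1 (@str_ext m)).
  move=> k _; right; apply/(proj1 (@str_ext m)); by rewrite -[LHS](congr1 (fun x => add x one) (predm_S k)).
by case: key => h; [left|right]; apply: eqM_eq.
Qed.

Lemma ltm_succ a : ltm a (add a one).
Proof. have := ltm_add a ltm_0_1; by rewrite addC add_0 addC. Qed.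

Lemma monusm_spec a b : (ltm a b /\ monusm a b = zero) \/ add b (monusm a b) = a.
Proof.
pose A : form [ty0; ty0] := Or (And (Lt v1 v0) (Eq (monus v1 v0) Zero)) (Eq (v0 + monus v1 v0)%tm v1).
have key : sat A (acons b (acons a (@anil _))).
  apply: model_induction b => //=.
    right; apply/(proj1 (@str_ext m)).
    exact: (etrans (congr1 (add zero) (monusm_0 a)) (etrans (addC _ _) (add_0 a))).
  move=> b [[h /eqM_eq e]|/eqM_eq e].
    left; split; first exact: ltm_trans h (ltm_succ b).
    apply/(proj1 (@str_ext m)); rewrite [LHS]monusm_S (_ : monusm a b = zero) //; exact: predm_0.
  case: (zero_or_succ (monusm a b)) => h; [left|right].
    have ba : b = a by rewrite -[RHS]e -[LHS]add_0 -h.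
    split; first by rewrite -ba; apply: ltm_succ.
    by apply/(proj1 (@str_ext m)); rewrite [LHS]monusm_S h predm_0.
  apply/(proj1 (@str_ext m)).
  rewrite -[RHS]e; change (add (add b one) (monusm a (add b one)) = add b (monusm a b)).
  rewrite monusm_S {2}h; ring.
by case: key => [[h /eqM_eq e]|/eqM_eq e]; [left|right].
Qed.

Lemma ltm_diff a b : ltm a b -> exists c, b = add (add a c) one.
Proof.
move=> h; case: (monusm_spec b a) => [[h' _]|h'].
  by case: (ltm_irr (ltm_trans h h')).
case: (zero_or_succ (monusm b a)) => e.
  by move: h; rewrite -h' e add_0 => /ltm_irr.
by exists (predm (monusm b a)); rewrite -[LHS]h' {1}e addA.
Qed.

(** Equality of formal differences. The ring of differences is turned into an ordered integral
    domain so that [ring] and [lra] apply to the numbers of the model through [emb]. *)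
Definition zrel (p q : M0 * M0) : Prop := add p.1 q.2 = add q.1 p.2.
Definition zrep (p : M0 * M0) : M0 * M0 := epsilon (inhabits p) (zrel p).

Lemma zrel_trans p q r : zrel p q -> zrel q r -> zrel p r.
Proof.
rewrite /zrel => h1 h2; apply: (@add_cancel _ _ (add q.1 q.2)).
rewrite (_ : add (add p.1 r.2) _ = add (add p.1 q.2) (add q.1 r.2)); last by ring.
rewrite h1 h2; ring.
Qed.

Lemma zrel_rep p : zrel p (zrep p).
Proof. apply: (epsilon_spec (inhabits p) (zrel p)); by exists p. Qed.

Lemma zrep_eq p q : zrel p q -> zrep p = zrep q.
Proof.
have sym p' q' : zrel p' q' -> zrel q' p' by rewrite /zrel.
move=> h; rewrite /zrep (Prop_irrelevance (inhabits p) (inhabits q)); congr epsilon.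
apply: functional_extensionality => z; apply: propositional_extensionality.
split=> h'; [exact: zrel_trans (sym _ _ h) h'|exact: zrel_trans h h'].
Qed.

Definition zmod := {p : M0 * M0 | zrep p = p}.
Definition zcls (p : M0 * M0) : zmod := exist _ (zrep p) (esym (zrep_eq (zrel_rep p))).

Lemma zcls_eq p q : zrel p q -> zcls p = zcls q.
Proof. by move=> h; apply: eq_exist; apply: zrep_eq. Qed.

Lemma zcls_inj p q : zcls p = zcls q -> zrel p q.
Proof.
move=> /(f_equal (@proj1_sig _ _)) /= e.
apply: zrel_trans (zrel_rep p) _; rewrite e; move: (zrel_rep q); by rewrite /zrel.
Qed.

Lemma zcls_surj u : exists p, u = zcls p.
Proof. by case: u => p hp; exists p; apply: eq_exist; rewrite /= hp. Qed.

Definition zadd (u v : zmod) : zmod :=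
  zcls (add (proj1_sig u).1 (proj1_sig v).1, add (proj1_sig u).2 (proj1_sig v).2).
Definition zopp (u : zmod) : zmod := zcls ((proj1_sig u).2, (proj1_sig u).1).
Definition zmul (u v : zmod) : zmod :=
  zcls (add (mul (proj1_sig u).1 (proj1_sig v).1) (mul (proj1_sig u).2 (proj1_sig v).2),
        add (mul (proj1_sig u).1 (proj1_sig v).2) (mul (proj1_sig u).2 (proj1_sig v).1)).
Definition zlt (u v : zmod) : Prop :=
  ltm (add (proj1_sig u).1 (proj1_sig v).2) (add (proj1_sig v).1 (proj1_sig u).2).

Lemma zaddE a b c d : zadd (zcls (a, b)) (zcls (c, d)) = zcls (add a c, add b d).
Proof.
apply: zcls_eq; have := zrel_rep (a, b); have := zrel_rep (c, d).
rewrite /zrel /= => h1 h2.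
rewrite (_ : add (add _ _) _ = add (add (zrep (a, b)).1 b) (add (zrep (c, d)).1 d)); last by ring.
rewrite -h1 -h2; ring.
Qed.

Lemma zoppE a b : zopp (zcls (a, b)) = zcls (b, a).
Proof.
apply: zcls_eq; have := zrel_rep (a, b); rewrite /zrel /= => h.
by rewrite addC h addC.
Qed.

Lemma zmulE a b c d : zmul (zcls (a, b)) (zcls (c, d)) =
  zcls (add (mul a c) (mul b d), add (mul a d) (mul b c)).
Proof.
apply: zcls_eq; have h1 := zrel_rep (a, b); have h2 := zrel_rep (c, d).
move: h1 h2 => /=; case: (zrep (a, b)) (zrep (c, d)) => [a' b'] [c' d'] h1 h2.
rewrite /zrel /= in h1 h2.
(* The two factors are exchanged for their representatives one at a time, through this mixed
   product. *)
apply: (@zrel_trans _ (add (mul a' c) (mul b' d), add (mul a' d) (mul b' c))); rewrite /zrel /=.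
  transitivity (add (mul a' (add c' d)) (mul b' (add c d'))); first by ring.
  by rewrite -h2 {2}h2; ring.
transitivity (add (mul c (add a' b)) (mul d (add a b'))); first by ring.
by rewrite -h1 {2}h1; ring.
Qed.

Lemma zltE a b c d : zlt (zcls (a, b)) (zcls (c, d)) <-> ltm (add a d) (add c b).
Proof.
have key p q p' q' : zrel p p' -> zrel q q' -> ltm (add p.1 q.2) (add q.1 p.2) ->
    ltm (add p'.1 q'.2) (add q'.1 p'.2).
  rewrite /zrel => h1 h2 h.
  case: (ltm_total (add p'.1 q'.2) (add q'.1 p'.2)) => [//|h'].
  have {h'} h' : ltm (add (add q'.1 p'.2) (add p.1 q.2)) (add (add p'.1 q'.2) (add q.1 p.2)).
    case: h' => [->|h']; first by rewrite !(addC (add q'.1 _)); apply: ltm_add.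
    apply: ltm_trans (ltm_add _ h'); rewrite !(addC (add q'.1 _)); exact: ltm_add.
  case: (@ltm_irr (add (add q'.1 p'.2) (add p.1 q.2))).
  rewrite {2}(_ : add (add q'.1 p'.2) (add p.1 q.2) = add (add p'.1 q'.2) (add q.1 p.2)) //.
  rewrite (_ : add _ _ = add (add p.1 p'.2) (add q'.1 q.2)); last by ring.
  rewrite h1 -h2; ring.
have sym p q : zrel p q -> zrel q p by rewrite /zrel => ->.
split; first exact: (key _ _ (a, b) (c, d) (sym _ _ (zrel_rep _)) (sym _ _ (zrel_rep _))).
exact: (key (a, b) (c, d) _ _ (zrel_rep _) (zrel_rep _)).
Qed.

HB.instance Definition _ := gen_eqMixin zmod.
HB.instance Definition _ := gen_choiceMixin zmod.

Ltac zcase := repeat (let a := fresh "a" in let b := fresh "b" in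
  let u := fresh "u" in move=> u; have [[a b] ->] := zcls_surj u; move=> {u}).
Ltac zring := zcase; rewrite ?zoppE ?zaddE ?zmulE ?zaddE ?zmulE; apply: zcls_eq; rewrite /zrel /=; ring.

Let zaddA : associative zadd. Proof. by zring. Qed.
Let zaddC : commutative zadd. Proof. by zring. Qed.
Let zadd0 : left_id (zcls (zero, zero)) zadd. Proof. by zring. Qed.
Let zaddN : left_inverse (zcls (zero, zero)) zopp zadd. Proof. by zring. Qed.

HB.instance Definition _ := GRing.isZmodule.Build zmod zaddA zaddC zadd0 zaddN.

Let zmulA : associative zmul. Proof. by zring. Qed.
Let zmulC : commutative zmul. Proof. by zring. Qed.
Let zmul1 : left_id (zcls (one, zero)) zmul. Proof. by zring. Qed.
Let zmulD : left_distributive zmul zadd.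
Proof. by zcase; rewrite [in LHS]zaddE !zmulE [in RHS]zaddE; apply: zcls_eq; rewrite /zrel /=; ring. Qed.
Let zone_neq0 : zcls (one, zero) != zcls (zero, zero).
Proof.
apply/eqP => /zcls_inj; rewrite /zrel /= => h.
apply: (@ltm_irr one); rewrite {1}(_ : one = zero); first exact: ltm_0_1.
by rewrite -[LHS]add_0 h; ring.
Qed.

HB.instance Definition _ := GRing.Zmodule_isComNzRing.Build zmod zmulA zmulC zmul1 zmulD zone_neq0.

Definition emb (n : M0) : zmod := zcls (n, zero).

Lemma emb_add a b : emb (add a b) = (emb a + emb b)%R.
Proof. by rewrite [RHS]zaddE /emb add_0. Qed.

Lemma emb_mul a b : emb (mul a b) = (emb a * emb b)%R.
Proof. by rewrite [RHS]zmulE; apply: zcls_eq; rewrite /zrel /=; ring. Qed.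

Lemma emb_0 : emb zero = 0%R. Proof. by []. Qed.
Lemma emb_1 : emb one = 1%R. Proof. by []. Qed.

Lemma emb_inj a b : emb a = emb b -> a = b.
Proof. by move/zcls_inj; rewrite /zrel /= !add_0. Qed.

Lemma zmod_sign u : exists n, u = emb n \/ u = (- emb n)%R.
Proof.
have [[a b] ->] := zcls_surj u.
case: (ltm_total a b) => [/ltm_diff [c ->]|[->|/ltm_diff [c ->]]].
- by exists (add c one); right; rewrite [RHS]zoppE; apply: zcls_eq; rewrite /zrel /=; ring.
- by exists zero; left; apply: zcls_eq; rewrite /zrel /=; ring.
- by exists (add c one); left; apply: zcls_eq; rewrite /zrel /=; ring.
Qed.

(** The algebraic hierarchy asks for units and inverses in an integral domain; classical choice
    supplies them. *)
Definition zunit (u : zmod) : bool := `[< exists v : zmod, (v * u = 1)%R >].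
Definition zinv (u : zmod) : zmod :=
  if pselect (exists v : zmod, (v * u = 1)%R) is left _
  then epsilon (inhabits 0%R) (fun v : zmod => (v * u = 1)%R) else u.

Let zmulV : {in zunit, left_inverse 1%R zinv *%R}.
Proof.
move=> u hu; rewrite /zinv; case: pselect => [h|[]]; last exact: (asboolP _ hu).
exact: epsilon_spec h.
Qed.
Let zunitP (x y : zmod) : (y * x = 1)%R -> zunit x.
Proof. by move=> h; apply/asboolP; exists y. Qed.
Let zinv_out : {in [predC zunit], zinv =1 id}.
Proof.
move=> u /negP hu; rewrite /zinv; case: pselect => // h; case: hu; exact/asboolP.
Qed.

HB.instance Definition _ := GRing.ComNzRing_hasMulInverse.Build zmod zmulV zunitP zinv_out.

Lemma mul_eq_zero a b : mul a b = zero -> a = zero \/ b = zero.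
Proof.
move=> h; case: (ge_0 a) => [ha|]; last by left.
case: (ge_0 b) => [hb|]; last by right.
by have := ltm_mul hb ha; rewrite h mulC mul_0 => /ltm_irr.
Qed.

Let zintegral : GRing.integral_domain_axiom zmod.
Proof.
have key a b : (emb a * emb b)%R = 0%R -> (emb a == 0%R) || (emb b == 0%R).
  rewrite -emb_mul => /emb_inj /mul_eq_zero [] ->; rewrite eqxx ?orbT //.
move=> u v; have [a [->|->]] := zmod_sign u; have [b [->|->]] := zmod_sign v;
  rewrite ?GRing.mulNr ?GRing.mulrN ?GRing.opprK ?GRing.oppr_eq0; try exact: key.
- by move/eqP; rewrite GRing.oppr_eq0 => /eqP /key.
- by move/eqP; rewrite GRing.oppr_eq0 => /eqP /key.
Qed.

HB.instance Definition _ := GRing.ComUnitRing_isIntegral.Build zmod zintegral.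

Definition zltb (u v : zmod) : bool := `[< zlt u v >].
Definition zleb (u v : zmod) : bool := (u == v) || zltb u v.
Definition znorm (u : zmod) : zmod := if zleb 0%R u then u else (- u)%R.

Lemma zlt0E a b : zltb 0%R (zcls (a, b)) <-> ltm b a.
Proof.
rewrite /zltb; split=> [/asboolP /zltE|h]; last (apply/asboolP/zltE);
  by rewrite add_0 addC add_0.
Qed.

Lemma zltb_sub (u v : zmod) : zltb 0%R (v - u)%R = zltb u v.
Proof.
move: u v; zcase; rewrite [(- _)%R]zoppE [(_ + _)%R]zaddE; apply/idP/idP.
  by move/zlt0E => h; apply/asboolP/zltE; rewrite addC.
by move/asboolP/zltE => h; apply/zlt0E; rewrite addC.
Qed.

Let zlt0_add (x y : zmod) : zltb 0%R x -> zltb 0%R y -> zltb 0%R (x + y)%R.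
Proof.
move: x y; zcase; move=> /zlt0E h1 /zlt0E h2; rewrite [(_ + _)%R]zaddE; apply/zlt0E.
apply: ltm_trans (ltm_add _ h1) _; rewrite !(addC a); exact: ltm_add.
Qed.

Let zlt0_mul (x y : zmod) : zltb 0%R x -> zltb 0%R y -> zltb 0%R (x * y)%R.
Proof.
have pos n : zltb 0%R (emb n) -> ltm zero n by move/zlt0E.
have neg n : zltb 0%R (- emb n)%R -> False.
  rewrite [(- _)%R]zoppE => /zlt0E h; case: (ge_0 n) => [h'|e].
    exact: ltm_irr (ltm_trans h h').
  by move: h; rewrite -e => /ltm_irr.
have [a [->|->]] := zmod_sign x; last by move/neg.
have [b [->|->]] := zmod_sign y; last by move=> _ /neg.
move=> /pos ha /pos hb; rewrite -emb_mul; apply/zlt0E.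
by have := ltm_mul hb ha; rewrite (mulC zero) mul_0.
Qed.

Let zlt0_ngt0 (x : zmod) : zltb 0%R x -> ~~ zltb x 0%R.
Proof.
move: x; zcase; move=> /zlt0E h; apply/negP => /asboolP /zltE.
rewrite add_0 addC add_0 => h'; exact: ltm_irr (ltm_trans h h').
Qed.

Let zlt0_total (x : zmod) : x != 0%R -> zltb 0%R x || zltb x 0%R.
Proof.
move: x; zcase; move=> hx; case: (ltm_total a b) => [h|[e|h]].
- by apply/orP; right; apply/asboolP/zltE; rewrite add_0 addC add_0.
- by case/eqP: hx; apply: zcls_eq; rewrite /zrel /= e addC.
- by apply/orP; left; apply/zlt0E.
Qed.

Let znormN (x : zmod) : znorm (- x)%R = znorm x.
Proof.
rewrite /znorm /zleb -(zltb_sub 0%R x) -(zltb_sub 0%R (- x)%R) !GRing.subr0.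
rewrite eq_sym GRing.oppr_eq0 (eq_sym 0%R x); case: eqP => [->|/eqP hx] /=; first by rewrite GRing.oppr0.
have := zlt0_total hx; rewrite -(zltb_sub x 0%R) GRing.sub0r.
case E : (zltb 0%R x) => /=; last by move->.
have := zlt0_ngt0 E; rewrite -(zltb_sub x 0%R) GRing.sub0r => /negbTE ->.
by rewrite GRing.opprK.
Qed.

Let zge0_norm (x : zmod) : zleb 0%R x -> znorm x = x.
Proof. by rewrite /znorm => ->. Qed.

Let zle_def (x y : zmod) : zleb x y = (x == y) || zltb x y.
Proof. by []. Qed.

HB.instance Definition _ := Num.IntegralDomain_isLtReal.Build zmod
  zlt0_add zlt0_mul zlt0_ngt0 zltb_sub zlt0_total znormN zge0_norm zle_def.

Lemma emb_lt a b : (emb a < emb b)%R <-> ltm a b.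
Proof.
change (zltb (emb a) (emb b) <-> ltm a b).
by split=> [/asboolP /zltE|h]; [|apply/asboolP/zltE]; rewrite !add_0.
Qed.

End SemiRing.

From mathcomp Require Import ring lra.
Import Order.TTheory GRing.Theory Num.Theory.

(** * Representable functions and induction in a model *)

Section Arithmetic.
Variable m : model.
Local Notation M0 := (dom m ty0).
Local Notation M1 := (dom m ty1).

Lemma eval_lamE G s t (a : tm (s :: G) t) (e : assign (dom m) G) x :
  app (eval (lam a) e) x = eval a (acons x e).
Proof. exact: eval_lam_model. Qed.

Lemma emb_le (a b : M0) : (emb a <= emb b)%R <-> ~ ltm b a.
Proof. by rewrite leNgt; split=> [/negP h /emb_lt //|h]; apply/negP => /emb_lt. Qed.

Lemma emb_lt_succ (a b : M0) : (emb a < emb b)%R = (emb a + 1 <= emb b)%R.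
Proof.
apply/idP/idP => [/emb_lt /ltm_diff [c ->]|]; last lra.
rewrite !emb_add emb_1; have : (0 <= emb c)%R; last lra.
by rewrite -[X in (X <= _)%R]emb_0; apply/emb_le => h; case: (ge_0 c) => [h'|e];
  [exact: ltm_irr (ltm_trans h h')|move: h; rewrite -e => /ltm_irr].
Qed.

Lemma emb_ge0 (a : M0) : (0 <= emb a)%R.
Proof.
by rewrite -[X in (X <= _)%R]emb_0; apply/emb_le => h; case: (ge_0 a) => [h'|e];
  [exact: ltm_irr (ltm_trans h h')|move: h; rewrite -e => /ltm_irr].
Qed.

Lemma monusmE (a b : M0) : ((emb a <= emb b)%R /\ monusm a b = zero m) \/
  ((emb b <= emb a)%R /\ (emb (monusm a b) = emb a - emb b)%R).
Proof.
case: (monusm_spec a b) => [[/emb_lt h ->]|h]; [left|right].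
  by split=> //; exact: ltW.
have := emb_ge0 (monusm a b); have : (emb a = emb b + emb (monusm a b))%R by rewrite -emb_add h.
by split; lra.
Qed.

Lemma monusm_eq0 (a b : M0) : monusm a b = zero m <-> (emb a <= emb b)%R.
Proof.
case: (monusmE a b) => [[h ->]|[h e]]; first by [].
split=> [e'|h']; first by move: e; rewrite e' emb_0; lra.
by apply: emb_inj; rewrite e emb_0; lra.
Qed.

Lemma monusm_emb (a b : M0) : (emb b <= emb a)%R -> (emb (monusm a b) = emb a - emb b)%R.
Proof. case: (monusmE a b) => [[h ->]|[h ->]] // h'; rewrite emb_0; lra. Qed.

Lemma emb_eq0 (a : M0) : a = zero m <-> (emb a <= 0)%R.
Proof.
split=> [->|h]; first by rewrite emb_0.
by apply: emb_inj; have := emb_ge0 a; rewrite emb_0; lra.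
Qed.

(** Functions of the metatheory that have an index in the model. The model may be nonstandard, so
    induction is available only for predicates tied to such functions; [decp] and [decp_ind] make
    that usable without writing formulas. *)
Definition repf (f : M0 -> M0) : Prop := exists F : M1, forall n, app F n = f n.

Lemma repf_tm G (t : tm (ty0 :: G) ty0) e : repf (fun n => eval t (acons n e)).
Proof. by exists (eval (lam t) e) => n; rewrite eval_lamE. Qed.

Lemma repf_id : repf (fun n => n).
Proof. exact: (repf_tm v0 (@anil _)). Qed.

Lemma repf_const c : repf (fun=> c).
Proof. exact: (repf_tm v1 (acons c (@anil _))). Qed.

Lemma repf_app F f : repf f -> repf (fun n => app F (f n)).
Proof.
move=> [G hG]; have [H hH] := repf_tm (v1 @ (v2 @ v0))%tm (acons F (acons G (@anil _))).
by exists H => n; rewrite hH /= hG.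
Qed.

Lemma repf_app2 (F : dom m (ty0 ~> ty0 ~> ty0)) f g : repf f -> repf g ->
  repf (fun n => app (app F (f n)) (g n)).
Proof.
move=> [f' hf] [g' hg].
have [H hH] := repf_tm (v1 @ (v2 @ v0) @ (Var (vs (vs (vs vz))) @ v0))%tm
  (acons F (acons f' (acons g' (@anil _)))).
by exists H => n; rewrite hH /= hf hg.
Qed.

Lemma repf_op1 (t : tm [ty0] ty0) f : repf f -> repf (fun n => eval t (acons (f n) (@anil (dom m)))).
Proof.
move=> /(repf_app (eval (lam t) (@anil (dom m)))) [H hH].
by exists H => n; rewrite hH eval_lamE.
Qed.

Lemma repf_op2 (t : tm [ty0; ty0] ty0) f g : repf f -> repf g ->
  repf (fun n => eval t (acons (g n) (acons (f n) (@anil (dom m))))).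
Proof.
move=> hf hg; have [H hH] := repf_app2 (eval (lam (lam t)) (@anil (dom m))) hf hg.
by exists H => n; rewrite hH !eval_lamE.
Qed.

Lemma repf_add f g : repf f -> repf g -> repf (fun n => add (f n) (g n)).
Proof. exact: (repf_op2 (v1 + v0)%tm). Qed.

Lemma repf_mul f g : repf f -> repf g -> repf (fun n => mul (f n) (g n)).
Proof. exact: (repf_op2 (v1 * v0)%tm). Qed.

Lemma repf_monus f g : repf f -> repf g -> repf (fun n => monusm (f n) (g n)).
Proof. exact: (repf_op2 (monus v1 v0)). Qed.

Definition decp (P : M0 -> Prop) : Prop := exists2 f, repf f & forall n, P n <-> f n = zero m.

Lemma decp_le f g : repf f -> repf g -> decp (fun n => (emb (f n) <= emb (g n))%R).
Proof.
move=> hf hg; exists (fun n => monusm (f n) (g n)); first exact: repf_monus.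
by move=> n; rewrite monusm_eq0.
Qed.

Lemma decp_and P Q : decp P -> decp Q -> decp (fun n => P n /\ Q n).
Proof.
move=> [f hf hP] [g hg hQ]; exists (fun n => add (f n) (g n)); first exact: repf_add.
move=> n; rewrite hP hQ !emb_eq0 emb_add; have := emb_ge0 (f n); have := emb_ge0 (g n).
by split=> [[]|]; [lra|split; lra].
Qed.

Lemma decp_eq f g : repf f -> repf g -> decp (fun n => f n = g n).
Proof.
move=> hf hg; have [k hk hE] := decp_and (decp_le hf hg) (decp_le hg hf).
exists k => // n; rewrite -hE; split=> [->|[h1 h2]]; first by rewrite lexx.
by apply: emb_inj; lra.
Qed.

Lemma decp_or P Q : decp P -> decp Q -> decp (fun n => P n \/ Q n).
Proof.
move=> [f hf hP] [g hg hQ]; exists (fun n => mul (f n) (g n)); first exact: repf_mul.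
move=> n; rewrite hP hQ; split=> [[]->|/mul_eq_zero //]; last by rewrite mul_0.
by rewrite mulC mul_0.
Qed.

Lemma decp_ind P : decp P -> P (zero m) -> (forall n, P n -> P (add n (one m))) -> forall n, P n.
Proof.
move=> [f [F hF] hP] h0 hS n; apply/hP; rewrite -hF; apply: eqM_eq.
apply: (model_induction (A := Eq (v1 @ v0)%tm Zero) (e := acons F (@anil _))) => // [|k] /=.
  by apply/(proj1 (@str_ext m)); rewrite hF; apply/hP.
by move=> /eqM_eq h; apply/(proj1 (@str_ext m)); rewrite hF; apply/hP; apply: hS; apply/hP; rewrite -hF.
Qed.

Lemma recE G (f : tm (ty0 :: ty0 :: G) ty0) a n e :
  eval (rec f a n) e = recm (step_fun (m := m) f e) (eval a e) (eval n e).
Proof. by []. Qed.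

Lemma rec_0 G (f : tm (ty0 :: ty0 :: G) ty0) e a :
  recm (step_fun (m := m) f e) a (zero m) = a.
Proof. exact: recm_0. Qed.

Lemma rec_S G (f : tm (ty0 :: ty0 :: G) ty0) e a n :
  recm (step_fun (m := m) f e) a (add n (one m)) =
  eval f (acons (recm (step_fun f e) a n) (acons n e)).
Proof. by rewrite recm_S step_funE. Qed.

Lemma ifz_0 G (c a b : tm G ty0) (e : assign (dom m) G) : eval c e = zero m -> eval (ifz c a b) e = eval a e.
Proof. by rewrite recE => ->; rewrite rec_0. Qed.

Lemma ifz_S G (c a b : tm G ty0) (e : assign (dom m) G) : eval c e <> zero m -> eval (ifz c a b) e = eval b e.
Proof.
rewrite recE; case: (zero_or_succ (eval c e)) => // -> _.
by rewrite rec_S !eval_wk.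
Qed.

Definition pow2m (n : M0) : M0 := eval (pow2 v0) (acons n (@anil _)).

Lemma pow2m_0 : pow2m (zero m) = one m.
Proof. exact: recm_0. Qed.

Lemma pow2m_S n : emb (pow2m (add n (one m))) = (2 * emb (pow2m n))%R.
Proof.
rewrite [X in emb X](_ : _ = add (pow2m n) (pow2m n)); first by rewrite emb_add; ring.
exact: (rec_S (v0 + v0)%tm (acons n (@anil _)) (one m) n).
Qed.

Lemma repf_pow2 f : repf f -> repf (fun n => pow2m (f n)).
Proof. exact: (repf_op1 (pow2 v0)). Qed.

Lemma pow2m_ge1 n : (1 <= emb (pow2m n))%R.
Proof.
rewrite -emb_1; move: n; apply: decp_ind => [||n].
- by apply: decp_le; [exact: repf_const|apply: repf_pow2; exact: repf_id].
- by rewrite pow2m_0.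
- by rewrite pow2m_S emb_1; lra.
Qed.

Lemma pow2m_add a b : pow2m (add a b) = mul (pow2m a) (pow2m b).
Proof.
move: b; apply: decp_ind => [||n e].
- apply: decp_eq; [apply: repf_pow2; apply: repf_add|apply: repf_mul; [|apply: repf_pow2]];
    by [exact: repf_const|exact: repf_id].
- by rewrite pow2m_0 mul_1 add_0.
- apply: emb_inj; rewrite -addA emb_mul !pow2m_S e emb_mul; ring.
Qed.

Definition trim (n : M0) : M0 := eval (tri v0) (acons n (@anil _)).
Definition pairm (a b : M0) : M0 := eval (pair v1 v0) (acons b (acons a (@anil _))).
Definition diagm (z : M0) : M0 := eval (diag v0) (acons z (@anil _)).
Definition psndm (z : M0) : M0 := eval (psnd v0) (acons z (@anil _)).
Definition pfstm (z : M0) : M0 := eval (pfst v0) (acons z (@anil _)).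

Lemma trim_0 : trim (zero m) = zero m.
Proof. exact: recm_0. Qed.

Lemma trim_S n : trim (add n (one m)) = add (trim n) (add n (one m)).
Proof. exact: (rec_S (v0 + (v1 + 1))%tm (acons n (@anil _)) (zero m) n). Qed.

Lemma repf_tri f : repf f -> repf (fun n => trim (f n)).
Proof. exact: (repf_op1 (tri v0)). Qed.

Lemma repf_diag f : repf f -> repf (fun n => diagm (f n)).
Proof. exact: (repf_op1 (diag v0)). Qed.

End Arithmetic.

Ltac prove_repf := lazymatch goal with
  | |- repf (fun n => n) => exact: repf_id
  | |- repf (fun n => add (@?f n) (@?g n)) => apply (repf_add (f := f) (g := g)); prove_repf
  | |- repf (fun n => mul (@?f n) (@?g n)) => apply (repf_mul (f := f) (g := g)); prove_repf
  | |- repf (fun n => pow2m (@?f n)) => apply (repf_pow2 (f := f)); prove_repf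
  | |- repf (fun n => trim (@?f n)) => apply (repf_tri (f := f)); prove_repf
  | |- repf (fun n => diagm (@?f n)) => apply (repf_diag (f := f)); prove_repf
  | |- repf (fun n => app ?F (@?f n)) => apply (repf_app F (f := f)); prove_repf
  | |- repf _ => first [exact: repf_const | refine (repf_app _ _); prove_repf]
  end.

(** * The pairing function in a model *)

Section Pairing.
Variable m : model.
Local Notation M0 := (dom m ty0).

Lemma pairmE (a b : M0) : pairm a b = add (trim (add a b)) b.
Proof. by []. Qed.

Lemma psndmE (z : M0) : psndm z = monusm z (trim (diagm z)).
Proof. by []. Qed.

Lemma pfstmE (z : M0) : pfstm z = monusm (diagm z) (psndm z).
Proof. by []. Qed.

Lemma diagm_0 : diagm (zero m) = zero m.
Proof. exact: recm_0. Qed.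

Lemma diagm_S (z : M0) : let w := diagm z in
  diagm (add z (one m)) =
  if (emb (trim (add w (one m))) <= emb (add z (one m)))%R then add w (one m) else w.
Proof.
move=> w; pose e : assign (dom m) [ty0] := acons (add z (one m)) (@anil _).
pose c : tm [ty0; ty0; ty0] ty0 := monus (tri (v0 + 1)) (v1 + 1).
have -> : diagm (add z (one m)) = eval (ifz c (v0 + 1)%tm v0) (acons w (acons z e)).
  exact (rec_S (ifz c (v0 + 1)%tm v0) e (zero m) z).
case: ifP => h; first by rewrite ifz_0 //; apply/monusm_eq0.
by rewrite ifz_S // => /monusm_eq0; rewrite h.
Qed.

Lemma trim_mono (a b : M0) : (emb a <= emb b)%R -> (emb (trim a) <= emb (trim b))%R.
Proof.
have key n : (emb (trim a) <= emb (trim (add a n)))%R.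
  move: n; apply: decp_ind => [||n h].
  - by apply: decp_le; prove_repf.
  - by rewrite add_0.
  - by rewrite -addA trim_S !emb_add emb_1; have := emb_ge0 a; have := emb_ge0 n; lra.
move=> h; have e := monusm_emb h.
have -> : b = add a (monusm b a) by apply: emb_inj; rewrite emb_add e; ring.
exact: key.
Qed.

(** The two bounds are kept together by induction: when [z] grows by one, [w] is raised exactly if
    [tri (w + 1)] has been reached, and the next triangular number is then larger by at least
    one. *)
Lemma diagm_spec (z : M0) :
  (emb (trim (diagm z)) <= emb z)%R /\ (emb (add z (one m)) <= emb (trim (add (diagm z) (one m))))%R.
Proof.
move: z; apply: decp_ind => [||z].
- by apply: decp_and; apply: decp_le; prove_repf.
- by rewrite diagm_0 trim_S trim_0 !emb_add emb_0 emb_1; split; lra.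
- rewrite diagm_S; case: ifP => h [h1 h2]; split=> //; last first.
  + have := emb_lt_succ (add z (one m)) (trim (add (diagm z) (one m))).
    rewrite ltNge h /= [emb (add (add z _) _)]emb_add emb_1 => /esym; lra.
  + by move: h1; rewrite [emb (add z _)]emb_add emb_1; lra.
  + move: h2; rewrite (trim_S (add _ _)) !emb_add emb_1; have := emb_ge0 (diagm z); lra.
Qed.

(** Since [pair a b] lies between [tri (a + b)] and [tri (a + b + 1)], monotonicity of [tri] leaves
    no other value for the search. *)
Lemma diagm_pair (a b : M0) : diagm (pairm a b) = add a b.
Proof.
have [h1 h2] := diagm_spec (pairm a b); set w := diagm _ in h1 h2 *.
have ha := emb_ge0 a; have hb := emb_ge0 b.
move: h1 h2; rewrite [pairm a b]pairmE => h1 h2.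
have hw : (emb w < emb (add a b) + 1)%R.
  rewrite ltNge; apply/negP => h.
  have := @trim_mono (add (add a b) (one m)) w; rewrite trim_S.
  by move: h1 h; rewrite !emb_add emb_1 => h1 h /(_ h); lra.
have hw' : (emb (add a b) < emb w + 1)%R.
  rewrite ltNge; apply/negP => h.
  have := @trim_mono (add w (one m)) (add a b).
  by move: h2 h; rewrite !emb_add emb_1 => h2 h /(_ h); lra.
apply: emb_inj.
have e1 : (emb w <= emb (add a b))%R.
  have : (emb w < emb (add (add a b) (one m)))%R by rewrite (emb_add (add a b)) emb_1.
  by rewrite emb_lt_succ (emb_add (add a b)) emb_1; lra.
have : (emb (add a b) < emb (add w (one m)))%R by rewrite (emb_add w) emb_1.
rewrite emb_lt_succ (emb_add w) emb_1; lra.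
Qed.

Lemma psndm_pair (a b : M0) : psndm (pairm a b) = b.
Proof.
apply: emb_inj; rewrite psndmE diagm_pair [pairm a b]pairmE.
have := emb_ge0 b => h; rewrite monusm_emb emb_add; lra.
Qed.

Lemma pfstm_pair (a b : M0) : pfstm (pairm a b) = a.
Proof.
apply: emb_inj; rewrite pfstmE psndm_pair diagm_pair.
have := emb_ge0 a => h; rewrite monusm_emb emb_add; lra.
Qed.

End Pairing.

(** * Rationals and reals of a model *)

Section Reals.
Variable m : model.
Local Notation M0 := (dom m ty0).
Local Notation M1 := (dom m ty1).
Local Notation "0" := (zero m) : model_scope.
Local Notation "1" := (one m) : model_scope.
Local Notation "a + b" := (@add m a b) : model_scope.
Local Notation "a * b" := (@mul m a b) : model_scope.
Delimit Scope model_scope with M.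
Local Open Scope ring_scope.

Definition num (q : M0) : zmod m := emb (pfstm (pfstm q)) - emb (psndm (pfstm q)).
Definition den (q : M0) : zmod m := emb (psndm q + 1)%M.
Definition pw (n : M0) : zmod m := emb (pow2m n).

Lemma den_ge1 q : 1 <= den q.
Proof. by rewrite /den emb_add emb_1; have := emb_ge0 (psndm q); lra. Qed.

Lemma pw_ge1 n : 1 <= pw n. Proof. exact: pow2m_ge1. Qed.
Lemma pw_add a b : pw (a + b)%M = pw a * pw b.
Proof. by rewrite /pw pow2m_add emb_mul. Qed.
Lemma pw_0 : pw 0%M = 1. Proof. by rewrite /pw pow2m_0. Qed.
Lemma pw_1 : pw 1%M = 2.
Proof. by have := pow2m_S (zero m); rewrite addC add_0 pow2m_0 emb_1 mulr1. Qed.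

Definition ratle (q r k n : M0) : Prop :=
  pw n * (num q * den r - num r * den q) <= emb k * (den q * den r).
Definition ratlt (q r k n : M0) : Prop :=
  pw n * (num q * den r - num r * den q) < emb k * (den q * den r).

Lemma sat_rat_lt G (q r k n : tm G ty0) (e : assign (dom m) G) :
  sat (rat_lt q r k n) e <-> ratlt (eval q e) (eval r e) (eval k e) (eval n e).
Proof.
set a := eval q e; set b := eval r e; set c := eval k e; set d := eval n e.
have -> : sat (rat_lt q r k n) e <->
  ltm (pow2m d * (pfstm (pfstm a) * (psndm b + 1) + psndm (pfstm b) * (psndm a + 1)))%M
     (pow2m d * (psndm (pfstm a) * (psndm b + 1) + pfstm (pfstm b) * (psndm a + 1)) +
      c * ((psndm a + 1) * (psndm b + 1)))%M by [].
rewrite -emb_lt !(emb_add, emb_mul) /ratlt /num /den /pw !emb_add.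
by split; lra.
Qed.

Lemma sat_rat_le G (q r k n : tm G ty0) (e : assign (dom m) G) :
  sat (rat_le q r k n) e <-> ratle (eval q e) (eval r e) (eval k e) (eval n e).
Proof.
set a := eval q e; set b := eval r e; set c := eval k e; set d := eval n e.
have -> : sat (rat_le q r k n) e <->
  ltm (pow2m d * (pfstm (pfstm a) * (psndm b + 1) + psndm (pfstm b) * (psndm a + 1)))%M
     (pow2m d * (psndm (pfstm a) * (psndm b + 1) + pfstm (pfstm b) * (psndm a + 1)) +
      c * ((psndm a + 1) * (psndm b + 1)))%M \/
  eqM (pow2m d * (pfstm (pfstm a) * (psndm b + 1) + psndm (pfstm b) * (psndm a + 1)))%M
     (pow2m d * (psndm (pfstm a) * (psndm b + 1) + pfstm (pfstm b) * (psndm a + 1)) +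
      c * ((psndm a + 1) * (psndm b + 1)))%M by [].
set X := (_ * _)%M; set Y := (_ + _)%M.
have -> : ltm X Y \/ eqM X Y <-> emb X <= emb Y.
  rewrite -emb_lt (proj1 (@str_ext m)); split=> [[/ltW //|->]|]; first exact: lexx.
  by rewrite le_eqVlt => /orP [/eqP /emb_inj|]; [right|left].
rewrite /X /Y !(emb_add, emb_mul) /ratle /num /den /pw !emb_add.
by split; lra.
Qed.

Definition isreal (x : M1) : Prop := forall n k : M0,
  ratlt (app x n) (app x (n + k)%M) 1%M n /\ ratlt (app x (n + k)%M) (app x n) 1%M n.

Definition inunit (x : M1) : Prop := isreal x /\
  forall n : M0, pw n * - num (app x n) <= 2 * den (app x n) /\
    pw n * (num (app x n) - den (app x n)) <= 2 * den (app x n).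

Definition eqreal (x y : M1) : Prop := forall n : M0,
  ratle (app x n) (app y n) (1 + 1)%M n /\ ratle (app y n) (app x n) (1 + 1)%M n.

(** A code of [c / 2^e]; a code stores the denominator minus one. *)
Definition dyadic (c e : M0) : M0 := pairm (pairm c 0%M) (monusm (pow2m e) 1%M).

Lemma num_dyadic c e : num (dyadic c e) = emb c.
Proof. by rewrite /num /dyadic !pfstm_pair psndm_pair emb_0 subr0. Qed.

Lemma den_dyadic c e : den (dyadic c e) = pw e.
Proof.
rewrite /den /dyadic psndm_pair emb_add monusm_emb; first by rewrite /pw; ring.
by rewrite emb_1; apply: pw_ge1.
Qed.

Lemma num_pair a b : num (pairm (pairm a b) 0%M) = emb a - emb b.
Proof. by rewrite /num !pfstm_pair psndm_pair. Qed.

Lemma den_pair a : den (pairm a 0%M) = 1.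
Proof. by rewrite /den psndm_pair emb_add emb_0 emb_1 add0r. Qed.

Lemma emb_2 : emb (1 + 1)%M = 2 :> zmod m.
Proof. by rewrite emb_add emb_1. Qed.

Lemma sat_is_real G (x : tm G ty1) (e : assign (dom m) G) : sat (is_real x) e <-> isreal (eval x e).
Proof.
split=> h n k; have [h1 h2] := h n k.
  split.
    have := proj1 (sat_rat_lt _ _ _ _ _) h1; by rewrite /= !eval_wk.
  have := proj1 (sat_rat_lt _ _ _ _ _) h2; by rewrite /= !eval_wk.
by split; apply: (proj2 (sat_rat_lt _ _ _ _ _)); rewrite /= !eval_wk.
Qed.

Lemma sat_eq_real G (x y : tm G ty1) (e : assign (dom m) G) :
  sat (eq_real x y) e <-> eqreal (eval x e) (eval y e).
Proof.
split=> h n; have [h1 h2] := h n.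
  split.
    have := proj1 (sat_rat_le _ _ _ _ _) h1; by rewrite /= !eval_wk.
  have := proj1 (sat_rat_le _ _ _ _ _) h2; by rewrite /= !eval_wk.
by split; apply: (proj2 (sat_rat_le _ _ _ _ _)); rewrite /= !eval_wk.
Qed.

Lemma sat_in_unit G (x : tm G ty1) (e : assign (dom m) G) : sat (in_unit x) e <-> inunit (eval x e).
Proof.
have z0 n : app (eval (real_zero G) e) n = pairm (pairm 0%M 0%M) 0%M.
  by rewrite /real_zero eval_lamE.
have z1 n : app (eval (real_one G) e) n = pairm (pairm 1%M 0%M) 0%M.
  by rewrite /real_one eval_lamE.
have -> : sat (in_unit x) e <-> sat (is_real x) e /\ sat (le_real (real_zero G) x) e /\
    sat (le_real x (real_one G)) e by [].
rewrite sat_is_real; split=> [[h [h0 h1]]|[h h']]; split=> //.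
  move=> n; have := proj1 (sat_rat_le _ _ _ _ _) (h0 n); have := proj1 (sat_rat_le _ _ _ _ _) (h1 n).
  rewrite /= !eval_wk z0 z1 /ratle !num_pair !den_pair emb_0 emb_1.
  rewrite (_ : emb _ = 2 :> zmod m); last exact: emb_2.
  by split; lra.
split=> n; apply: (proj2 (sat_rat_le _ _ _ _ _)); rewrite /= !eval_wk ?z0 ?z1 /ratle
  !num_pair !den_pair emb_0 ?emb_1 (_ : emb (app _ _) = 2 :> zmod m); try exact: emb_2;
  by have [] := h' n; lra.
Qed.

(* Parametrising closed dyadic intervals by functions *)
Local Opaque monusm pow2m pairm pfstm psndm.

(** The three summands of [test] vanish together exactly when [u = g (j + 1)] differs from [2 k] by
    at most 2 and is at most [2^(j + 1)]; the last line selects [u] in that case and [2 k]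
    otherwise. The value of [g] at 0 is never read, which leaves it free to carry a number. *)
Definition kstep G (g : tm G ty1) : tm (ty0 :: ty0 :: G) ty0 :=
  let k := v0 in let u := (ren_tm (@wk _ _) (ren_tm (@wk _ _) g) @ (v1 + Defs.One))%tm in
  let test := (monus u (k + k + (Defs.One + Defs.One)) + monus (k + k) (u + (Defs.One + Defs.One)) +
               monus u (pow2 (v1 + Defs.One)))%tm in
  (u * monus Defs.One test + (k + k) * monus Defs.One (monus Defs.One test))%tm.

Definition kseqE : dom m (ty1 ~> ty0 ~> ty0) :=
  eval (lam (lam (rec (kstep v1) Zero v0))) (@anil _).

(* [kseq g] is a sequence of integers with [kseq g j / 2^j] converging in [[0,1]]:
   it follows [g] as long as this keeps [|k_(j+1) - 2 k_j| <= 2]. *)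
Definition kseq (g : M1) (j : M0) : M0 := app (app kseqE g) j.

Lemma kseq_eval g j : kseq g j =
  eval (rec (kstep v1) Zero v0) (acons j (acons g (@anil (dom m)))).
Proof. by rewrite /kseq /kseqE !eval_lamE. Qed.

Lemma kseq_0 g : kseq g 0%M = 0%M.
Proof. rewrite kseq_eval; exact: recm_0. Qed.

Lemma three_tests (a b c d e f : M0) :
  (monusm a b + monusm c d + monusm e f = 0)%M <->
  emb a <= emb b /\ emb c <= emb d /\ emb e <= emb f.
Proof.
have z (u v : M0) : (u + v = 0 <-> u = 0 /\ v = 0)%M.
  rewrite !emb_eq0 emb_add; have := emb_ge0 u; have := emb_ge0 v.
  by split=> [|[]]; [split; lra|lra].
rewrite !z !monusm_eq0; tauto.
Qed.

Lemma select_zero (u k test : M0) (C : Prop) : (test = 0%M <-> C) ->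
  let r := (u * monusm 1 test + (k + k) * monusm 1 (monusm 1 test))%M in
  (C /\ r = u) \/ (~ C /\ emb r = 2 * emb k).
Proof.
move=> hC; case: (EM (test = 0%M)) => h; [left|right]; split; try by [apply/hC|rewrite -hC].
  rewrite h (monusm_0 (one m)) (_ : monusm 1%M 1%M = 0%M); last by apply/monusm_eq0.
  by rewrite mul_1 mul_0 add_0.
have e1 : monusm 1%M test = 0%M.
  apply/monusm_eq0; rewrite emb_1; have := emb_lt_succ 0%M test.
  rewrite emb_0 add0r => <-; rewrite lt_def emb_ge0 andbT; apply/eqP => h'.
  by apply: h; apply: emb_inj; rewrite h' emb_0.
rewrite e1 (monusm_0 (one m)) mul_1 mul_0 emb_add emb_0 emb_add; ring.
Qed.

Lemma kseq_S g j : let k := kseq g j in let u := app g (j + 1)%M in let k' := kseq g (j + 1)%M in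
  ((emb u <= 2 * emb k + 2 /\ 2 * emb k <= emb u + 2 /\ emb u <= pw (j + 1)%M) /\ k' = u) \/
  (~ (emb u <= 2 * emb k + 2 /\ 2 * emb k <= emb u + 2 /\ emb u <= pw (j + 1)%M) /\
     emb k' = 2 * emb k).
Proof.
move=> k u k'.
pose test := (monusm u (k + k + (1 + 1)) + monusm (k + k) (u + (1 + 1)) + monusm u (pow2m (j + 1)))%M.
have e : k' = (u * monusm 1 test + (k + k) * monusm 1 (monusm 1 test))%M.
  rewrite /k' kseq_eval recE [X in recm _ _ X](_ : _ = (j + 1)%M) // rec_S.
  rewrite (_ : recm _ _ j = k); last by rewrite /k kseq_eval.
  by [].
have ht : test = 0%M <-> (emb u <= 2 * emb k + 2 /\ 2 * emb k <= emb u + 2 /\ emb u <= pw (j + 1)%M).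
  rewrite three_tests !emb_add emb_1 -/(pw _).
  by split=> [[? [? ?]]|[? [? ?]]]; split; try split; lra.
rewrite e; exact: select_zero.
Qed.

Lemma repf_kseq g f : repf f -> repf (fun n => kseq g (f n)).
Proof. exact: repf_app. Qed.

Lemma pw_S j : pw (j + 1)%M = 2 * pw j.
Proof. by rewrite pw_add pw_1 mulrC. Qed.

Lemma kseq_le g j : emb (kseq g j) <= pw j.
Proof.
move: j; apply: decp_ind => [||j h].
- by apply: decp_le; [apply: repf_kseq; exact: repf_id|apply: repf_pow2; exact: repf_id].
- by rewrite kseq_0 emb_0; have := pw_ge1 0%M; lra.
- case: (kseq_S g j) => [[[_ [_ h']] ->] //|[_ ->]]; rewrite pw_S; lra.
Qed.

(** The errors 2 of the single steps, each doubled by every later step, add up to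
    [2 * (2^t - 1)]. *)
Lemma kseq_diff g j t :
  emb (kseq g (j + t)%M) <= pw t * emb (kseq g j) + 2 * pw t - 2 /\
  pw t * emb (kseq g j) <= emb (kseq g (j + t)%M) + 2 * pw t - 2.
Proof.
(* Subtractions are moved to the other side, because [decp_le] compares natural numbers of the
   model. *)
pose P t := emb (kseq g (j + t)%M + (1 + 1))%M <= emb (pow2m t * kseq g j + (1 + 1) * pow2m t)%M /\
  emb (pow2m t * kseq g j + (1 + 1))%M <= emb (kseq g (j + t) + (1 + 1) * pow2m t)%M.
have : P t.
  move: t; apply: decp_ind => [||t].
  - by apply: decp_and; apply: decp_le; prove_repf.
  - by rewrite /P !(emb_add, emb_mul) -/(pw _) pw_0 add_0 emb_1; split; lra.
  - rewrite /P !(emb_add, emb_mul) -!/(pw _) pw_S -addA emb_1.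
    by case: (kseq_S g (j + t)%M) => [[[h1 [h2 _]] ->]|[_ ->]] [h3 h4]; split; lra.
by rewrite /P !(emb_add, emb_mul) -!/(pw _) emb_1; move=> [h1 h2]; split; lra.
Qed.

Definition minm (a b : M0) : M0 := monusm a (monusm a b).
Definition maxm (a b : M0) : M0 := (a + monusm b a)%M.

Lemma minmE a b : (emb a <= emb b /\ minm a b = a) \/ (emb b <= emb a /\ minm a b = b).
Proof.
rewrite /minm; case: (monusmE a b) => [[h ->]|[h e]]; [left|right]; split=> //.
  exact: monusm_0.
by apply: emb_inj; rewrite monusm_emb e; have := emb_ge0 b; lra.
Qed.

Lemma maxmE a b : (emb a <= emb b /\ maxm a b = b) \/ (emb b <= emb a /\ maxm a b = a).
Proof.
rewrite /maxm; case: (monusmE b a) => [[h ->]|[h e]]; [right|left]; split=> //.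
  exact: add_0.
by apply: emb_inj; rewrite emb_add e; lra.
Qed.

Definition clamp (lo hi k : M0) : M0 := maxm lo (minm hi k).

Lemma clampE lo hi k : emb lo <= emb hi ->
  (emb k <= emb lo /\ clamp lo hi k = lo) \/
  (emb lo <= emb k /\ emb k <= emb hi /\ clamp lo hi k = k) \/
  (emb hi <= emb k /\ clamp lo hi k = hi).
Proof.
rewrite /clamp => h; case: (minmE hi k) => [[h1 ->]|[h1 ->]].
  right; right; split=> //; case: (maxmE lo hi) => [[_ ->]|[h2 ->]] //.
  by apply: emb_inj; lra.
by case: (maxmE lo k) => [[h2 ->]|[h2 ->]]; [right; left|left].
Qed.

(** A single closed term, since it has to occur inside the functionals given to Delta-comprehension.
    Entry [j] uses the precision [l + j]: the end points then have the integer numerators [lo * 2^j]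
    and [hi * 2^j], and for [l >= 1] the bound of [kseq_diff] yields the rate of convergence
    required of reals. *)
Definition clampedE : dom m (ty0 ~> ty0 ~> ty0 ~> ty1 ~> ty1) :=
  let l := Var (vs (vs (vs (vs vz)))) in let lo := Var (vs (vs (vs vz))) in
  let hi := (v2 * pow2 v0)%tm in let k := (Var (vs (vs (vs (vs (vs vz))))) @ v1 @ (l + v0))%tm in
  let c := monus hi (monus hi k) in let x := (lo * pow2 v0)%tm in
  eval (lam (lam (lam (lam (lam
    (pair (pair (x + monus c x)%tm Zero) (monus (pow2 (l + v0)%tm) Defs.One)))))))
  (acons kseqE (@anil _)).

(* The real in the interval from [lo / 2^l] to [hi / 2^l] closest to the limit of [kseq g j / 2^j]. *)
Definition clamped (l lo hi : M0) (g : M1) : M1 := app (app (app (app clampedE l) lo) hi) g.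

Lemma clampedEq l lo hi g j : app (clamped l lo hi g) j =
  dyadic (clamp (lo * pow2m j) (hi * pow2m j) (kseq g (l + j)))%M (l + j)%M.
Proof. by rewrite /clamped /clampedE !eval_lamE. Qed.

Lemma emb_int (a b : M0) : emb a < emb b + 1 -> emb a <= emb b.
Proof. by move=> h; rewrite leNgt emb_lt_succ; apply/negP => h'; lra. Qed.

(** Clamping to an interval does not increase distances, so the estimate of [kseq_diff] survives
    it. *)
Lemma clamp_diff lo hi k k' s : emb lo <= emb hi -> 1 <= emb s ->
  emb k' <= emb s * emb k + 2 * emb s - 2 -> emb s * emb k <= emb k' + 2 * emb s - 2 ->
  let c := emb (clamp lo hi k) in let c' := emb (clamp (lo * s)%M (hi * s)%M k') in
  c' <= emb s * c + 2 * emb s - 2 /\ emb s * c <= c' + 2 * emb s - 2.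
Proof.
move=> h hs h1 h2; have h' : emb (lo * s)%M <= emb (hi * s)%M.
  by rewrite !emb_mul; apply: ler_wpM2r => //; lra.
have mono (a b : zmod m) : a <= b -> emb s * a <= emb s * b.
  by move=> ?; apply: ler_wpM2l => //; lra.
have H : let c := emb (clamp lo hi k) in
   (emb k <= emb lo /\ c = emb lo) \/ (emb lo <= emb k /\ emb k <= emb hi /\ c = emb k) \/
   (emb hi <= emb k /\ c = emb hi).
  by case: (clampE k h) => [[? ->]|[[? [? ->]]|[? ->]]]; auto.
have : let c' := emb (clamp (lo * s)%M (hi * s)%M k') in
   (emb k' <= emb lo * emb s /\ c' = emb lo * emb s) \/
   (emb lo * emb s <= emb k' /\ emb k' <= emb hi * emb s /\ c' = emb k') \/
   (emb hi * emb s <= emb k' /\ c' = emb hi * emb s).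
  by rewrite -!emb_mul; case: (clampE k' h') => [[? ->]|[[? [? ->]]|[? ->]]]; auto.
move: H => /=; move: (emb (clamp lo hi k)) (emb (clamp _ _ _)) => c c'.
(* The products with [emb s] are not linear; these implications supply the scaled comparisons, after
   which each of the nine cases is linear. *)
move: (mono (emb k) (emb lo)) (mono (emb lo) (emb k)) (mono (emb k) (emb hi))
  (mono (emb hi) (emb k)) (mono _ _ h).
move: (emb lo) (emb hi) (emb s) (emb k) (emb k') hs h1 h2 => A B S X X' hs h1 h2.
move=> m1 m2 m3 m4 m5 [[e ->]|[[e [e' ->]]|[e ->]]] [[f ->]|[[f [f' ->]]|[f ->]]];
  try (have := m1 e); try (have := m2 e); try (have := m3 e'); try (have := m4 e);
  move=> *; split; lra.
Qed.

Lemma pw_gt0 n : 0 < pw n. Proof. by have := pw_ge1 n; lra. Qed.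

Lemma inunit_dyadic (x : M1) (c e : M0 -> M0) : (forall j, app x j = dyadic (c j) (e j)) ->
  (forall j, emb (c j) <= pw (e j)) ->
  (forall j t, pw j * (emb (c j) * pw (e (j + t)%M) - emb (c (j + t)%M) * pw (e j)) <
               pw (e j) * pw (e (j + t)%M) /\
               pw j * (emb (c (j + t)%M) * pw (e j) - emb (c j) * pw (e (j + t)%M)) <
               pw (e j) * pw (e (j + t)%M)) -> inunit x.
Proof.
move=> hx hc hd; split=> [j t|j].
  rewrite /ratlt !hx !num_dyadic !den_dyadic emb_1; have [h1 h2] := hd j t.
  by split; [move: h1|move: h2]; lra.
rewrite hx num_dyadic den_dyadic; have h0 := emb_ge0 (c j); have h1 := hc j.
have p := pw_gt0 j; have q := pw_gt0 (e j).
have : 0 <= pw j * emb (c j) by apply: mulr_ge0 => //; apply: ltW.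
have : 0 <= pw j * (pw (e j) - emb (c j)) by apply: mulr_ge0; [exact: ltW|lra].
by split; lra.
Qed.

Lemma inunit_clamped l lo hi g : 1 <= emb l -> emb lo <= emb hi -> emb hi <= pw l ->
  inunit (clamped l lo hi g).
Proof.
move=> hl h1 h2.
pose c j := (clamp (lo * pow2m j) (hi * pow2m j) (kseq g (l + j)))%M.
have hlo j : emb (lo * pow2m j)%M <= emb (hi * pow2m j)%M.
  by rewrite !emb_mul; apply: ler_wpM2r => //; apply: ltW; apply: pw_gt0.
have hl2 : 2 <= pw l.
  have e : l = (monusm l 1 + 1)%M by apply: emb_inj; rewrite emb_add monusm_emb emb_1; lra.
  by rewrite e pw_S; have := pw_ge1 (monusm l 1%M); lra.
apply: (@inunit_dyadic _ c (fun j => (l + j)%M)) => [j|j|j t]; first exact: clampedEq.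
  rewrite pw_add /c; have p := pw_gt0 j.
  have h3 : emb hi * pw j <= pw l * pw j by apply: ler_wpM2r => //; apply: ltW.
  have := hlo j; case: (clampE (kseq g (l + j)%M) (hlo j)) => [[_ ->]|[[_ [h ->]]|[_ ->]]].
  - by rewrite !emb_mul -/(pw j); lra.
  - by move: h; rewrite !emb_mul -/(pw j); lra.
  - by rewrite !emb_mul -/(pw j); lra.
have [k1 k2] := kseq_diff g (l + j)%M t.
have ht := pw_ge1 t.
have := @clamp_diff (lo * pow2m j)%M (hi * pow2m j)%M (kseq g (l + j)%M) (kseq g (l + j + t)%M)
  (pow2m t) (hlo j) ht k1 k2; rewrite -/(pw t).
rewrite !mulA -!pow2m_add addA -/(c j) -/(c (j + t)%M) => -[d1 d2].
rewrite -addA !pw_add; move: d1 d2; set C := emb (c j); set C' := emb (c (j + t)%M).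
have p := pw_gt0 j; have q := pw_gt0 l.
move: (pw j) (pw l) (pw t) p q ht hl2 => P L T p q ht hl2 d1 d2.
have hPP : 0 < P * (L * P) by do !apply: mulr_gt0.
have key X : X <= 2 * T - 2 -> P * (L * P) * X < P * (L * P) * (L * T).
  move=> hX; rewrite ltr_pM2l //; have : 0 <= (L - 2) * T by apply: mulr_ge0; lra.
  lra.
have K1 : P * (L * P) * (T * C - C') < P * (L * P) * (L * T) by apply: key; lra.
have K2 : P * (L * P) * (C' - T * C) < P * (L * P) * (L * T) by apply: key; lra.
split; lra.
Qed.

(** * Every real of the unit interval is reached by the parametrisation *)

(** The base theory has choice for function arguments only. A number [j] is passed as the constant
    function [j] and read back through its value at 0. *)
Lemma choice_numbers (F : dom m (ty0 ~> ty0 ~> ty0)) :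
  (forall j, exists k, app (app F j) k = 0%M) -> exists g : M1, forall j, app (app F j) (app g j) = 0%M.
Proof.
move=> h; pose A : form [ty0; ty1; ty0 ~> ty0 ~> ty0] := Eq (v2 @ (v1 @ Zero) @ v0)%tm Zero.
have hA : qf A by [].
have := proj1 (@sat_close m _ (Defs.choice A)) (@str_models m _ (RCA0w_QFAC hA))
  (acons F (@anil _)).
case.
  move=> f; have [k hk] := h (app f 0%M); exists k; exact: (proj2 (proj1 (@str_ext m) _ _) hk).
move=> Y hY; exists (eval (lam (v1 @ (Pi @ v0)))%tm (acons Y (@anil _))) => j.
rewrite eval_lamE /=; pose f : M1 := app (@piM m ty0 ty0) j; rewrite -/f.
have := proj1 (@sat_subst m _ A _ _ _) (hY f) => /= /eqM_eq.
by rewrite /f app_pi.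
Qed.

Lemma zmod_lt_succ (u v : zmod m) : (u < v) = (u + 1 <= v).
Proof.
apply/idP/idP => [h|]; last lra.
have [n [e|e]] := zmod_sign (v - u); last by have := emb_ge0 n; lra.
have := emb_lt_succ 0%M n; rewrite emb_0 -e => h'.
have : 0 + 1 <= v - u by rewrite -h'; lra.
lra.
Qed.

(** [k] is within 1/2 of [2^j * q] and at most [2^j]. The entry [j + 2] is precise enough for two
    purposes: an element of the unit interval has [2^j * q] between -1/2 and [2^j + 1/2], so such a
    [k] exists, and consecutive choices pass the test of [kstep]. *)
Definition good (x : M1) (j k : M0) : Prop := let q := app x (j + (1 + 1))%M in
  2 * pw j * num q <= 2 * emb k * den q + den q /\
  2 * emb k * den q <= 2 * pw j * num q + den q /\ emb k <= pw j.

Lemma good_dec (x : M1) : exists F : dom m (ty0 ~> ty0 ~> ty0),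
  forall j k, good x j k <-> app (app F j) k = 0%M.
Proof.
pose q : tm [ty0; ty0; ty1] ty0 := (v2 @ (v1 + (Defs.One + Defs.One)))%tm.
pose a := ((Defs.One + Defs.One) * pow2 v1 * qpos q)%tm.
pose b := ((Defs.One + Defs.One) * pow2 v1 * qneg q)%tm.
pose c := ((Defs.One + Defs.One) * v0 * qden q)%tm.
exists (eval (lam (lam (monus a (b + c + qden q) + monus (b + c) (a + qden q) +
  monus v0 (pow2 v1))))%tm (acons x (@anil _))) => j k.
rewrite !eval_lamE; set e := acons k _.
set t := eval _ e; pose Q := app x (j + (1 + 1))%M.
have -> : t = (monusm ((1 + 1) * pow2m j * pfstm (pfstm Q))
     ((1 + 1) * pow2m j * psndm (pfstm Q) + (1 + 1) * k * (psndm Q + 1) + (psndm Q + 1)) +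
   monusm ((1 + 1) * pow2m j * psndm (pfstm Q) + (1 + 1) * k * (psndm Q + 1))
     ((1 + 1) * pow2m j * pfstm (pfstm Q) + (psndm Q + 1)) + monusm k (pow2m j))%M by [].
rewrite three_tests /good /num /den /pw; change (app x (j + (1 + 1))%M) with Q; clearbody Q.
move: (pfstm (pfstm Q)) (psndm (pfstm Q)) (psndm Q) (pow2m j) => u v d p.
rewrite !(emb_add, emb_mul) emb_1.
by split=> [[? [? ?]]|[? [? ?]]]; split; try split; lra.
Qed.

(** Rounding by induction: if no [k] is good, then each [k] up to [2^j] satisfies
    [k + 1/2 < 2^j * q], which fails at [k = 2^j]. *)
Lemma good_ex (x : M1) j : inunit x -> exists k, good x j k.
Proof.
move=> [_ hx]; apply: NNPP => hn.
pose q := app x (j + (1 + 1))%M.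
have [h1 h2] := hx (j + (1 + 1))%M; rewrite -/q pw_add pw_add pw_1 in h1 h2.
have hd := den_ge1 q; have hp := pw_ge1 j.
pose P k := pw j + 1 <= emb k \/ 2 * emb k * den q + den q < 2 * pw j * num q.
have decP : decp P.
  pose P' k := emb (pow2m j + 1)%M <= emb k \/ emb ((1 + 1) * k * (psndm q + 1) + (psndm q + 1) +
    (1 + 1) * pow2m j * psndm (pfstm q) + 1)%M <= emb ((1 + 1) * pow2m j * pfstm (pfstm q))%M.
  have hP k : P k <-> P' k.
    rewrite /P' /P zmod_lt_succ !(emb_add, emb_mul) /num /den !emb_add emb_1 -/(pw j).
    by split=> -[h|h]; [left|right|left|right]; lra.
  have [f hf hfE] : decp P'.
    by apply: decp_or; apply: decp_le; prove_repf.
  by exists f => // k; rewrite hP.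
have all k : P k.
  move: k; apply: decp_ind => // [|k hk].
    right; rewrite emb_0; rewrite ltNge; apply/negP => h; apply: hn; exists 0%M.
    by rewrite /good -/q emb_0; split; [|split]; lra.
  rewrite /P emb_add emb_1; case: hk => hk; first by left; lra.
  case: (lerP (pw j + 1) (emb k + 1)) => h; [by left|right].
  have hk' : emb (k + 1)%M <= pw j.
    by apply: emb_int; rewrite emb_add emb_1 -/(pw j); lra.
  rewrite ltNge; apply/negP => h'; apply: hn; exists (k + 1)%M.
  by rewrite /good -/q; move: hk'; rewrite emb_add emb_1 => hk'; split; [|split]; lra.
by case: (all (pow2m j)); rewrite -/(pw j); lra.
Qed.

(** The tolerance 2 of [kstep] is the sum of 1/2 from rounding [k'], 1/2 from the two entries of
    [x], and 1 from twice the rounding of [k]. *)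
Lemma good_diff (x : M1) j k k' : isreal x -> good x j k -> good x (j + 1)%M k' ->
  emb k' <= 2 * emb k + 2 /\ 2 * emb k <= emb k' + 2.
Proof.
move=> hx [g1 [g2 _]] [g3 [g4 _]].
have [] := hx (j + (1 + 1))%M 1%M.
rewrite (_ : (j + (1 + 1) + 1)%M = (j + 1 + (1 + 1))%M); last by rewrite !addA (addC 1%M).
move: g1 g2 g3 g4; rewrite /ratlt pw_S 2!pw_add pw_1 emb_1.
set q := app x (j + (1 + 1))%M; set q' := app x _.
move: (den_ge1 q) (den_ge1 q') (pw_ge1 j) (emb k) (emb k').
move: (num q) (num q') (den q) (den q') (pw j) => U U' d d' P hd hd' hP K K'.
move=> g1 g2 g3 g4 r1 r2.
have dd : 0 < d * d' by apply: mulr_gt0; lra.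
have w1 := ler_wpM2l (ltW (lt_le_trans ltr01 hd')) g1.
have w2 := ler_wpM2l (ltW (lt_le_trans ltr01 hd')) g2.
have w3 := ler_wpM2l (ltW (lt_le_trans ltr01 hd)) g3.
have w4 := ler_wpM2l (ltW (lt_le_trans ltr01 hd)) g4.
have a1 : (d * d') * K' <= (d * d') * (2 * K + 2) by lra.
have a2 : (d * d') * (2 * K) <= (d * d') * (K' + 2) by lra.
by split; [move: a1|move: a2]; rewrite ler_pM2l.
Qed.

Lemma kseq_of_real (x : M1) : inunit x -> exists g, forall j, good x (j + 1)%M (kseq g (j + 1)%M).
Proof.
move=> hx; have [F hF] := good_dec x.
have [j|g hg] := @choice_numbers F; first by have [k /hF hk] := good_ex j hx; exists k.
have {F hF} hg j : good x j (app g j) by apply/hF.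
have e : forall j, kseq g (j + 1)%M = app g (j + 1)%M.
  apply: decp_ind => [||j IH].
  - by apply: decp_eq; [apply: repf_kseq|]; prove_repf.
  (* The sequence starts at 0 whatever [g] is at 0. The first test still succeeds, because a good
     number at index 1 is at most 2. *)
  - case: (kseq_S g 0%M) => [[_ ->] //|[[]]].
    have [_ [_ h]] := hg (0 + 1)%M; have := emb_ge0 (app g (0 + 1)%M).
    by move: h; rewrite kseq_0 emb_0 pw_S pw_0 => h h'; split; [|split]; lra.
  - case: (kseq_S g (j + 1)%M) => [[_ ->] //|[[]]].
    have [d1 d2] := good_diff (proj1 hx) (hg (j + 1)%M) (hg (j + 1 + 1)%M).
    have [_ [_ h]] := hg (j + 1 + 1)%M.
    by rewrite IH; split; [|split]; lra.
by exists g => j; rewrite e.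
Qed.

(** The bound falls short of the admissible error [2 / 2^n] by [2 / 2^(l + n)]. This reserve lets
    [low_or_high] raise [K] by up to 2 when clamping. *)
Lemma kseq_approx (x : M1) : inunit x -> exists g, forall l n, 2 <= emb l ->
  let K := emb (kseq g (l + n)%M) in let q := app x n in let A := pw (l + n)%M in
  pw n * (num q * A - K * den q) <= 2 * den q * A - 2 * pw n * den q /\
  pw n * (K * den q - num q * A) <= 2 * den q * A - 2 * pw n * den q.
Proof.
move=> hx; have [g hg] := kseq_of_real hx; exists g => l n hl.
have [l' ->] : exists l', l = (l' + (1 + 1))%M.
  exists (monusm l (1 + 1)%M); apply: emb_inj; rewrite emb_add monusm_emb emb_2; lra.
have := hg (l' + 1 + n)%M.
rewrite (_ : (l' + 1 + n + 1)%M = (l' + (1 + 1) + n)%M); last first.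
  by apply: emb_inj; rewrite !emb_add; ring.
set j := (l' + (1 + 1) + n)%M; move=> [g1 [g2 _]].
have [] := proj1 hx n (l' + (1 + 1) + (1 + 1))%M.
rewrite (_ : (n + (l' + (1 + 1) + (1 + 1)))%M = (j + (1 + 1))%M); last first.
  by apply: emb_inj; rewrite /j !emb_add; ring.
move: g1 g2; rewrite /ratlt emb_1 /=.
set q := app x (j + (1 + 1))%M; set q' := app x n.
have hA : pw j = 4 * pw l' * pw n by rewrite /j !pw_add pw_1; ring.
rewrite hA; move: (den_ge1 q) (den_ge1 q') (pw_ge1 n) (pw_ge1 l') (emb (kseq g j)).
move: (num q) (num q') (den q) (den q') (pw n) (pw l') => U V d e P L hd he hP hL K g1 g2 r1 r2.
have P0 : 0 <= P by lra.
have A0 : 0 <= 4 * L * P by apply: mulr_ge0; lra.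
have Pe0 : 0 <= P * e by apply: mulr_ge0; lra.
have w1 := ler_wpM2l Pe0 g1; have w2 := ler_wpM2l Pe0 g2.
have w3 := ler_wpM2l A0 (ltW r1); have w4 := ler_wpM2l A0 (ltW r2).
have d2 : 0 < 2 * d by lra.
have edP : 0 <= (e * d * P) * (L - 1) by apply: mulr_ge0; [do !apply: mulr_ge0; lra|lra].
have edP' : 0 <= e * d * P by do !apply: mulr_ge0; lra.
by split; rewrite -(ler_pM2l d2); lra.
Qed.

End Reals.

(** * Comparison with dyadic points and the diagonal real *)

Section Diagonal.
Variable m : model.
Local Notation M0 := (dom m ty0).
Local Notation M1 := (dom m ty1).
Local Notation "0" := (zero m) : model_scope.
Local Notation "1" := (one m) : model_scope.
Local Notation "a + b" := (@add m a b) : model_scope.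
Local Notation "a * b" := (@mul m a b) : model_scope.
Delimit Scope model_scope with M.
Local Open Scope ring_scope.
Local Opaque monusm pow2m pairm pfstm psndm.
Lemma clamped_bounds l lo hi g j : emb lo <= emb hi -> exists c,
  app (clamped l lo hi g) j = dyadic c (l + j)%M /\
  emb lo * pw j <= emb c /\ emb c <= emb hi * pw j.
Proof.
move=> h; eexists; split; first exact: clampedEq.
have h' : emb (lo * pow2m j)%M <= emb (hi * pow2m j)%M.
  by rewrite !emb_mul; apply: ler_wpM2r => //; apply: ltW; apply: pw_gt0.
have := h'; case: (clampE (kseq g (l + j)%M) h') => [[_ ->]|[[h1 [h2 ->]]|[_ ->]]];
  rewrite ?emb_mul -?/(pw j) => h3; split; try lra.
  by move: h1; rewrite emb_mul.
by move: h2; rewrite emb_mul.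
Qed.

(** The two rationals are at least [1 / 2^s] apart, whereas equality of reals at index [s + 2]
    admits an error of [1 / 2^(s + 1)] only. *)
Lemma separated (p e q e' s : M0) (c : zmod m) :
  emb p * pw s <= (c - 1) * pw e -> c * pw e' <= emb q * pw s ->
  ~ ratle (dyadic q e') (dyadic p e) (1 + 1)%M (s + (1 + 1))%M.
Proof.
rewrite /ratle !num_dyadic !den_dyadic emb_2 !pw_add pw_1.
move: (pw_gt0 e) (pw_gt0 e') => h h' h1 h2.
have := ler_wpM2r (ltW h') h1; have := ler_wpM2r (ltW h) h2.
by have : 0 < pw e * pw e' by [apply: mulr_gt0]; lra.
Qed.

(** The reals below [a / 2^l] form the union over [k] of the closed intervals ending at
    [a / 2^l - 1 / 2^(l + k)], and [low] ranges over the [k]-th of them. *)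
Definition low (l a k : M0) (g : M1) : M1 := clamped (l + k)%M 0%M (monusm (a * pow2m k) 1)%M g.
Definition high (l a : M0) (g : M1) : M1 := clamped l a (pow2m l) g.

(** [2 <= l] is the precision needed for [kseq_approx], and [1 <= a] makes the cutoff subtraction in
    [low] exact. *)
Definition admissible (l a : M0) : Prop := [/\ 2 <= emb l, 1 <= emb a & emb a <= pw l].

Lemma low_hi l a k : admissible l a -> emb (monusm (a * pow2m k) 1)%M = emb a * pw k - 1 /\ 0 <= emb a * pw k - 1.
Proof.
move=> [l_ge2 a_ge1 a_le].
have h : 1 <= emb a * pw k.
  by have := ler_wpM2l (ltW (lt_le_trans ltr01 a_ge1)) (pw_ge1 k); lra.
by rewrite monusm_emb emb_mul emb_1 //; split=> //; lra.
Qed.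

Lemma inunit_low l a k g : admissible l a -> inunit (low l a k g).
Proof.
move=> hla; have [l_ge2 a_ge1 a_le] := hla; have [e h] := low_hi k hla; apply: inunit_clamped.
- by rewrite emb_add; have := emb_ge0 k; lra.
- by rewrite e emb_0.
- by rewrite e pw_add; have := ler_wpM2r (ltW (pw_gt0 k)) a_le; lra.
Qed.

Lemma inunit_high l a g : admissible l a -> inunit (high l a g).
Proof. by move=> [l_ge2 a_ge1 a_le]; apply: inunit_clamped => //; lra. Qed.

Lemma low_bound l a k g n : admissible l a -> exists c, app (low l a k g) n = dyadic c (l + k + n)%M /\
  emb c <= (emb a * pw k - 1) * pw n.
Proof.
move=> hla; have [e h] := low_hi k hla.
have [|c [h1 [_ h2]]] := @clamped_bounds (l + k)%M 0%M (monusm (a * pow2m k) 1)%M g n.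
  by rewrite e emb_0.
by exists c; rewrite -e.
Qed.

Lemma high_bound l a g n : admissible l a -> exists c, app (high l a g) n = dyadic c (l + n)%M /\ emb a * pw n <= emb c.
Proof. by move=> [l_ge2 a_ge1 a_le]; have [c [h1 [h2 _]]] := clamped_bounds l g n a_le; exists c. Qed.

Lemma low_high l a k g g' : admissible l a -> ~ eqreal (low l a k g) (high l a g').
Proof.
move=> hla /(_ (l + k + (1 + 1))%M) [_].
have [c [-> h]] := low_bound k g (l + k + (1 + 1))%M hla.
have [c' [-> h']] := high_bound g' (l + k + (1 + 1))%M hla.
refine (@separated _ _ _ _ (l + k)%M (emb a * pw k) _ _).
  by rewrite (pw_add (l + k)%M); have := ler_wpM2r (ltW (pw_gt0 (l + k)%M)) h; lra.
rewrite (pw_add l); have := ler_wpM2r (ltW (pw_gt0 (l + k)%M)) h'.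
rewrite (pw_add l k); lra.
Qed.

Lemma kseq_ext (f g : M1) : (forall j, app f (j + 1)%M = app g (j + 1)%M) ->
  forall j, kseq f j = kseq g j.
Proof.
move=> h; apply: decp_ind => [||j IH].
- by apply: decp_eq; apply: repf_kseq; exact: repf_id.
- by rewrite !kseq_0.
- case: (kseq_S f j) (kseq_S g j) => [[c ->]|[c e]] [[c' e']|[c' e']].
  + by rewrite e' h.
  + by case: c'; rewrite -IH -h.
  + by case: c; rewrite IH h.
  + by apply: emb_inj; rewrite e e' IH.
Qed.

Lemma with_value_0 (g : M1) k : exists f : M1, app f 0%M = k /\ forall j, app f (j + 1)%M = app g (j + 1)%M.
Proof.
exists (eval (lam (rec (Var (vs (vs (vs vz))) @ (v1 + Defs.One))%tm (Var (vs (vs vz))) v0))%tm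
  (acons g (acons k (@anil _)))); split.
  by rewrite eval_lamE recE /= rec_0.
by move=> j; rewrite eval_lamE recE /= rec_S.
Qed.

Lemma low_or_high l a (x : M1) : admissible l a -> inunit x ->
  (exists f, eqreal x (low l a (app f 0%M) f)) \/ (exists g, eqreal x (high l a g)).
Proof.
move=> hla hx; have [l_ge2 a_ge1 a_le] := hla; have [g hg] := kseq_approx hx.
have approx l' n c : 2 <= emb l' ->
    emb (kseq g (l' + n)%M) <= emb c -> emb c <= emb (kseq g (l' + n)%M) + 2 ->
    ratle (app x n) (dyadic c (l' + n)%M) (1 + 1)%M n /\
    ratle (dyadic c (l' + n)%M) (app x n) (1 + 1)%M n.
  move=> hl h1 h2; have [h3 h4] := hg l' n hl.
  rewrite /ratle num_dyadic den_dyadic emb_2.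
  have hd := den_ge1 (app x n); have hp := pw_gt0 n.
  have hpd : 0 <= pw n * den (app x n) by apply: mulr_ge0; lra.
  have := ler_wpM2l hpd h1; have := ler_wpM2l hpd h2; move: h3 h4 => /=; split; lra.
(* In the first case the approximations never fall short of [a / 2^l] by more than the reserve, so
   clamping from below leaves the real unchanged. *)
case: (EM (forall k, emb a * pw k <= emb (kseq g (l + k)%M) + 2)) => [h|].
  right; exists g => n; rewrite clampedEq.
  have h' : emb (a * pow2m n)%M <= emb (pow2m l * pow2m n)%M.
    by rewrite !emb_mul; apply: ler_wpM2r => //; apply: ltW; apply: pw_gt0.
  have hk := kseq_le g (l + n)%M; rewrite pw_add in hk; have hn := h n.
  apply: approx => //; case: (clampE (kseq g (l + n)%M) h') => [[h1 ->]|[[h1 [h2 ->]]|[h1 ->]]] //;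
    rewrite ?emb_mul -/(pw _) -?/(pw n) in h1 *; lra.
move=> /existsNP [k /negP]; rewrite -ltNge => h; left.
(* The index [k] is stored at the unread argument 0, so that one function quantifier covers both [k]
   and the real. *)
have [f [f0 fS]] := with_value_0 g k; exists f; rewrite f0 => n; rewrite clampedEq.
have [e hi] := low_hi k hla.
have hlo : emb (0 * pow2m n)%M <= emb (monusm (a * pow2m k) 1 * pow2m n)%M.
  by rewrite !emb_mul e emb_0 mul0r; apply: mulr_ge0 => //; apply: ltW; apply: pw_gt0.
have hlk : 2 <= emb (l + k)%M by rewrite emb_add; have := emb_ge0 k; lra.
have hke := kseq_ext fS (l + k + n)%M.
have [hk _] := kseq_diff g (l + k)%M n.
(* The failure at [k] is by at least one unit, more than the later errors can make up for; so from
   precision [l + k] on clamping has no effect. *)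
have hkn : emb (kseq g (l + k + n)%M) <= (emb a * pw k - 1) * pw n.
  move: h; rewrite zmod_lt_succ => h.
  have := ler_wpM2l (ltW (pw_gt0 n)) h; have := pw_gt0 n; lra.
rewrite hke; apply: approx => //;
  case: (clampE (kseq g (l + k + n)%M) hlo) => [[h1 ->]|[[h1 [h2 ->]]|[h1 ->]]] //;
  rewrite ?emb_mul ?e ?emb_0 -?/(pw n) in h1 *; have := emb_ge0 (kseq g (l + k + n)%M); lra.
Qed.


Definition level (N : M0) : M0 := ((N + 1) + (N + 1))%M.
(* The midpoint [(4k + 2) / 4^(N+1)] of the interval from [k / 4^N] to [(k + 1) / 4^N], cut off at 1. *)
Definition midpoint (N k : M0) : M0 :=
  minm ((1 + 1) * (1 + 1) * k + (1 + 1))%M (pow2m (level N)).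

Lemma midpointE N k :
  (4 * emb k + 2 <= pw (level N) /\ emb (midpoint N k) = 4 * emb k + 2) \/
  (pw (level N) <= 4 * emb k + 2 /\ emb (midpoint N k) = pw (level N)).
Proof.
have e : emb ((1 + 1) * (1 + 1) * k + (1 + 1))%M = 4 * emb k + 2.
  by rewrite !(emb_add, emb_mul) emb_1; ring.
by rewrite -e /midpoint; case: (minmE ((1 + 1) * (1 + 1) * k + (1 + 1))%M (pow2m (level N)))
  => [[h ->]|[h ->]]; [left|right].
Qed.

Lemma admissible_midpoint N k : admissible (level N) (midpoint N k).
Proof.
have hN := emb_ge0 N; have hk := emb_ge0 k; have hp : 4 <= pw (level N).
  have -> : level N = (N + N + 1 + 1)%M by apply: emb_inj; rewrite !emb_add; ring.
  by rewrite !pw_S; have := pw_ge1 (N + N)%M; lra.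
split; first by rewrite !emb_add emb_1; lra.
  by case: (midpointE N k) => [[_ ->]|[_ ->]]; lra.
by case: (midpointE N k) => [[h ->]|[h ->]].
Qed.

Definition absdiff (a b : M0) : M0 := (monusm a b + monusm b a)%M.

Lemma absdiff_0 a b : absdiff a b = 0%M <-> a = b.
Proof.
rewrite emb_eq0 emb_add; split=> [h|->].
  have h1 := emb_ge0 (monusm a b); have h2 := emb_ge0 (monusm b a).
  have /monusm_eq0 h3 : monusm a b = 0%M by apply/emb_eq0; lra.
  have /monusm_eq0 h4 : monusm b a = 0%M by apply/emb_eq0; lra.
  by apply: emb_inj; lra.
have -> : monusm b b = 0%M by apply/monusm_eq0.
by rewrite emb_0; lra.
Qed.

(** The argument [n] codes an index [N] and a candidate [k]. Which midpoint matters at step [N]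
    depends on the earlier decisions, so Delta-comprehension is asked about all candidates at
    once. *)
Definition lowE (Y : dom m ty2) : dom m (ty1 ~> ty0 ~> ty0) :=
  let n := pfst v0 in let k := psnd v0 in let f := v1 in
  let one := Defs.One in
  let l := ((n + one) + (n + one))%tm in
  let u := ((one + one) * (one + one) * k + (one + one))%tm in
  let a := monus u (monus u (pow2 l)) in let t := (f @ Zero)%tm in
  let y := (Var (vs (vs (vs vz))) @ (v2 @ (l + t) @ Zero @ (monus (a * pow2 t) one) @ f))%tm in
  eval (lam (lam (monus y n + monus n y)%tm)) (acons (clampedE m) (acons Y (@anil _))).

Lemma lowE_eq Y f n : app (app (lowE Y) f) n =
  absdiff (app Y (low (level (pfstm n)) (midpoint (pfstm n) (psndm n)) (app f 0%M) f)) (pfstm n).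
Proof. by rewrite /lowE !eval_lamE. Qed.

Definition highE (Y : dom m ty2) : dom m (ty1 ~> ty0 ~> ty0) :=
  let n := pfst v0 in let k := psnd v0 in let f := v1 in
  let one := Defs.One in
  let l := ((n + one) + (n + one))%tm in
  let u := ((one + one) * (one + one) * k + (one + one))%tm in
  let a := monus u (monus u (pow2 l)) in
  let y := (Var (vs (vs (vs vz))) @ (v2 @ l @ a @ pow2 l @ f))%tm in
  eval (lam (lam (monus y n + monus n y)%tm)) (acons (clampedE m) (acons Y (@anil _))).

Lemma highE_eq Y f n : app (app (highE Y) f) n =
  absdiff (app Y (high (level (pfstm n)) (midpoint (pfstm n) (psndm n)) f)) (pfstm n).
Proof. by rewrite /highE !eval_lamE. Qed.

(** [k_n] stands for the interval from [k_n / 4^n] to [(k_n + 1) / 4^n]. The next interval is its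
    third quarter if [x_n] lies below the midpoint, and its first quarter otherwise. Quarters are
    taken because [x_n] may be the midpoint itself, from which the first quarter keeps a
    distance. *)
Definition dseqE (X : M1) : M1 :=
  let one := Defs.One in
  eval (lam (rec ((one + one) * (one + one) * v0 + (one + one) * (Var (vs (vs (vs vz))) @ pair v1 v0))%tm
    Zero v0)) (acons X (@anil _)).

Lemma dseq_0 X : app (dseqE X) 0%M = 0%M.
Proof. by rewrite /dseqE eval_lamE recE /= rec_0. Qed.

Lemma dseq_S X n : app (dseqE X) (n + 1)%M =
  ((1 + 1) * (1 + 1) * app (dseqE X) n + (1 + 1) * app X (pairm n (app (dseqE X) n)))%M.
Proof. by rewrite /dseqE !eval_lamE !recE /= rec_S. Qed.

Definition dreal (X : M1) : M1 :=
  let one := Defs.One in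
  eval (lam (pair (pair (v1 @ v0) Zero) (monus (pow2 (v0 + v0)%tm) one))) (acons (dseqE X) (@anil _)).

Lemma dreal_eq X n : app (dreal X) n = dyadic (app (dseqE X) n) (n + n)%M.
Proof. by rewrite /dreal eval_lamE. Qed.

Section Sequence.
Variable X : M1.
Hypothesis X01 : forall n, app X n = 0%M \/ app X n = 1%M.

Lemma dseq_bounds n t : let k := emb (app (dseqE X) n) in let k' := emb (app (dseqE X) (n + t)%M) in
  pw t * pw t * k <= k' /\ k' <= pw t * pw t * k + pw t * pw t - 1.
Proof.
pose P t := emb (pow2m t * pow2m t * app (dseqE X) n)%M <= emb (app (dseqE X) (n + t)%M) /\
  emb (app (dseqE X) (n + t) + 1)%M <= emb (pow2m t * pow2m t * app (dseqE X) n + pow2m t * pow2m t)%M.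
have : P t.
  move: t; apply: decp_ind => [||t].
  - by apply: decp_and; apply: decp_le; prove_repf.
  - by rewrite /P !(emb_add, emb_mul) -/(pw _) pw_0 add_0 emb_1; split; lra.
  - rewrite /P !(emb_add, emb_mul) -!/(pw _) pw_S -addA dseq_S !(emb_add, emb_mul) emb_1.
    by case: (X01 (pairm (n + t)%M (app (dseqE X) (n + t)%M))) => ->; rewrite ?emb_0 ?emb_1 => -[h1 h2];
      split; lra.
by rewrite /P !(emb_add, emb_mul) -!/(pw _) emb_1 => -[h1 h2] /=; split; lra.
Qed.

Lemma dseq_le n : emb (app (dseqE X) n) <= pw n * pw n - 1.
Proof.
have [_] := dseq_bounds 0%M n; rewrite addC add_0 dseq_0 emb_0; lra.
Qed.

Lemma inunit_dreal : inunit (dreal X).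
Proof.
apply: (inunit_dyadic (dreal_eq X)) => [j|j t]; first by rewrite pw_add; have := dseq_le j; lra.
have [h1 h2] := dseq_bounds j t; rewrite !pw_add.
move: h1 h2 (pw_ge1 j) (pw_ge1 t) => /=; move: (emb _) (emb _) => k k'.
move: (pw j) (pw t) => P T h1 h2 hP hT.
have P0 : 0 < P by lra.
have PPP : 0 < P * (P * P) by do !apply: mulr_gt0.
have PPPP : 0 <= (P * P * (P * P) - P * (P * P)) * (T * T).
  apply: mulr_ge0; last by apply: mulr_ge0; lra.
  have : 0 <= (P - 1) * (P * (P * P)) by apply: mulr_ge0; lra.
  lra.
have w1 := ler_wpM2l (ltW PPP) h1; have w2 := ler_wpM2l (ltW PPP) h2.
have : 0 < P * P * (P * P) * (T * T) by do !apply: mulr_gt0; lra.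
by move=> w3; split; lra.
Qed.

(** Along the sequence [k] is at most [4^N - 1], so the cutoff at 1 in [midpoint] is not reached. *)
Lemma midpoint_dseq N : emb (midpoint N (app (dseqE X) N)) = 4 * emb (app (dseqE X) N) + 2.
Proof.
have h := dseq_le N; case: (midpointE N (app (dseqE X) N)) => [[_ ->] //|[h' _]].
by move: h'; rewrite /level pw_add !pw_S; lra.
Qed.

(** The diagonal real may equal the midpoint; the gap comes from the margin [1 / 2^(level N + t)] in
    [low]. *)
Lemma dreal_not_low N f t : app X (pairm N (app (dseqE X) N)) = 1%M ->
  ~ eqreal (low (level N) (midpoint N (app (dseqE X) N)) t f) (dreal X).
Proof.
set k := app (dseqE X) N; move=> hX; pose s := (N + 1 + t + (1 + 1))%M.
have E : (level N + t + (1 + 1))%M = (N + 1 + s)%M.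
  by apply: emb_inj; rewrite /level /s !emb_add; ring.
move=> /(_ (level N + t + (1 + 1))%M) [_].
have [c [-> h]] := low_bound t f (level N + t + (1 + 1))%M (admissible_midpoint N k).
have [h1 _] := dseq_bounds (N + 1)%M s; rewrite dseq_S hX !(emb_add, emb_mul) emb_1 in h1.
rewrite dreal_eq E; move: h1; rewrite -E => h1.
refine (@separated _ _ _ _ (level N + t)%M (emb (midpoint N k) * pw t) _ _).
  by rewrite (pw_add (level N + t)%M); have := ler_wpM2r (ltW (pw_gt0 (level N + t)%M)) h; lra.
rewrite midpoint_dseq -/k E (pw_add (level N) t) /level (pw_add (N + 1 + s)%M) !(pw_add (N + 1)%M).
move: h1; rewrite E -/k.
move: (emb (app (dseqE X) _)) (emb k) (pw (N + 1)%M) (pw s) (pw t) (pw_gt0 (N + 1)%M) (pw_gt0 t).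
move=> z K A S T hA hT h1.
have AAT : 0 < A * A * T by do !apply: mulr_gt0.
have := ler_wpM2r (ltW AAT) h1; lra.
Qed.

(** Here the gap is the second quarter: the diagonal real is at most [(4k + 1) / 4^(N + 1)] and the
    midpoint is [(4k + 2) / 4^(N + 1)]. *)
Lemma dreal_not_high N f : app X (pairm N (app (dseqE X) N)) = 0%M ->
  ~ eqreal (high (level N) (midpoint N (app (dseqE X) N)) f) (dreal X).
Proof.
set k := app (dseqE X) N; move=> hX; pose s := (N + 1 + (1 + 1))%M.
have E : (level N + (1 + 1))%M = (N + 1 + s)%M.
  by apply: emb_inj; rewrite /level /s !emb_add; ring.
move=> /(_ (level N + (1 + 1))%M) [h0 _]; move: h0.
have [c [-> h]] := high_bound f (level N + (1 + 1))%M (admissible_midpoint N k).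
have [_ h1] := dseq_bounds (N + 1)%M s; rewrite dseq_S hX !(emb_add, emb_mul) emb_1 emb_0 in h1.
rewrite dreal_eq; move: h1; rewrite -E => h1.
refine (@separated _ _ _ _ (level N) (emb (midpoint N k)) _ _); last first.
  by rewrite (pw_add (level N)); have := ler_wpM2r (ltW (pw_gt0 (level N))) h; lra.
rewrite midpoint_dseq -/k.
move: h1; rewrite -/k E /level (pw_add (N + 1 + s)%M) !(pw_add (N + 1)%M).
move: (emb (app (dseqE X) _)) (emb k) (pw (N + 1)%M) (pw s) (pw_gt0 (N + 1)%M).
move=> z K A S hA h1.
have AA : 0 < A * A by apply: mulr_gt0.
have := ler_wpM2r (ltW AA) h1; have := AA; lra.
Qed.

End Sequence.

Lemma no_bijection (Y : dom m ty2) :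
  (forall Y0 Y1 : dom m (ty1 ~> ty0 ~> ty0),
     (forall n, (exists f, app (app Y0 f) n = 0%M) <-> ~ (exists f, app (app Y1 f) n = 0%M)) ->
     exists X : M1, (forall n, app X n = 0%M \/ app X n = 1%M) /\
       forall n, app X n = 1%M <-> exists f, app (app Y0 f) n = 0%M) ->
  (forall x y, inunit x -> inunit y -> eqreal x y -> app Y x = app Y y) ->
  (forall x y, inunit x -> inunit y -> app Y x = app Y y -> eqreal x y) ->
  ~ (forall N, exists2 x, inunit x & app Y x = N).
Proof.
move=> delta resp inj surj.
have adm n := admissible_midpoint (pfstm n) (psndm n).
have low_iff n : (exists f, app (app (lowE Y) f) n = 0%M) <-> exists f,
    app Y (low (level (pfstm n)) (midpoint (pfstm n) (psndm n)) (app f 0%M) f) = pfstm n.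
  by split=> -[f h]; exists f; move: h; rewrite lowE_eq absdiff_0.
have high_iff n : (exists f, app (app (highE Y) f) n = 0%M) <-> exists f,
    app Y (high (level (pfstm n)) (midpoint (pfstm n) (psndm n)) f) = pfstm n.
  by split=> -[f h]; exists f; move: h; rewrite highE_eq absdiff_0.
(* The two sides exclude each other by injectivity, and one of them holds by surjectivity. *)
have excl n : (exists f, app (app (lowE Y) f) n = 0%M) <-> ~ (exists f, app (app (highE Y) f) n = 0%M).
  rewrite low_iff high_iff; split.
    move=> [f hf] [g hg]; apply: (@low_high _ _ (app f 0%M) f g (adm n)).
    apply: inj; [exact: inunit_low (adm n)|exact: inunit_high (adm n)|by rewrite hf].
  move=> hn; have [x hx hN] := surj (pfstm n).
  case: (low_or_high (adm n) hx) => [[f hf]|[g hg]].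
    by exists f; rewrite -(resp _ _ hx (inunit_low _ _ (adm n)) hf).
  by case: hn; exists g; rewrite -(resp _ _ hx (inunit_high _ (adm n)) hg).
have [X [X01 hX]] := delta _ _ excl.
(* The diagonal real has some value [N], but step [N] of its construction moved away from the only
   real with that value. *)
pose N := app Y (dreal X); pose k := app (dseqE X) N; pose n := pairm N k.
have eN : pfstm n = N by exact: pfstm_pair.
have ek : psndm n = k by exact: psndm_pair.
case: (X01 n) => hn.
  have : exists f, app (app (highE Y) f) n = 0%M.
    by apply: NNPP => h; move/excl/hX: h; rewrite hn => e; apply: (@ltm_irr m 1%M);
      rewrite -{1}e; exact: ltm_0_1.
  move/high_iff => [g]; rewrite eN ek => hg.
  apply: (dreal_not_high X01 (f := g) hn); apply: inj; [|exact: inunit_dreal|exact: hg].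
  by apply: inunit_high; apply: admissible_midpoint.
move/hX/low_iff: (hn) => [f]; rewrite eN ek => hf.
apply: (dreal_not_low X01 (f := f) hn); apply: inj; [|exact: inunit_dreal|exact: hf].
by apply: inunit_low; apply: admissible_midpoint.
Qed.

End Diagonal.

Theorem RCA0w_DeltaCA_NBI : proves RCA0w (Imp DeltaCA NBI).
Proof.
apply: extensional_completeness => M hM hext; pose m := Model hM hext.
change (sat (M := m) (Imp DeltaCA NBI) (@anil _)).
have eqE (a b : dom m ty0) : eqM a b <-> a = b by exact: (proj1 (@str_ext m)).
move=> hdelta Y hY; apply: NNPP => hn.
pose env2 (x y : dom m ty1) : assign (dom m) [ty1; ty1; ty2] :=
  acons y (acons x (acons Y (@anil _))).
apply: (@no_bijection m Y).
- move=> Y0 Y1 h.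
  have [n|X [hX hX']] := hdelta Y0 Y1.
    have [h0 h1] := h n.
    have sE (Z : dom m (ty1 ~> ty0 ~> ty0)) :
        (exists f, eqM (app (app Z f) n) (zero m)) <-> (exists f, app (app Z f) n = zero m).
      by split=> -[f hf]; exists f; apply/eqE.
    split=> [/sE /h0 hh /sE //|hh]; apply/sE/h1 => /sE //.
  exists X; split=> n; first by case: (hX n) => hh; [left|right]; apply/eqE.
  have [h1 h2] := hX' n; split.
    by move=> hh; have [f hf] := h1 (proj2 (eqE _ _) hh); exists f; apply/eqE.
  by move=> [f hf]; apply/eqE; apply: h2; exists f; apply/eqE.
- move=> x y hx hy hxy; apply/eqE; apply: (hY x y).
  split; first exact: (proj2 (sat_in_unit v1 (env2 x y)) hx).
  split; first exact: (proj2 (sat_in_unit v0 (env2 x y)) hy).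
  exact: (proj2 (sat_eq_real v1 v0 (env2 x y)) hxy).
- move=> x y hx hy hxy; apply: NNPP => hne; apply: hn; left; exists x, y.
  split; first exact: (proj2 (sat_in_unit v1 (env2 x y)) hx).
  split; first exact: (proj2 (sat_in_unit v0 (env2 x y)) hy).
  split; last exact: (proj2 (eqE _ _) hxy).
  by move=> hh; apply: hne; exact: (proj1 (sat_eq_real v1 v0 (env2 x y)) hh).
- move=> N; apply: NNPP => hN; apply: hn; right; exists N => x hx hxN; apply: hN.
  pose e : assign (dom m) [ty1; ty0; ty2] := acons x (acons N (acons Y (@anil _))).
  exists x; first exact: (proj1 (sat_in_unit v0 e) hx).
  exact: (proj1 (eqE _ _) hxN).
Qed.

Theorem theorem3p35 :
  proves RCA0w (Imp DeltaCA NBI) /\ ~ proves (extend Z2w DeltaCA) NIN.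
Proof. by split; [exact: RCA0w_DeltaCA_NBI|exact: Z2w_DeltaCA_not_NIN]. Qed.
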